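(* Let $k$ be an infinite field and let $X$ be a proper, smooth, geometrically connected $k$-variety. If $X$ is almost $\mathrm{R}$-trivial, then $H^0(X,(\Omega^i)^{\otimes m})=0$ for all integers $i>0$ and $m>0$.
   Context: $\Omega^i=\Omega^i_{X/k}$ is the sheaf of degree-$i$ Kähler differential forms of $X$ over $k$. For a field $L$ and an $L$-variety $V$, two points $A,B\in V(L)$ are elementarily $\mathrm{R}$-linked if there exist an open subset $W\subset \mathbb{P}^1_L$ and an $L$-morphism $h: W\to V$ with $A,B\in h(W(L))$. Two points $A,B\in V(L)$ are $\mathrm{R}$-equivalent if there is a chain $A=A_1,\dots,A_n=B$ in $V(L)$ with $A_i$ and $A_{i+1}$ elementarily $\mathrm{R}$-linked for each $i$. The quotient of $V(L)$ by this equivalence relation is denoted $V(L)/\mathrm{R}$. For a field $L\supset k$ and a $k$-variety $X$, $X(L)/\mathrm{R}$ means $X_L(L)/\mathrm{R}$ computed over $L$, where $X_L=X\times_k L$. An integral $k$-variety $X$ is almost $\mathrm{R}$-trivial if there is a dense Zariski open subset $U\subset X$ such that for every field $L$ containing $k$ the image of $U(L)$ in $X(L)/\mathrm{R}$ has exactly one element. *)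

(* Defs.v *)
(* Rings of sections are comPzRingType since the zero ring occurs, over the
   empty open set. *)

From HB Require Import structures.
From mathcomp Require mpoly.
(* first and without its notations, which clash with those below *)
Import -(notations) mpoly.
From mathcomp Require Import all_boot all_order all_algebra.
From mathcomp Require Import boolp classical_sets functions cardinality topology.

Set Implicit Arguments.
Unset Strict Implicit.
Unset Printing Implicit Defensive.

Import GRing.Theory.
Local Open Scope classical_set_scope.
Local Open Scope ring_scope.
Local Open Scope quotient_scope.

Section Presentation.
Variables (A : comPzRingType) (G : choiceType) (rel : set (seq (A * G))).

Definition fscale (a : A) (s : seq (A * G)) : seq (A * G) :=
  [seq (a * p.1, p.2) | p <- s].

(* The list [:: (a1, g1); ...; (an, gn)] stands for a1 g1 + ... + an gn;
   rel is the set of those formal combinations that are imposed to vanish. *)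
Inductive pres_eq : seq (A * G) -> seq (A * G) -> Prop :=
| pres_refl s : pres_eq s s
| pres_sym s t : pres_eq s t -> pres_eq t s
| pres_trans s t u : pres_eq s t -> pres_eq t u -> pres_eq s u
| pres_cat s s' t t' :
    pres_eq s s' -> pres_eq t t' -> pres_eq (s ++ t) (s' ++ t')
| pres_catC s t : pres_eq (s ++ t) (t ++ s)
| pres_fscale a s t : pres_eq s t -> pres_eq (fscale a s) (fscale a t)
| pres_add a b g : pres_eq [:: (a, g); (b, g)] [:: (a + b, g)]
| pres_zero g : pres_eq [:: (0, g)] [::]
| pres_rel r : rel r -> pres_eq r [::].

Definition pres_eqb (s t : seq (A * G)) : bool := `[< pres_eq s t >].

Lemma pres_eqb_refl : reflexive pres_eqb.
Proof. by move=> s; apply/asboolP/pres_refl. Qed.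

Lemma pres_eqb_sym : symmetric pres_eqb.
Proof. by move=> s t; apply/asboolP/asboolP => /pres_sym. Qed.

Lemma pres_eqb_trans : transitive pres_eqb.
Proof.
by move=> t s u /asboolP st /asboolP tu; apply/asboolP/(pres_trans st tu).
Qed.

Canonical pres_equiv :=
  EquivRel pres_eqb pres_eqb_refl pres_eqb_sym pres_eqb_trans.

Definition pres : Type := {eq_quot pres_equiv}.
HB.instance Definition _ : EqQuotient _ pres_equiv pres :=
  EqQuotient.on pres.
HB.instance Definition _ := Choice.on pres.

Lemma pres_piP s t : reflect (pres_eq s t) (\pi_pres s == \pi_pres t).
Proof.
apply: (iffP eqP) => [/eqmodP/asboolP //|st].
by apply/eqmodP/asboolP.
Qed.

Lemma pres_pi_eq s t : pres_eq s t -> \pi_pres s = \pi_pres t.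
Proof. by move/pres_piP/eqP. Qed.

Lemma pres_repr s : pres_eq (repr (\pi_pres s)) s.
Proof. by apply/pres_piP; rewrite reprK. Qed.

Definition padd (x y : pres) : pres := \pi_pres (repr x ++ repr y).
Definition pscale (a : A) (x : pres) : pres := \pi_pres (fscale a (repr x)).
Definition popp (x : pres) : pres := pscale (-1) x.
Definition pzero : pres := \pi_pres [::].

Lemma padd_pi s t : padd (\pi_pres s) (\pi_pres t) = \pi_pres (s ++ t).
Proof. by apply: pres_pi_eq; apply: pres_cat; apply: pres_repr. Qed.

Lemma pscale_pi a s : pscale a (\pi_pres s) = \pi_pres (fscale a s).
Proof. by apply: pres_pi_eq; apply: pres_fscale; apply: pres_repr. Qed.

Lemma presW (P : pres -> Prop) : (forall s, P (\pi_pres s)) -> forall x, P x.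
Proof. by move=> Ps x; rewrite -[x]reprK. Qed.

Lemma paddA : associative padd.
Proof.
elim/presW=> s; elim/presW=> t; elim/presW=> u.
by rewrite !padd_pi catA.
Qed.

Lemma paddC : commutative padd.
Proof.
elim/presW=> s; elim/presW=> t; rewrite !padd_pi.
exact/pres_pi_eq/pres_catC.
Qed.

Lemma padd0 : left_id pzero padd.
Proof. by elim/presW=> s; rewrite padd_pi. Qed.

Lemma fscaleA a b s : fscale a (fscale b s) = fscale (a * b) s.
Proof. by rewrite /fscale -map_comp; apply: eq_map => p /=; rewrite mulrA. Qed.

Lemma fscale1 s : fscale 1 s = s.
Proof.
by rewrite /fscale -[RHS]map_id; apply: eq_map => -[a g] /=; rewrite mul1r.
Qed.

Lemma fscaleDl a b s : pres_eq (fscale a s ++ fscale b s) (fscale (a + b) s).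
Proof.
elim: s => [|[c g] s IHs]; first exact: pres_refl.
set u := [:: (a * c, g)]; set v := [:: (b * c, g)].
have sw : pres_eq ((u ++ fscale a s) ++ (v ++ fscale b s))
    ((u ++ v) ++ (fscale a s ++ fscale b s)).
  rewrite -!catA; apply: pres_cat; first exact: pres_refl.
  rewrite !catA; apply: pres_cat; last exact: pres_refl.
  exact: pres_catC.
apply: (pres_trans sw).
rewrite -[fscale (a + b) _]/([:: ((a + b) * c, g)] ++ fscale (a + b) s) mulrDl.
by apply: pres_cat => //; apply: pres_add.
Qed.

Lemma fscale0 s : pres_eq (fscale 0 s) [::].
Proof.
elim: s => [|[c g] s IHs]; first exact: pres_refl.
rewrite /= mul0r -cat1s -[[::]]/([::] ++ [::]).
by apply: pres_cat => //; apply: pres_zero.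
Qed.

Lemma paddN : left_inverse pzero popp padd.
Proof.
elim/presW=> s; rewrite /popp pscale_pi padd_pi; apply: pres_pi_eq.
rewrite -{2}[s]fscale1.
by apply: pres_trans (fscaleDl _ _ _) _; rewrite addNr; apply: fscale0.
Qed.

HB.instance Definition _ :=
  GRing.isZmodule.Build pres paddA paddC padd0 paddN.

Lemma pscaleA a b x : pscale a (pscale b x) = pscale (a * b) x.
Proof. by elim/presW: x => s; rewrite !pscale_pi fscaleA. Qed.

Lemma pscale1 : left_id 1 pscale.
Proof. by elim/presW=> s; rewrite pscale_pi fscale1. Qed.

Lemma pscaleDr : right_distributive pscale +%R.
Proof.
move=> a; elim/presW=> s; elim/presW=> t.
rewrite -[_ + _]/(padd _ _) -[RHS]/(padd _ _) padd_pi !pscale_pi padd_pi.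
by rewrite /fscale map_cat.
Qed.

Lemma pscaleDl x : {morph pscale^~ x : a b / a + b}.
Proof.
elim/presW: x => s a b; rewrite -[RHS]/(padd _ _) !pscale_pi padd_pi.
exact/pres_pi_eq/pres_sym/fscaleDl.
Qed.

HB.instance Definition _ := GRing.Zmodule_isLmodule.Build A pres
  pscaleA pscale1 pscaleDr pscaleDl.

Definition pgen (g : G) : pres := \pi_pres [:: (1, g)].

End Presentation.

Section PresentationMap.
Variables (A B : comPzRingType) (G H : choiceType).
Variables (relA : set (seq (A * G))) (relB : set (seq (B * H))).
Variables (rho : {rmorphism A -> B}) (phi : G -> H).

Definition fmap (s : seq (A * G)) : seq (B * H) :=
  [seq (rho p.1, phi p.2) | p <- s].

(* Defined through a representative; pres_map_pi shows that the choice does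
   not matter as soon as relations are sent to relations. *)
Definition pres_map (x : pres relA) : pres relB :=
  \pi_(pres relB) (fmap (repr x)).

Hypothesis fmap_rel : forall r, relA r -> pres_eq relB (fmap r) [::].

Lemma fmap_eq s t : pres_eq relA s t -> pres_eq relB (fmap s) (fmap t).
Proof.
elim=> {s t} [s|s t _ |s t u _ st _|s s' t t' _ ss' _ tt'|s t|a s t _ st
             |a b g|g|r rel_r].
- exact: pres_refl.
- exact: pres_sym.
- exact: pres_trans.
- by rewrite /fmap !map_cat; apply: pres_cat.
- by rewrite /fmap !map_cat; apply: pres_catC.
- have fmapZ u : fmap (fscale a u) = fscale (rho a) (fmap u).
    rewrite /fmap /fscale -!map_comp; apply: eq_map => p /=.
    by rewrite rmorphM.
  by rewrite !fmapZ; apply: pres_fscale.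
- by rewrite /fmap /= rmorphD; apply: pres_add.
- by rewrite /fmap /= rmorph0; apply: pres_zero.
- exact: fmap_rel.
Qed.

Lemma pres_map_pi s : pres_map (\pi_(pres relA) s) = \pi_(pres relB) (fmap s).
Proof. exact/pres_pi_eq/fmap_eq/pres_repr. Qed.

Lemma pres_mapD x y : pres_map (x + y) = pres_map x + pres_map y.
Proof.
elim/presW: x => s; elim/presW: y => t.
rewrite -[_ + _]/(padd _ _) -[RHS]/(padd _ _) padd_pi !pres_map_pi padd_pi.
by rewrite /fmap map_cat.
Qed.

Lemma pres_mapZ a x : pres_map (a *: x) = rho a *: pres_map x.
Proof.
elim/presW: x => s.
rewrite -[_ *: _]/(pscale _ _) -[RHS]/(pscale _ _) pscale_pi !pres_map_pi.
rewrite pscale_pi /fmap /fscale -!map_comp; congr (\pi _).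
by apply: eq_map => p /=; rewrite rmorphM.
Qed.

Lemma pres_map_gen g : pres_map (pgen relA g) = pgen relB (phi g).
Proof. by rewrite pres_map_pi /fmap /= rmorph1. Qed.

End PresentationMap.

Section Forms.

(* Omega_{A/k}, with universal derivation d a = pgen a *)
Inductive Omega_rel (k A : comPzRingType) (str : {rmorphism k -> A}) :
    set (seq (A * A)) :=
| Omega_add (a b : A) :
    Omega_rel str [:: (1, a + b); (-1, a); (-1, b)]
| Omega_leibniz (a b : A) :
    Omega_rel str [:: (1, a * b); (- a, b); (- b, a)]
| Omega_cst (c : k) : Omega_rel str [:: (1, str c)].

Definition Omega (k A : comPzRingType) (str : {rmorphism k -> A}) : lmodType A :=
  pres (Omega_rel str).

Definition upd (A : comPzRingType) (M : lmodType A) n (f : {ffun 'I_n -> M})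
    (j : 'I_n) (x : M) : {ffun 'I_n -> M} :=
  [ffun l => if l == j then x else f l].

Inductive tens_rel (A : comPzRingType) (n : nat) (M : lmodType A) :
    set (seq (A * {ffun 'I_n -> M})) :=
| tens_add (f : {ffun 'I_n -> M}) j x y :
    tens_rel [:: (1, upd f j (x + y)); (-1, upd f j x); (-1, upd f j y)]
| tens_scale (f : {ffun 'I_n -> M}) j a x :
    tens_rel [:: (1, upd f j (a *: x)); (- a, upd f j x)].

Inductive ext_rel (A : comPzRingType) (n : nat) (M : lmodType A) :
    set (seq (A * {ffun 'I_n -> M})) :=
| ext_multilinear r : tens_rel r -> ext_rel r
| ext_alternating (f : {ffun 'I_n -> M}) (j l : 'I_n) :
    j != l -> f j = f l -> ext_rel [:: (1, f)].

Definition tens_pow (A : comPzRingType) (m : nat) (M : lmodType A) : lmodType A :=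
  pres (@tens_rel A m M).

Definition ext_pow (A : comPzRingType) (i : nat) (M : lmodType A) : lmodType A :=
  pres (@ext_rel A i M).

(* (/\^i_A Omega_{A/k})^{(x)_A m} *)
Definition forms (k A : comPzRingType) (str : {rmorphism k -> A}) (i m : nat) :
    lmodType A :=
  tens_pow m (ext_pow i (Omega str)).

Definition Omega_map (k A B : comPzRingType)
    (strA : {rmorphism k -> A}) (strB : {rmorphism k -> B})
    (rho : {rmorphism A -> B}) : Omega strA -> Omega strB :=
  pres_map (Omega_rel strB) rho rho.

Definition ffun_map (M N : Type) n (phi : M -> N) (f : {ffun 'I_n -> M}) :
    {ffun 'I_n -> N} :=
  [ffun l => phi (f l)].

Definition tens_map (A B : comPzRingType) (rho : {rmorphism A -> B}) m
    (M : lmodType A) (N : lmodType B) (phi : M -> N) :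
    tens_pow m M -> tens_pow m N :=
  pres_map (@tens_rel B m N) rho (ffun_map phi).

Definition ext_map (A B : comPzRingType) (rho : {rmorphism A -> B}) i
    (M : lmodType A) (N : lmodType B) (phi : M -> N) :
    ext_pow i M -> ext_pow i N :=
  pres_map (@ext_rel B i N) rho (ffun_map phi).

Definition forms_map (k A B : comPzRingType)
    (strA : {rmorphism k -> A}) (strB : {rmorphism k -> B})
    (rho : {rmorphism A -> B}) i m : forms strA i m -> forms strB i m :=
  tens_map rho (ext_map rho (Omega_map strB rho)).

Lemma Omega_map_rel (k A B : comPzRingType)
    (strA : {rmorphism k -> A}) (strB : {rmorphism k -> B})
    (rho : {rmorphism A -> B}) r :
  (forall c, rho (strA c) = strB c) ->
  Omega_rel strA r -> pres_eq (Omega_rel strB) (fmap rho rho r) [::].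
Proof.
move=> rho_str [a b|a b|c]; apply: pres_rel; rewrite /fmap /=.
- by rewrite rmorphD rmorphN rmorph1; apply: Omega_add.
- by rewrite rmorphM !rmorphN rmorph1; apply: Omega_leibniz.
- by rewrite rho_str rmorph1; apply: Omega_cst.
Qed.

Section MultilinearMap.
Variables (A B : comPzRingType) (rho : {rmorphism A -> B}).
Variables (M : lmodType A) (N : lmodType B) (phi : M -> N).
Hypothesis phiD : forall x y, phi (x + y) = phi x + phi y.
Hypothesis phiZ : forall a x, phi (a *: x) = rho a *: phi x.

Lemma ffun_map_upd n (f : {ffun 'I_n -> M}) j x :
  ffun_map phi (upd f j x) = upd (ffun_map phi f) j (phi x).
Proof. by apply/ffunP => l; rewrite !ffunE; case: eqP. Qed.

Lemma tens_rel_map n r :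
  @tens_rel A n M r -> @tens_rel B n N (fmap rho (ffun_map phi) r).
Proof.
case=> [f j x y|f j a x]; rewrite /fmap /= !ffun_map_upd rmorph1 rmorphN.
- by rewrite rmorph1 phiD; apply: tens_add.
- by rewrite phiZ; apply: tens_scale.
Qed.

Lemma ext_rel_map n r :
  @ext_rel A n M r -> @ext_rel B n N (fmap rho (ffun_map phi) r).
Proof.
case=> [{}r /tens_rel_map|f j l jl fjl]; first exact: ext_multilinear.
rewrite /fmap /= rmorph1; apply: (ext_alternating jl).
by rewrite !ffunE fjl.
Qed.

End MultilinearMap.

Section FormsMap.
Variables (k A B : comPzRingType).
Variables (strA : {rmorphism k -> A}) (strB : {rmorphism k -> B}).
Variables (rho : {rmorphism A -> B}) (i m : nat).
Hypothesis rho_str : forall c, rho (strA c) = strB c.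

Let omap : Omega strA -> Omega strB := Omega_map strB rho.

Let omapD x y : omap (x + y) = omap x + omap y.
Proof. by apply: pres_mapD => r; apply: Omega_map_rel. Qed.

Let omapZ a x : omap (a *: x) = rho a *: omap x.
Proof. by apply: pres_mapZ => r; apply: Omega_map_rel. Qed.

Let emap : ext_pow i (Omega strA) -> ext_pow i (Omega strB) := ext_map rho omap.

Let emapD x y : emap (x + y) = emap x + emap y.
Proof. by apply: pres_mapD => r rr; apply/pres_rel/ext_rel_map. Qed.

Let emapZ a x : emap (a *: x) = rho a *: emap x.
Proof. by apply: pres_mapZ => r rr; apply/pres_rel/ext_rel_map. Qed.

Lemma forms_mapD (x y : forms strA i m) :
  forms_map strB rho (x + y) = forms_map strB rho x + forms_map strB rho y.
Proof. by apply: pres_mapD => r rr; apply/pres_rel/tens_rel_map. Qed.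

Lemma forms_mapZ a (x : forms strA i m) :
  forms_map strB rho (a *: x) = rho a *: forms_map strB rho x.
Proof. by apply: pres_mapZ => r rr; apply/pres_rel/tens_rel_map. Qed.

(* forms_map sends (x)_j (/\_l d b_jl) to (x)_j (/\_l d (rho b_jl)) *)
Lemma forms_map_gen (b : 'I_m -> 'I_i -> A) :
  forms_map strB rho (pgen (@tens_rel A m (ext_pow i (Omega strA)))
    [ffun j => pgen (@ext_rel A i (Omega strA))
       [ffun l => pgen (Omega_rel strA) (b j l)]]) =
  pgen (@tens_rel B m (ext_pow i (Omega strB)))
    [ffun j => pgen (@ext_rel B i (Omega strB))
       [ffun l => pgen (Omega_rel strB) (rho (b j l))]].
Proof.
rewrite /forms_map /tens_map pres_map_gen; last first.
  by move=> r rr; apply/pres_rel/tens_rel_map.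
congr (pgen _ _); apply/ffunP => j; rewrite !ffunE /ext_map pres_map_gen.
  congr (pgen _ _); apply/ffunP => l; rewrite !ffunE /Omega_map pres_map_gen //.
  by move=> r; apply: Omega_map_rel.
by move=> r rr; apply/pres_rel/ext_rel_map.
Qed.

End FormsMap.

End Forms.

Record opens (T : topologicalType) :=
  Opens { oset :> set T ; oset_open : open oset }.

Definition opens_mem (T : topologicalType) (U : opens T) (x : T) : Prop :=
  oset U x.
Coercion opens_mem : opens >-> Funclass.

Definition oT (T : topologicalType) : opens T := Opens openT.

Lemma preim_open (S T : topologicalType) (f : S -> T) (cf : continuous f)
  (V : opens T) : open (f @^-1` V).
Proof. by move/continuousP: cf; apply; apply: oset_open. Qed.

Definition preim (S T : topologicalType) (f : S -> T) (cf : continuous f)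
  (V : opens T) : opens S := Opens (preim_open cf V).

Definition invertible (A : comPzRingType) (a : A) := exists b : A, a * b = 1.

Record ringed_space := RingedSpace {
  points :> topologicalType ;
  sec : opens points -> comPzRingType ;
  res : forall U V : opens points, V `<=` U -> {rmorphism sec U -> sec V} ;
  res_id : forall (U : opens points) (h : U `<=` U) (s : sec U), res h s = s ;
  res_res : forall (U V W : opens points) (hV : V `<=` U) (hW : W `<=` V)
    (h : W `<=` U) (s : sec U), res hW (res hV s) = res h s ;
  sec_separated : forall (U : opens points) (F : set (opens points)) (s : sec U),
    U = \bigcup_(V in F) V :> set points ->
    (forall (V : opens points) (h : V `<=` U), F V -> res h s = 0) -> s = 0 ;
  (* only the values s V with V in F matter *)
  sec_glue : forall (U : opens points) (F : set (opens points))
      (s : forall V, sec V),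
    U = \bigcup_(V in F) V :> set points ->
    (forall (V V' W : opens points) (h : W `<=` V) (h' : W `<=` V'), F V -> F V' ->
       res h (s V) = res h' (s V')) ->
    exists t : sec U,
      forall (V : opens points) (h : V `<=` U), F V -> res h t = s V }.

(* The points of U at which the germ of f is invertible in the stalk. *)
Definition basic_set (X : ringed_space) (U : opens X) (f : sec U) : set X :=
  [set x | exists (V : opens X) (h : V `<=` U), V x /\ invertible (res h f)].

Lemma basic_set_open (X : ringed_space) (U : opens X) (f : sec U) :
  open (basic_set f).
Proof.
rewrite openE => x [V [h [Vx fV]]]; rewrite /interior nbhsE.
by exists V; [split=> //; apply: oset_open | move=> y Vy; exists V, h].
Qed.

Definition basic (X : ringed_space) (U : opens X) (f : sec U) : opens X :=
  Opens (basic_set_open f).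

Lemma basic_sub (X : ringed_space) (U : opens X) (f : sec U) : basic f `<=` U.
Proof. by move=> x [V [VU [Vx _]]]; apply: VU. Qed.

Definition prime_ideal (A : comPzRingType) (p : set A) :=
  [/\ forall a b, p a -> p b -> p (a + b),
      forall a b, p b -> p (a * b),
      p 0, ~ p 1
    & forall a b, p (a * b) -> p a \/ p b].

(* U is affine when the canonical morphism U -> Spec O(U),
   x |-> {f | f is not invertible at x}, is an isomorphism: bijective, open
   (the D(f) form a basis) and with O(D(f)) = O(U)_f for all f. *)
Definition affine (X : ringed_space) (U : opens X) :=
  [/\ forall p : set (sec U), prime_ideal p ->
        exists! x, U x /\ p = [set f | ~ basic f x],
      forall x, U x -> prime_ideal [set f : sec U | ~ basic f x],
      forall (V : opens X) x, V `<=` U -> V x ->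
        exists f : sec U, basic f x /\ basic f `<=` V
    & forall f : sec U,
        (forall s : sec (basic f), exists n (a : sec U),
           res (@basic_sub X U f) (f ^+ n) * s = res (@basic_sub X U f) a) /\
        (forall a : sec U, res (@basic_sub X U f) a = 0 ->
           exists n, f ^+ n * a = 0) ].

Record scheme := Scheme {
  scheme_space :> ringed_space ;
  (* the stalks are local rings *)
  stalk_nontrivial : forall x (U : opens scheme_space),
    ~ basic (0 : sec U) x ;
  stalk_local : forall x (U : opens scheme_space) (f g : sec U),
    basic (f + g) x -> basic f x \/ basic g x ;
  affine_cover : forall x : scheme_space,
    exists U : opens scheme_space, U x /\ affine U }.

Record morphism (X Y : scheme) := Morphism {
  mor :> X -> Y ;
  mor_cont : continuous mor ;
  pull : forall V : opens Y, {rmorphism sec V -> sec (preim mor_cont V)} ;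
  pull_res : forall (V W : opens Y) (h : W `<=` V)
    (h' : preim mor_cont W `<=` preim mor_cont V) (s : sec V),
    res h' (pull V s) = pull W (res h s) ;
  pull_local : forall (V : opens Y) (s : sec V) x,
    basic (pull V s) x -> basic s (mor x) }.

Definition mpreim (X Y : scheme) (f : morphism X Y) (V : opens Y) : opens X :=
  preim (@mor_cont X Y f) V.

(* Equality of morphisms; sections are compared after restriction since
   mpreim f V and mpreim g V are not convertible. *)
Definition mor_eq (X Y : scheme) (f g : morphism X Y) :=
  (forall x, f x = g x) /\
  forall (V : opens Y) (s : sec V) (W : opens X)
    (hf : W `<=` mpreim f V) (hg : W `<=` mpreim g V),
    res hf (pull f V s) = res hg (pull g V s).

Section Composition.
Variables (X Y Z : scheme) (g : morphism Y Z) (f : morphism X Y).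

Lemma comp_cont : continuous (g \o f).
Proof.
by move=> x; apply: continuous_comp; apply: mor_cont.
Qed.

Lemma comp_preim_sub (V : opens Z) :
  preim comp_cont V `<=` mpreim f (mpreim g V).
Proof. by []. Qed.

Definition comp_pull (V : opens Z) :
    {rmorphism sec V -> sec (preim comp_cont V)} :=
  res (@comp_preim_sub V) \o (pull f (mpreim g V) \o pull g V).

Lemma comp_pull_res (V W : opens Z) (h : W `<=` V)
    (h' : preim comp_cont W `<=` preim comp_cont V) (s : sec V) :
  res h' (comp_pull V s) = comp_pull W (res h s).
Proof.
have hg : mpreim g W `<=` mpreim g V by move=> x /h.
have hf : mpreim f (mpreim g W) `<=` mpreim f (mpreim g V) by move=> x /hg.
rewrite /= -(pull_res h hg) -(pull_res hg hf).
have h3 : preim comp_cont W `<=` mpreim f (mpreim g V) by move=> x /h.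
by rewrite !(res_res _ _ h3).
Qed.

Lemma basic_res (T : scheme) (U V : opens T) (h : V `<=` U) (s : sec U) x :
  basic (res h s) x -> basic s x.
Proof.
move=> [W [hW [Wx inv]]]; have hWU : W `<=` U by move=> y /hW /h.
by exists W, hWU; split=> //; rewrite -(res_res h hW).
Qed.

Lemma comp_pull_local (V : opens Z) (s : sec V) x :
  basic (comp_pull V s) x -> basic s ((g \o f) x).
Proof. by move=> h; do 2!apply: pull_local; apply: basic_res h. Qed.

Definition mcomp : morphism X Z := Morphism comp_pull_res comp_pull_local.

End Composition.

Section Identity.
Variable X : scheme.

Lemma id_cont : continuous (@id X).
Proof. by move=> x; apply: cvg_id. Qed.

Lemma id_preim_sub (V : opens X) : preim id_cont V `<=` V. Proof. by []. Qed.

Definition id_pull (V : opens X) : {rmorphism sec V -> sec (preim id_cont V)} :=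
  res (@id_preim_sub V).

Lemma id_pull_res (V W : opens X) (h : W `<=` V)
    (h' : preim id_cont W `<=` preim id_cont V) (s : sec V) :
  res h' (id_pull V s) = id_pull W (res h s).
Proof.
have h3 : preim id_cont W `<=` V by move=> x /h.
by rewrite /= !(res_res _ _ h3).
Qed.

Lemma id_pull_local (V : opens X) (s : sec V) x :
  basic (id_pull V s) x -> basic s x.
Proof. exact: basic_res. Qed.

Definition idm : morphism X X := Morphism id_pull_res id_pull_local.

End Identity.

Definition open_immersion (X Y : scheme) (j : morphism X Y) :=
  [/\ injective j,
      forall U : set X, open U -> open (j @` U)
    & forall V : opens Y, V `<=` range j -> bijective (pull j V)].

Definition closed_immersion (X Y : scheme) (j : morphism X Y) :=
  [/\ injective j,
      forall Z : set X, closed Z -> closed (j @` Z)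
    & forall (V : opens Y) (s : sec (mpreim j V)) y, V y ->
        exists (W : opens Y) (h : mpreim j W `<=` mpreim j V) (t : sec W),
          [/\ W `<=` V, W y & pull j W t = res h s] ].

(* A k-scheme: a morphism X -> Spec k amounts to a ring map k -> O(X). *)
Record kscheme (k : fieldType) := KScheme {
  total :> scheme ;
  str : {rmorphism k -> sec (oT total)} }.

Definition scal (k : fieldType) (X : kscheme k) (U : opens X) :
    {rmorphism k -> sec U} :=
  res (@subsetT _ U : U `<=` oT X) \o str X.

Record kmorphism (k : fieldType) (X Y : kscheme k) := KMorphism {
  kmor :> morphism X Y ;
  kmor_scal : forall (V : opens Y) (c : k),
    pull kmor V (scal V c) = scal (mpreim kmor V) c }.

(* An L-scheme seen as a k-scheme through a field extension L/k. *)
Definition restr (k L : fieldType) (iota : {rmorphism k -> L}) (Y : kscheme L) :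
    kscheme k :=
  @KScheme k Y (str Y \o iota).

(* P, with projections p and q, is the fibre product of X and Y over Spec k.
   Fibre products exist and are unique up to a unique isomorphism, so that the
   existential quantifiers over them below are statements on X x_k Y itself. *)
Definition fiber_product (k : fieldType) (X Y P : kscheme k)
    (p : kmorphism P X) (q : kmorphism P Y) :=
  forall (Z : kscheme k) (a : kmorphism Z X) (b : kmorphism Z Y),
    (exists u : kmorphism Z P, mor_eq (mcomp p u) a /\ mor_eq (mcomp q u) b) /\
    (forall u v : kmorphism Z P,
       mor_eq (mcomp p u) (mcomp p v) -> mor_eq (mcomp q u) (mcomp q v) ->
       mor_eq u v).

(* Y, with projection p, is the base change X_L = X x_k L. *)
Definition base_change (k L : fieldType) (iota : {rmorphism k -> L})
    (X : kscheme k) (Y : kscheme L) (p : kmorphism (restr iota Y) X) :=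
  forall (Z : kscheme L) (a : kmorphism (restr iota Z) X),
    (exists u : kmorphism Z Y, mor_eq (mcomp p u) a) /\
    (forall u v : kmorphism Z Y,
       mor_eq (mcomp p u) (mcomp p v) -> mor_eq u v).

Definition separated (k : fieldType) (X : kscheme k) :=
  exists (P : kscheme k) (p q : kmorphism P X),
    fiber_product p q /\
    exists delta : kmorphism X P,
      [/\ mor_eq (mcomp p delta) (idm X), mor_eq (mcomp q delta) (idm X)
        & closed_immersion delta].

Definition fin_gen (k : fieldType) (A : comPzRingType) (str : {rmorphism k -> A}) :=
  exists n (pi : {rmorphism mpoly n k -> A}),
    (forall c, pi (mpolyC n c) = str c) /\ (forall a, exists p, pi p = a).

Definition finite_type (k : fieldType) (X : kscheme k) :=
  exists n (U : 'I_n -> opens X),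
    (forall x, exists j, U j x) /\
    forall j, affine (U j) /\ fin_gen (scal (U j)).

Definition variety (k : fieldType) (X : kscheme k) :=
  separated X /\ finite_type X.

Definition universally_closed (k : fieldType) (X : kscheme k) :=
  forall T : kscheme k,
    exists (P : kscheme k) (p : kmorphism P X) (q : kmorphism P T),
      fiber_product p q /\ forall Z : set P, closed Z -> closed (q @` Z).

Definition proper_scheme (k : fieldType) (X : kscheme k) :=
  [/\ separated X, finite_type X & universally_closed X].

(* A is isomorphic to k[x_1..x_(c+d)] / (f_1..f_c), and the determinant of
   (d f_i / d x_j) for i, j <= c is invertible in A. *)
Definition standard_smooth (k : fieldType) (A : comPzRingType)
    (str : {rmorphism k -> A}) :=
  exists (c d : nat) (f : 'I_c -> mpoly (c + d) k)
      (pi : {rmorphism mpoly (c + d) k -> A}),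
    [/\ forall a, pi (mpolyC (c + d) a) = str a,
        forall a, exists p, pi p = a,
        forall p, pi p = 0 <->
          exists g : 'I_c -> mpoly (c + d) k, p = \sum_i g i * f i
      & invertible (pi (\det (\matrix_(i, j) mderiv (lshift d j) (f i))))].

Definition smooth (k : fieldType) (X : kscheme k) :=
  forall x : X, exists U : opens X,
    [/\ U x, affine U & standard_smooth (scal U)].

Definition geom_connected (k : fieldType) (X : kscheme k) :=
  forall (L : fieldType) (iota : {rmorphism k -> L}),
    exists (XL : kscheme L) (p : kmorphism (restr iota XL) X),
      base_change p /\ connected [set: XL].

Definition integral (X : scheme) :=
  [set: X] !=set0 /\
  forall U : opens X, U !=set0 ->
    1 <> 0 :> sec U /\
    forall a b : sec U, a * b = 0 -> a = 0 \/ b = 0.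

Section SpecField.
Variable L : fieldType.

Let pt := discrete_topology unit.

Let ptE (x y : pt) : x = y. Proof. by case: x; case: y. Qed.

(* The sections over U are the functions U -> L: L if U is the whole point,
   and the zero ring if U is empty. *)
Definition spec_sec (U : opens pt) : comPzRingType := set_type U -> L.

Definition spec_incl (U V : opens pt) (h : V `<=` U) (x : set_type V) :
    set_type U :=
  SigSub (mem_set (h _ (set_valP x))).

Definition spec_res_fun (U V : opens pt) (h : V `<=` U) (s : spec_sec U) :
    spec_sec V :=
  s \o spec_incl h.

Lemma spec_res_zmod (U V : opens pt) (h : V `<=` U) : zmod_morphism (@spec_res_fun U V h).
Proof. by []. Qed.

Lemma spec_res_monoid (U V : opens pt) (h : V `<=` U) :
  monoid_morphism (@spec_res_fun U V h).
Proof. by []. Qed.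

HB.instance Definition _ (U V : opens pt) (h : V `<=` U) :=
  GRing.isZmodMorphism.Build (spec_sec U) (spec_sec V) (@spec_res_fun U V h)
    (@spec_res_zmod U V h).
HB.instance Definition _ (U V : opens pt) (h : V `<=` U) :=
  GRing.isMonoidMorphism.Build (spec_sec U) (spec_sec V) (@spec_res_fun U V h)
    (@spec_res_monoid U V h).

Definition spec_res (U V : opens pt) (h : V `<=` U) :
    {rmorphism spec_sec U -> spec_sec V} :=
  @spec_res_fun U V h.

Lemma spec_res_id (U : opens pt) (h : U `<=` U) s : spec_res h s = s.
Proof.
by apply/funext => x; rewrite /= /spec_res_fun /=; congr (s _); apply: val_inj.
Qed.

Lemma spec_res_res (U V W : opens pt) (hV : V `<=` U) (hW : W `<=` V) (h : W `<=` U) s :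
  spec_res hW (spec_res hV s) = spec_res h s.
Proof. by apply/funext => x /=; congr (s _); apply: val_inj. Qed.

Lemma spec_separated (U : opens pt) (F : set (opens pt)) (s : spec_sec U) :
  U = \bigcup_(V in F) V :> set pt ->
  (forall (V : opens pt) (h : V `<=` U), F V -> spec_res h s = 0) -> s = 0.
Proof.
move=> UF s0; apply/funext => x.
have [V FV Vx] : (\bigcup_(V in F) V) (val x) by rewrite -UF; apply: set_valP.
have h : V `<=` U by rewrite UF => y Vy; exists V.
have := congr1 (fun t : spec_sec V => t (SigSub (mem_set Vx))) (s0 V h FV).
move=> e; apply: etrans _ e; congr (s _); exact: val_inj.
Qed.

Lemma spec_glue (U : opens pt) (F : set (opens pt)) (s : forall V, spec_sec V) :
  U = \bigcup_(V in F) V :> set pt ->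
  (forall (V V' W : opens pt) (h : W `<=` V) (h' : W `<=` V'), F V -> F V' ->
     spec_res h (s V) = spec_res h' (s V')) ->
  exists t : spec_sec U,
    forall (V : opens pt) (h : V `<=` U), F V -> spec_res h t = s V.
Proof.
move=> UF sc.
have cover (x : set_type U) : exists V : opens pt, F V /\ V (val x).
  have [V FV Vx] : (\bigcup_(V in F) V) (val x).
    by rewrite -UF; apply: set_valP.
  by exists V.
pose c x := cid (cover x).
exists (fun x => s (sval (c x)) (SigSub (mem_set (svalP (c x)).2))).
move=> V h FV; apply/funext => x /=.
rewrite /spec_res_fun /=; set y := spec_incl h x.
have yx : val y = val x by [].
case: (c y) => V' [FV' V'y] /=; have Vx := set_valP x.
pose W : opens pt := Opens (openI (oset_open V) (oset_open V')).
have h1 : W `<=` V by move=> z [].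
have h2 : W `<=` V' by move=> z [].
have Wx : (W : set pt) (val x) by split.
have := congr1 (fun t : spec_sec W => t (SigSub (mem_set Wx)))
  (sc V V' W h1 h2 FV FV').
rewrite /= /spec_res_fun /= => e; symmetry.
by apply: etrans (etrans e _); [congr (s V _)|congr (s V' _)]; apply: val_inj.
Qed.

Definition spec_space : ringed_space :=
  RingedSpace spec_res_id spec_res_res spec_separated spec_glue.

Lemma spec_basicP (U : opens spec_space) (f : sec U) (x : pt) :
  basic f x <-> exists Ux : (U : set pt) x,
    (f : spec_sec U) (SigSub (mem_set Ux)) != 0.
Proof.
split=> [[V [h [Vx [b fb]]]]|[Ux fx]].
  exists (h _ Vx); apply/eqP => f0.
  pose z : set_type V := SigSub (mem_set Vx).
  have e : (f : spec_sec U) (spec_incl h z) * (b : spec_sec V) z = 1 :=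
    congr1 (fun t : spec_sec V => t z) fb.
  have zE : spec_incl h z = SigSub (mem_set (h _ Vx)) by apply: val_inj.
  by move/eqP: e; rewrite zE f0 mul0r eq_sym oner_eq0.
exists U, (fun y Uy => Uy); split=> //.
exists ((fun y => ((f : spec_sec U) y)^-1) : spec_sec U); apply/funext => y.
rewrite -[LHS]/((f : spec_sec U) (spec_incl _ y) / (f : spec_sec U) y).
have -> : spec_incl (fun z (Uz : (U : set pt) z) => Uz) y = y by apply: val_inj.
rewrite divff //; suff -> : y = SigSub (mem_set Ux) by [].
by apply: val_inj; apply: ptE.
Qed.

Lemma spec_nontrivial x (U : opens spec_space) : ~ basic (0 : sec U) x.
Proof. by move/spec_basicP => [Ux]; rewrite eqxx. Qed.

Lemma spec_local x (U : opens spec_space) (f g : sec U) :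
  basic (f + g) x -> basic f x \/ basic g x.
Proof.
move/spec_basicP => [Ux fgx].
have [fx|fx] := eqVneq ((f : spec_sec U) (SigSub (mem_set Ux))) 0.
  right; apply/spec_basicP; exists Ux; move: fgx.
  by rewrite -[(_ + _) _]/(_ + _) fx add0r.
by left; apply/spec_basicP; exists Ux.
Qed.

Lemma spec_affine : affine (oT spec_space).
Proof.
pose o : set_type (oT spec_space) := SigSub (mem_set (I : [set: pt] tt)).
have oE (y : set_type (oT spec_space)) : y = o.
  by apply: val_inj; apply: ptE.
have bE (f : sec (oT spec_space)) x : basic f x <-> (f : spec_sec _) o != 0.
  split=> [/spec_basicP [Ux]|fo]; first by rewrite (oE (SigSub _)).
  by apply/spec_basicP; exists I; rewrite (oE (SigSub _)).
have cstE (f : sec (oT spec_space)) : f = cst ((f : spec_sec _) o) :> spec_sec _.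
  by apply/funext => y; rewrite (oE y).
have invE (f : sec (oT spec_space)) : (f : spec_sec _) o != 0 ->
    exists g : sec (oT spec_space), g * f = 1.
  move=> fo; exists (cst ((f : spec_sec _) o)^-1 : spec_sec _).
  apply/funext => y; rewrite (oE y).
  by rewrite -[LHS]/(((f : spec_sec _) o)^-1 * (f : spec_sec _) o) mulVf.
split.
- move=> p [pD pM p0 p1 _]; exists tt; split; last by move=> [].
  split=> //; apply/seteqP; split=> f /=.
    by move=> pf /bE /invE [g gf]; apply: p1; rewrite -gf; apply: pM.
  move=> nf; suff -> : f = 0 by [].
  have f0 : (f : spec_sec _) o = 0.
    by apply/eqP/negPn/negP => fo; apply: nf; apply/bE.
  by rewrite (cstE f) f0.
- move=> x _; split=> /=.
  + by move=> a b na nb /spec_local [].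
  + move=> a b nb /bE ab; apply: nb; apply/bE; apply: contra ab => /eqP b0.
    by rewrite -[(_ * _) _]/(_ * _) b0 mulr0.
  + exact: spec_nontrivial.
  + by move=> n1; apply: n1; apply/bE; apply: oner_neq0.
  + move=> a b nab; apply/or_asboolP; rewrite -[_ || _]negbK negb_or.
    apply/negP => /andP [/asboolPn /contrapT /bE a0 /asboolPn /contrapT /bE b0].
    by apply: nab; apply/bE; rewrite -[(_ * _) _]/(_ * _) mulf_neq0.
- move=> V x _ Vx; exists 1; split; first exact/bE/oner_neq0.
  by move=> y _; case: y; case: x Vx.
- move=> f; split=> [s|a].
    have [f0|fo] := eqVneq ((f : spec_sec _) o) 0.
      exists 0%N, 0; rewrite rmorph0; apply/funext => y.
      by have /bE := set_valP y; rewrite f0 eqxx.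
    have oV : (basic f : set pt) tt by apply/bE.
    exists 0%N, (cst ((s : spec_sec _) (SigSub (mem_set oV))) : spec_sec _).
    rewrite expr0 rmorph1 mul1r; apply/funext => y.
    suff -> : y = SigSub (mem_set oV) by [].
    by apply: val_inj; apply: ptE.
  move=> a0; have [f0|fo] := eqVneq ((f : spec_sec _) o) 0.
    by exists 1%N; rewrite expr1 (cstE f) f0 mul0r.
  have oV : (basic f : set pt) tt by apply/bE.
  pose z : set_type (basic f) := SigSub (mem_set oV).
  have az : (a : spec_sec _) (spec_incl (@basic_sub _ _ f) z) = 0 :=
    congr1 (fun t : spec_sec _ => t z) a0.
  rewrite (oE (spec_incl _ z)) in az.
  by exists 0%N; rewrite expr0 mul1r (cstE a) az.
Qed.

Lemma spec_cover (x : spec_space) : exists U : opens spec_space, U x /\ affine U.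
Proof. by exists (oT spec_space); split=> //; apply: spec_affine. Qed.

Definition spec_scheme : scheme :=
  Scheme spec_nontrivial spec_local spec_cover.

Definition spec_cst (a : L) : sec (oT spec_scheme) := (cst a : spec_sec _).

Lemma spec_cst_zmod : zmod_morphism spec_cst. Proof. by []. Qed.
Lemma spec_cst_monoid : monoid_morphism spec_cst. Proof. by []. Qed.

HB.instance Definition _ :=
  GRing.isZmodMorphism.Build L (sec (oT spec_scheme)) spec_cst spec_cst_zmod.
HB.instance Definition _ :=
  GRing.isMonoidMorphism.Build L (sec (oT spec_scheme)) spec_cst spec_cst_monoid.

Definition spec : kscheme L := @KScheme L spec_scheme spec_cst.

End SpecField.

Definition rat_points (L : fieldType) (V : kscheme L) := kmorphism (spec L) V.

Definition rat_image (L : fieldType) (V : kscheme L) (A : rat_points V) : V :=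
  A tt.

(* P is P^1_L, glued from the affine lines U0 = Spec L[t0] and
   U1 = Spec L[t1] along t0 t1 = 1. *)
Definition projective_line (L : fieldType) (P : kscheme L) :=
  exists (U0 U1 : opens P)
      (phi0 : {rmorphism {poly L} -> sec U0})
      (phi1 : {rmorphism {poly L} -> sec U1}),
    [/\ affine U0 /\ affine U1,
        bijective phi0 /\ bijective phi1,
        (forall c, phi0 c%:P = scal U0 c) /\ (forall c, phi1 c%:P = scal U1 c),
        U0 `|` U1 = [set: P]
      & [/\ U0 `&` U1 = basic (phi0 'X) :> set P,
            U0 `&` U1 = basic (phi1 'X) :> set P
          & forall (W : opens P) (h0 : W `<=` U0) (h1 : W `<=` U1),
              res h0 (phi0 'X) * res h1 (phi1 'X) = 1] ].

Definition elem_R_linked (L : fieldType) (V : kscheme L) (A B : rat_points V) :=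
  exists (P W : kscheme L) (j : kmorphism W P) (h : kmorphism W V),
    [/\ projective_line P, open_immersion j,
        exists a : rat_points W, mor_eq (mcomp h a) A
      & exists b : rat_points W, mor_eq (mcomp h b) B].

Definition R_equiv (L : fieldType) (V : kscheme L) (A B : rat_points V) :=
  exists (n : nat) (c : nat -> rat_points V),
    [/\ c 0%N = A, c n = B & forall i, (i < n)%N -> elem_R_linked (c i) (c i.+1)].

Definition R_class (L : fieldType) (V : kscheme L) (A : rat_points V) :
    set (rat_points V) :=
  [set B | R_equiv A B].

(* For a field L/k, X(L) = X_L(L), and U(L) is the set of the L-points of X_L
   whose image in X lies in U. *)
Definition almost_R_trivial (k : fieldType) (X : kscheme k) :=
  integral X /\
  exists U : opens X, dense U /\
    forall (L : fieldType) (iota : {rmorphism k -> L}),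
      exists (XL : kscheme L) (p : kmorphism (restr iota XL) X),
        base_change p /\
        exists C : set (rat_points XL),
          [set R_class A
            | A in [set A : rat_points XL | U (p (@rat_image L XL A))]]
          = [set C].

Section GlobalSections.
Variables (k : fieldType) (X : kscheme k) (i m : nat).

(* (Omega^i)^{(x) m} is the sheaf associated with this presheaf, sheafification
   being compatible with exterior and tensor powers. *)
Definition pre_forms (U : opens X) : lmodType (sec U) := forms (scal U) i m.

Definition pre_forms_res (U V : opens X) (h : V `<=` U) :
    pre_forms U -> pre_forms V :=
  fun s => forms_map (scal V) (res h) s.

(* The germ at x of a section over U, as the set of all pairs (V, t) with t a
   section over V that coincides with it near x. *)
Definition germ (x : X) (U : opens X) (s : pre_forms U) :
    set {V : opens X & pre_forms V} :=
  [set q : {V : opens X & pre_forms V} |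
    exists (W : opens X) (h : W `<=` U) (h' : W `<=` projT1 q),
      W x /\ pre_forms_res h s = pre_forms_res h' (projT2 q)].

(* H^0(X, (Omega^i)^{(x) m}): the functions to the stalks that are locally
   given by a section of the presheaf. *)
Definition H0_forms : set (X -> set {V : opens X & pre_forms V}) :=
  [set sigma | forall x, exists (U : opens X) (s : pre_forms U),
     U x /\ forall y, U y -> sigma y = germ y s].

Definition H0_forms_zero : X -> set {V : opens X & pre_forms V} :=
  fun x => germ x (0 : pre_forms (oT X)).

End GlobalSections.

Arguments H0_forms {k} X i m.
Arguments H0_forms_zero {k} X i m.

(* Main.v *)
(* Let L be the function field of X, let omega be a form and let D_jl be
   k-derivations of L. Evaluating the factors of omega on the D_jl turns the
   pull-back of omega along any L-point of X into an element of L, and this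
   value is constant on R-equivalence classes. Indeed, let W, open in P^1_L, map
   to X, and let a, b be points of W(L). For a suitable polynomial q of degree at
   most 1, the derivation D + q d/dt of L(t) commutes with the evaluations at a
   and at b. As q has degree at most 1, it preserves the local rings of P^1_L,
   at infinity too, and as X is proper the form is regular at all points of
   P^1_L: its value on these derivations is thus a rational function without
   poles, i.e. a constant, which specializes to the values at a and at b.
   The generic point of X is R-equivalent to a point that comes from X(k), where
   the value is 0 since the D_jl vanish on k. As X is smooth, dual bases of
   derivations then show that all coefficients of omega vanish. *)

Require Import Defs.
From HB Require Import structures.
From mathcomp Require mpoly.
Import -(notations) mpoly.
From mathcomp Require Import all_boot all_order all_algebra perm ring.
From mathcomp Require Import boolp classical_sets functions cardinality topology.

Set Implicit Arguments.
Unset Strict Implicit.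
Unset Printing Implicit Defensive.

Import GRing.Theory.
Local Open Scope classical_set_scope.
Local Open Scope ring_scope.
Local Open Scope quotient_scope.

(** * Evaluation of forms on derivations *)

(** A form is only given by local sections, so its value at a point is a relation, [form_at], shown
    to be single-valued by restriction to a common neighbourhood. Poles and specialization are
    carried by one relation, [loc_rel]: [z] is a fraction with a denominator in [M], and the same
    fraction specializes to [c]. It is closed under ring operations and compatible derivations, so
    [forms_ev_ind2] transports it from functions to forms at once. The degree of q comes from
    interpolation: compatibility with evaluation at a asks that q take the value D(t(a)) at t(a),
    and a link has two ends. In s = 1/t the image q0 + q1 t of t becomes -(q0 s + q1) s as image of
    s: a polynomial vanishing at s = 0, hence compatible with evaluation at infinity since D 0 = 0.
    The map to X is defined on W only. At the other points of the line the closure of its graph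
    supplies a point of X, and functions near that point have no pole on the line. Finally, a point
    of X(k) exists because almost R-triviality over k itself provides exactly one class, hence a
    nonempty U(k). *)

Section PresEval.
Variables (A : comPzRingType) (G : choiceType) (rel : set (seq (A * G))).
Variables (S : comPzRingType) (phi : A -> S) (u : G -> S).

(** Computed on the representative of the class; [pres_ev_pi] gives independence of it as soon as
    [u] respects the relations. *)
Definition pres_ev (x : pres rel) : S := \sum_(p <- repr x) phi p.1 * u p.2.

Hypothesis phiD : {morph phi : a b / a + b}.
Hypothesis phiM : {morph phi : a b / a * b}.
Hypothesis phi1 : phi 1 = 1.
Hypothesis u_rel : forall r, rel r -> \sum_(p <- r) phi p.1 * u p.2 = 0.

Let phi0 : phi 0 = 0.
Proof. by apply: (addrI (phi 0)); rewrite -phiD !addr0. Qed.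

Lemma pres_eq_ev s t : pres_eq rel s t ->
  \sum_(p <- s) phi p.1 * u p.2 = \sum_(p <- t) phi p.1 * u p.2.
Proof.
elim=> {s t} [//|s t _ //|s t w _ -> _ -> //|s s' t t' _ + _|s t|a s t _ st|a b g|g|r].
- by rewrite !big_cat /= => -> ->.
- by rewrite !big_cat /= addrC.
- have scaleE w : \sum_(p <- fscale a w) phi p.1 * u p.2 =
      phi a * \sum_(p <- w) phi p.1 * u p.2.
    by rewrite big_map mulr_sumr; apply: eq_bigr => p _ /=; rewrite phiM mulrA.
  by rewrite !scaleE st.
- by rewrite !big_cons !big_nil /= phiD !addr0 mulrDl.
- by rewrite big_cons big_nil /= phi0 mul0r addr0.
- by move/u_rel ->; rewrite big_nil.
Qed.

Lemma pres_ev_pi s : pres_ev (\pi_(pres rel) s) = \sum_(p <- s) phi p.1 * u p.2.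
Proof. exact/pres_eq_ev/pres_repr. Qed.

Lemma pres_evD x y : pres_ev (x + y) = pres_ev x + pres_ev y.
Proof.
elim/presW: x => s; elim/presW: y => t.
by rewrite -[_ + _ in LHS]/(padd _ _) padd_pi !pres_ev_pi big_cat.
Qed.

Lemma pres_evZ a x : pres_ev (a *: x) = phi a * pres_ev x.
Proof.
elim/presW: x => s.
rewrite -[_ *: _]/(pscale _ _) pscale_pi !pres_ev_pi big_map mulr_sumr.
by apply: eq_bigr => p _ /=; rewrite phiM mulrA.
Qed.

Lemma pres_ev_gen g : pres_ev (pgen rel g) = u g.
Proof. by rewrite pres_ev_pi big_cons big_nil /= phi1 mul1r addr0. Qed.

End PresEval.

Lemma pres_sum_gen (A : comPzRingType) (G : choiceType) (rel : set (seq (A * G)))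
  (s : seq (A * G)) : \pi_(pres rel) s = \sum_(p <- s) p.1 *: pgen rel p.2.
Proof.
elim: s => [|[a g] s IHs]; first by rewrite big_nil.
rewrite big_cons -IHs -[_ + _]/(padd _ _) -[_ *: _]/(pscale _ _) pscale_pi padd_pi.
by rewrite /fscale /= mulr1.
Qed.

Lemma pres_rel0 (A : comPzRingType) (G : choiceType) (rel : set (seq (A * G)))
  (s : seq (A * G)) : rel s -> \sum_(p <- s) p.1 *: pgen rel p.2 = 0.
Proof. by move=> rs; rewrite -pres_sum_gen; apply/pres_pi_eq/pres_rel. Qed.

(** Both evaluations run over the same representative of [x], so a relation compatible with sums and
    products passes from coefficients and generators to values. *)
Lemma pres_ev_ind2 (A : comPzRingType) (G : choiceType) (rel : set (seq (A * G)))
  (S S' : comPzRingType) (R : S -> S' -> Prop) phi u phi' u' :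
  R 0 0 -> (forall x x' y y', R x x' -> R y y' -> R (x + y) (x' + y')) ->
  (forall x x' y y', R x x' -> R y y' -> R (x * y) (x' * y')) ->
  (forall a, R (phi a) (phi' a)) -> (forall g, R (u g) (u' g)) ->
  forall x : pres rel, R (pres_ev phi u x) (pres_ev phi' u' x).
Proof.
by move=> R0 RD RM Rphi Ru x; apply: big_rec2 => // p y y' _ ?; apply: RD => //; apply: RM.
Qed.

Definition derivation (A S : comPzRingType) (phi : A -> S) (d : A -> S) :=
  {morph d : a b / a + b} /\ forall a b, d (a * b) = phi a * d b + phi b * d a.

Lemma derivation0 (A S : comPzRingType) (phi d : A -> S) : derivation phi d -> d 0 = 0.
Proof. by case=> dD _; apply: (addrI (d 0)); rewrite -dD !addr0. Qed.

Lemma derivation1 (A S : comPzRingType) (phi : {rmorphism A -> S}) (d : A -> S) :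
  derivation phi d -> d 1 = 0.
Proof.
case=> _ dM; apply: (addrI (d 1)).
by rewrite addr0 -[in RHS](mulr1 1) dM rmorph1 !mul1r.
Qed.

Lemma derivationN (A S : comPzRingType) (phi d : A -> S) a :
  derivation phi d -> d (- a) = - d a.
Proof.
move=> dd; apply: (addrI (d a)).
by rewrite subrr -(derivation0 dd) -[in RHS](subrr a) (proj1 dd).
Qed.

Lemma derivation_sum (A S : comPzRingType) (phi d : A -> S) (I : finType) (f : I -> A) :
  derivation phi d -> d (\sum_i f i) = \sum_i d (f i).
Proof. by move=> dd; apply: (big_morph d (proj1 dd) (derivation0 dd)). Qed.

Section FormsEval.
Variables (k A : comPzRingType) (str : {rmorphism k -> A}) (S : comPzRingType).

Definition omega_ev (phi d : A -> S) : Omega str -> S := pres_ev phi d.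

Definition ext_ev (phi : A -> S) i (M : lmodType A) (u : 'I_i -> M -> S) :
    ext_pow i M -> S :=
  pres_ev phi (fun f : {ffun 'I_i -> M} => \det (\matrix_(l', l) u l' (f l))).

Definition tens_ev (phi : A -> S) m (M : lmodType A) (u : 'I_m -> M -> S) :
    tens_pow m M -> S :=
  pres_ev phi (fun f : {ffun 'I_m -> M} => \prod_j u j (f j)).

(* sends (x)_j (/\_l d b_jl) to \prod_j \det (d_jl' b_jl)_(l', l) *)
Definition forms_ev i m (phi : A -> S) (d : 'I_m -> 'I_i -> A -> S) :
    forms str i m -> S :=
  tens_ev phi (fun j => ext_ev phi (fun l => omega_ev phi (d j l))).

End FormsEval.

Section FormsEvalTheory.
Variables (k A : comPzRingType) (str : {rmorphism k -> A}) (S : comPzRingType).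
Variable (phi : {rmorphism A -> S}).

Definition semilinear_over (M : lmodType A) (u : M -> S) :=
  {morph u : x y / x + y} /\ forall a x, u (a *: x) = phi a * u x.

Lemma semilinear_sum (M : lmodType A) (u : M -> S) (I : finType) (f : I -> M) :
  semilinear_over u -> u (\sum_i f i) = \sum_i u (f i).
Proof.
move=> [uD uZ]; apply: (big_morph u uD).
by rewrite -(scale0r (0 : M)) uZ rmorph0 mul0r.
Qed.

(** Linearity in each slot is all that the relations express; this serves both for products (tensor
    powers) and for determinants (exterior powers). *)
Lemma tens_ev_rel n (M : lmodType A) (v : {ffun 'I_n -> M} -> S) :
  (forall f j, semilinear_over (fun x => v (upd f j x))) ->
  forall r, @tens_rel A n M r -> \sum_(p <- r) phi p.1 * v p.2 = 0.
Proof.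
move=> lv _ [f j x y|f j a x]; have [vD vZ] := lv f j;
  rewrite !big_cons big_nil /= !rmorphN rmorph1 ?mulN1r mul1r addr0.
- by rewrite vD addrACA subrr add0r subrr.
- by rewrite vZ mulNr subrr.
Qed.

Lemma prod_semilinear m (M : lmodType A) (u : 'I_m -> M -> S) :
  (forall j, semilinear_over (u j)) ->
  forall (f : {ffun 'I_m -> M}) j, semilinear_over (fun x => \prod_l u l (upd f j x l)).
Proof.
move=> lu f j.
have E x : \prod_l u l (upd f j x l) = u j x * \prod_(l | l != j) u l (f l).
  rewrite (bigD1 j) //= ffunE eqxx; congr (_ * _).
  by apply: eq_bigr => l /negPf lj; rewrite ffunE lj.
split=> [x y|a x]; rewrite !E; first by rewrite (proj1 (lu j)) mulrDl.
by rewrite (proj2 (lu j)) mulrA.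
Qed.

Lemma det_semilinear i (M : lmodType A) (u : 'I_i -> M -> S) :
  (forall j, semilinear_over (u j)) ->
  forall (f : {ffun 'I_i -> M}) j,
    semilinear_over (fun x => \det (\matrix_(l', l) u l' (upd f j x l))).
Proof.
move=> lu f j; split=> [x y|a x].
(* The modified slot indexes a column, while [determinant_multilinear] splits a row. *)
- rewrite -!(det_tr (\matrix_(_, _) _)).
  rewrite (determinant_multilinear (B := (\matrix_(l', l) u l' (upd f j x l))^T)
    (C := (\matrix_(l', l) u l' (upd f j y l))^T) (i0 := j) (b := 1) (c := 1)).
  + by rewrite !mul1r.
  + apply/rowP => l; rewrite !mxE !ffunE eqxx !mul1r; exact: (proj1 (lu l)).
  + by apply/matrixP => a b; rewrite !mxE !ffunE eq_sym (negPf (neq_lift _ _)).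
  + by apply/matrixP => a b; rewrite !mxE !ffunE eq_sym (negPf (neq_lift _ _)).
- rewrite -!(det_tr (\matrix_(_, _) _)).
  rewrite (determinant_multilinear (B := (\matrix_(l', l) u l' (upd f j x l))^T)
    (C := (\matrix_(l', l) u l' (upd f j x l))^T) (i0 := j) (b := phi a) (c := 0)).
  + by rewrite mul0r addr0.
  + apply/rowP => l; rewrite !mxE !ffunE eqxx mul0r addr0; exact: (proj2 (lu l)).
  + by apply/matrixP => b c; rewrite !mxE !ffunE eq_sym (negPf (neq_lift _ _)).
  + by apply/matrixP => b c; rewrite !mxE !ffunE eq_sym (negPf (neq_lift _ _)).
Qed.

Lemma ext_ev_rel i (M : lmodType A) (u : 'I_i -> M -> S) :
  (forall j, semilinear_over (u j)) ->
  forall r, @ext_rel A i M r ->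
    \sum_(p <- r) phi p.1 * \det (\matrix_(l', l) u l' (p.2 l)) = 0.
Proof.
move=> lu _ [r tr|f j l jl fjl].
  apply: (tens_ev_rel (v := fun f => \det (\matrix_(l', l) u l' (f l))) _ tr).
  exact: det_semilinear.
rewrite big_cons big_nil /= rmorph1 mul1r addr0 -det_tr.
by apply: (determinant_alternate jl) => l'; rewrite !mxE fjl.
Qed.

Lemma omega_ev_rel (d : A -> S) : derivation phi d -> (forall c, d (str c) = 0) ->
  forall r, Omega_rel str r -> \sum_(p <- r) phi p.1 * d p.2 = 0.
Proof.
move=> [dD dM] dk _ [a b|a b|c]; rewrite !big_cons big_nil /= !(rmorphN, rmorph1) addr0.
- by rewrite dD mul1r !mulN1r addrACA !subrr addr0.
- by rewrite dM mul1r !mulNr addrACA !subrr addr0.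
- by rewrite dk mulr0.
Qed.

Let phiD := rmorphD phi.
Let phiM := rmorphM phi.
Let phi1 := rmorph1 phi.

Lemma omega_ev_semilinear d : derivation phi d -> (forall c, d (str c) = 0) ->
  semilinear_over (@omega_ev _ _ str S phi d).
Proof.
move=> dd dk; have dr := omega_ev_rel dd dk.
by split=> *; [apply: pres_evD | apply: pres_evZ].
Qed.

Lemma omega_ev_gen d a : derivation phi d -> (forall c, d (str c) = 0) ->
  @omega_ev _ _ str S phi d (pgen _ a) = d a.
Proof. by move=> dd dk; apply: pres_ev_gen => //; apply: omega_ev_rel. Qed.

Section Ext.
Variables (i : nat) (M : lmodType A) (u : 'I_i -> M -> S).
Hypothesis lu : forall j, semilinear_over (u j).

Lemma ext_ev_semilinear : semilinear_over (@ext_ev _ S phi i M u).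
Proof.
by split=> *; [apply: pres_evD | apply: pres_evZ] => //; apply: ext_ev_rel.
Qed.

Lemma ext_ev_gen f : @ext_ev _ S phi i M u (pgen _ f) = \det (\matrix_(l', l) u l' (f l)).
Proof. by apply: (pres_ev_gen (u := fun f : {ffun _} => _)) => //; apply: ext_ev_rel. Qed.

End Ext.

Section Tens.
Variables (m : nat) (M : lmodType A) (u : 'I_m -> M -> S).
Hypothesis lu : forall j, semilinear_over (u j).

Lemma tens_prod_rel r :
  @tens_rel A m M r -> \sum_(p <- r) phi p.1 * \prod_j u j (p.2 j) = 0.
Proof.
exact: (tens_ev_rel (v := fun f => \prod_j u j (f j)) (prod_semilinear lu)).
Qed.

Lemma tens_ev_semilinear : semilinear_over (@tens_ev _ S phi m M u).
Proof.
by split=> *; [apply: pres_evD | apply: pres_evZ] => //; apply: tens_prod_rel.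
Qed.

Lemma tens_ev_gen f : @tens_ev _ S phi m M u (pgen _ f) = \prod_j u j (f j).
Proof. by apply: (pres_ev_gen (u := fun f : {ffun _} => _)) => //; apply: tens_prod_rel. Qed.

End Tens.

End FormsEvalTheory.

Lemma pres_ev_map (A B : comPzRingType) (G H : choiceType)
  (relA : set (seq (A * G))) (relB : set (seq (B * H))) (rho : {rmorphism A -> B})
  (f : G -> H) (S : comPzRingType) (phi : {rmorphism B -> S}) (u : H -> S) (x : pres relA) :
  (forall r, relB r -> \sum_(p <- r) phi p.1 * u p.2 = 0) ->
  pres_ev phi u (pres_map relB rho f x) = pres_ev (phi \o rho) (u \o f) x.
Proof.
move=> ur; rewrite /pres_map pres_ev_pi ?big_map //.
- exact: rmorphD.
- exact: rmorphM.
Qed.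

(** Pulling a form back along [rho] and then evaluating amounts to composing the derivations with
    [rho]; this is how values are compared on a smaller open set. *)
Lemma forms_ev_map (k A B : comPzRingType) (strA : {rmorphism k -> A})
  (strB : {rmorphism k -> B}) (rho : {rmorphism A -> B}) i m (S : comPzRingType)
  (phi : {rmorphism B -> S}) (d : 'I_m -> 'I_i -> B -> S) (x : forms strA i m) :
  (forall j l, derivation phi (d j l)) -> (forall j l c, d j l (strB c) = 0) ->
  forms_ev phi d (forms_map strB rho x) =
  forms_ev (phi \o rho) (fun j l => d j l \o rho) x.
Proof.
move=> dd dk.
have lo j l := omega_ev_semilinear (dd j l) (dk j l).
rewrite /forms_ev /tens_ev /forms_map /tens_map pres_ev_map; last first.
  by apply: (tens_prod_rel (u := fun j => ext_ev phi (fun l => omega_ev phi (d j l))))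
    => j; apply: ext_ev_semilinear.
congr pres_ev; apply/funext => f /=; apply: eq_bigr => j _; rewrite ffunE.
rewrite /ext_ev /ext_map pres_ev_map; last first.
  exact: (ext_ev_rel (u := fun l => omega_ev phi (d j l)) (lo j)).
congr pres_ev; apply/funext => g /=; congr (\det _).
apply/matrixP => l' l; rewrite !mxE ffunE /omega_ev /Omega_map pres_ev_map //.
exact: omega_ev_rel.
Qed.

(** Values of forms are built from values of functions and derivations by ring operations only. To
    be applied with [loc_rel]; closure under opposite accounts for the signs of permutations in
    determinants. *)
Lemma forms_ev_ind2 (k A : comPzRingType) (str : {rmorphism k -> A}) i m
  (S S' : comPzRingType) (R : S -> S' -> Prop) phi d phi' d' :
  R 0 0 -> R 1 1 -> (forall x x', R x x' -> R (- x) (- x')) ->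
  (forall x x' y y', R x x' -> R y y' -> R (x + y) (x' + y')) ->
  (forall x x' y y', R x x' -> R y y' -> R (x * y) (x' * y')) ->
  (forall a, R (phi a) (phi' a)) -> (forall j l a, R (d j l a) (d' j l a)) ->
  forall x : forms str i m, R (forms_ev phi d x) (forms_ev phi' d' x).
Proof.
move=> R0 R1 RN RD RM Rphi Rd x.
apply: (pres_ev_ind2 R0 RD RM Rphi) => // f.
apply: (big_rec2 R) => // j y y' _ ?; apply: (RM) => //.
apply: (pres_ev_ind2 R0 RD RM Rphi) => // g.
apply: (big_rec2 R) => // s z z' _ ?; apply: (RD) => //; apply: (RM).
  by case: odd_perm; rewrite ?expr1 ?expr0 //; apply: RN.
apply: (big_rec2 R) => // l w w' _ ?; apply: (RM) => //; rewrite !mxE.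
exact: (pres_ev_ind2 R0 RD RM Rphi).
Qed.

(** Positivity of [m] provides a tensor factor and positivity of [i] makes its zero matrix nonempty,
    so that the determinant is 0 and not the empty determinant 1. *)
Lemma forms_ev0 (k A : comPzRingType) (str : {rmorphism k -> A}) i m
  (S : comPzRingType) phi (d : 'I_m -> 'I_i -> A -> S) (x : forms str i m) :
  (0 < i)%N -> (0 < m)%N -> (forall j l a, d j l a = 0) -> forms_ev phi d x = 0.
Proof.
case: i d x => // i d x _; case: m d x => // m d x _ d0.
rewrite /forms_ev /tens_ev /pres_ev big1 // => p _.
rewrite big_ord_recl [X in _ * (X * _)](_ : _ = 0) ?mul0r ?mulr0 //.
rewrite /ext_ev /pres_ev big1 // => q _.
rewrite [X in \det X](_ : _ = 0) ?det0 ?mulr0 //.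
apply/matrixP => l' l; rewrite !mxE /omega_ev /pres_ev big1 // => r _.
by rewrite d0 mulr0.
Qed.

(** * Spanning families of tensor and exterior powers *)

Section Span.
Variables (A : comPzRingType) (M : lmodType A).

Definition spanned (I : finType) (e : I -> M) (x : M) : Prop :=
  exists c : I -> A, x = \sum_j c j *: e j.

Variables (I : finType) (e : I -> M).

Lemma spanned0 : spanned e 0.
Proof. by exists (fun=> 0); rewrite big1 // => j _; rewrite scale0r. Qed.

Lemma spannedD x y : spanned e x -> spanned e y -> spanned e (x + y).
Proof.
move=> [c ->] [c' ->]; exists (fun j => c j + c' j).
by rewrite -big_split; apply: eq_bigr => j _; rewrite scalerDl.
Qed.

Lemma spannedZ a x : spanned e x -> spanned e (a *: x).
Proof.
move=> [c ->]; exists (fun j => a * c j).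
by rewrite scaler_sumr; apply: eq_bigr => j _; rewrite scalerA.
Qed.

Lemma spannedN x : spanned e x -> spanned e (- x).
Proof. by rewrite -scaleN1r; apply: spannedZ. Qed.

Lemma spanned_sum (J : Type) (s : seq J) (P : pred J) (f : J -> M) :
  (forall j, P j -> spanned e (f j)) -> spanned e (\sum_(j <- s | P j) f j).
Proof. by move=> ef; apply: big_ind => //; [apply: spanned0 | apply: spannedD]. Qed.

Lemma spanned_gen j : spanned e (e j).
Proof.
exists (fun l => (l == j)%:R); rewrite (bigD1 j) //= eqxx scale1r big1 ?addr0 //.
by move=> l /negPf ->; rewrite scale0r.
Qed.

End Span.

Section MultilinearSpan.
Variables (A : comPzRingType) (n : nat) (M : lmodType A).
Variable rel : set (seq (A * {ffun 'I_n -> M})).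
Hypothesis rel_tens : forall r, tens_rel r -> rel r.

Lemma gen_updD (f : {ffun 'I_n -> M}) j x y :
  pgen rel (upd f j (x + y)) = pgen rel (upd f j x) + pgen rel (upd f j y).
Proof.
have := pres_rel0 (rel_tens (tens_add f j x y)).
rewrite !big_cons big_nil /= addr0 !scaleN1r scale1r => /eqP.
by rewrite -opprD subr_eq0 => /eqP.
Qed.

Lemma gen_updZ (f : {ffun 'I_n -> M}) j a x :
  pgen rel (upd f j (a *: x)) = a *: pgen rel (upd f j x).
Proof.
have := pres_rel0 (rel_tens (tens_scale f j a x)).
rewrite !big_cons big_nil /= addr0 scaleNr scale1r => /eqP.
by rewrite subr_eq0 => /eqP.
Qed.

Lemma gen_upd0 (f : {ffun 'I_n -> M}) j : pgen rel (upd f j 0) = 0.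
Proof. by rewrite -(scale0r (0 : M)) gen_updZ scale0r. Qed.

Lemma upd_id (f : {ffun 'I_n -> M}) j : upd f j (f j) = f.
Proof. by apply/ffunP => l; rewrite ffunE; case: eqP => // ->. Qed.

Lemma gen_zero (f : {ffun 'I_n -> M}) j : f j = 0 -> pgen rel f = 0.
Proof. by move=> fj; rewrite -(upd_id f j) fj gen_upd0. Qed.

Variables (I : finType) (e : I -> M).
Hypothesis e_span : forall x, spanned e x.

Lemma multilinear_spanned (x : pres rel) :
  spanned (fun J : {ffun 'I_n -> I} => pgen rel [ffun j => e (J j)]) x.
Proof.
elim/presW: x => s; rewrite pres_sum_gen; apply: spanned_sum => -[a f] _ /=.
apply: spannedZ => {s a}.
(* Only the first [q] slots are still arbitrary; the induction step expands slot number [q] over the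
   family. *)
have H q : (q <= n)%N -> forall f : {ffun 'I_n -> M},
    (forall j : 'I_n, (q <= j)%N -> exists b, f j = e b) ->
    spanned (fun J : {ffun 'I_n -> I} => pgen rel [ffun j => e (J j)]) (pgen rel f).
  elim: q => [|q IHq] qn {}f fe.
    have {}fe j : {b | f j = e b} by apply: cid; apply: fe.
    pose J := [ffun j => sval (fe j)].
    have -> : f = [ffun j => e (J j)].
      by apply/ffunP => j; rewrite !ffunE; case: (fe j).
    exact: spanned_gen.
  pose j := Ordinal qn.
  have [c fj] := e_span (f j).
  rewrite -(upd_id f j) fj.
  rewrite (big_morph (fun x => pgen rel (upd f j x)) (gen_updD f j) (gen_upd0 f j)).
  apply: spanned_sum => b _; rewrite gen_updZ; apply: spannedZ.
  apply: IHq; first exact: ltnW.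
  move=> l; rewrite leq_eqVlt => /orP [/eqP ql|ql]; rewrite ffunE.
    by exists b; rewrite ifT //; apply/eqP/val_inj.
  case: eqP => [_|_]; first by exists b.
  exact: fe.
by apply: (H n) => // j; rewrite leqNgt ltn_ord.
Qed.

End MultilinearSpan.

Section ExteriorSpan.
Variables (A : comPzRingType) (n : nat) (M : lmodType A).
Notation gen := (pgen (@ext_rel A n M)).

(** Polarization: expand F(x + y, x + y) = 0 for the alternating map F of the two slots. *)
Lemma ext_gen_tperm (f : {ffun 'I_n -> M}) (a b : 'I_n) : a != b ->
  gen [ffun l => f (tperm a b l)] = - gen f.
Proof.
move=> ab; have ba : b == a = false by rewrite eq_sym (negPf ab).
pose F x y := gen (upd (upd f a x) b y).
have F0 x : F x x = 0.
  have := pres_rel0 (@ext_alternating A n M (upd (upd f a x) b x) a b ab _).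
  rewrite big_cons big_nil /= scale1r addr0; apply.
  by rewrite !ffunE (negPf ab) !eqxx.
have updC x y : upd (upd f a x) b y = upd (upd f b y) a x.
  by apply/ffunP => l; rewrite !ffunE; case: eqP => // ->; rewrite ba.
have FDr x y z : F x (y + z) = F x y + F x z.
  exact: (gen_updD (@ext_multilinear A n M)).
have FDl x y z : F (x + y) z = F x z + F y z.
  by rewrite /F !updC; apply: (gen_updD (@ext_multilinear A n M)).
have -> : gen f = F (f a) (f b).
  congr (pgen _ _); apply/ffunP => l; rewrite !ffunE.
  by case: eqP => [->|_] //; case: eqP => [->|].
have -> : gen [ffun l => f (tperm a b l)] = F (f b) (f a).
  congr (pgen _ _); apply/ffunP => l; rewrite !ffunE.
  have [->|lb] := eqVneq l b; first by rewrite tpermR.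
  have [->|la] := eqVneq l a; first by rewrite tpermL.
  by rewrite tpermD // eq_sym.
have := F0 (f a + f b); rewrite FDl !FDr !F0 add0r addr0 => /eqP.
by rewrite addrC addr_eq0 => /eqP.
Qed.

(** The scalar is the sign of [s]; spanning only requires that some scalar exists. *)
Lemma ext_gen_perm (f : {ffun 'I_n -> M}) (s : 'S_n) :
  exists c : A, gen [ffun l => f (s l)] = c *: gen f.
Proof.
have [ts -> tsP] := prod_tpermP s.
elim: ts tsP f => [_|[a b] ts IHts /= /andP[/= ab tsP]] f.
  exists 1; rewrite scale1r big_nil; congr (pgen _ _).
  by apply/ffunP => l; rewrite ffunE perm1.
have [c gc] := IHts tsP f; exists (- c).
rewrite big_cons scaleNr -gc -(ext_gen_tperm _ ab); congr (pgen _ _).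
by apply/ffunP => l; rewrite !ffunE permM.
Qed.

Variables (d : nat) (e : 'I_d -> M).

(** A basis of an exterior power is indexed by subsets of size [n]. Any enumeration of [B] by ['I_n]
    is taken, not the increasing one, and there is none when [B] has another size. *)
Definition set_enum (B : {set 'I_d}) : option {ffun 'I_n -> 'I_d} :=
  [pick J : {ffun 'I_n -> 'I_d} | injectiveb J && ([set J l | l in 'I_n]%SET == B)].

(** The value 0 on sets of the wrong size allows all subsets as indices. *)
Definition ext_basis (B : {set 'I_d}) : ext_pow n M :=
  if set_enum B is Some J then gen [ffun l => e (J l)] else 0.

Hypothesis e_span : forall x, spanned e x.

(** A generator with a repeated index vanishes; any other one is, up to a permutation, the chosen
    enumeration of the set of its indices. *)
Lemma ext_spanned (x : ext_pow n M) : spanned ext_basis x.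
Proof.
have [c ->] := multilinear_spanned (@ext_multilinear A n M) e_span x.
apply: spanned_sum => J _; apply: spannedZ.
have [Jinj|/injectivePn [a [b ab Jab]]] := boolP (injectiveb J); last first.
  have := pres_rel0 (@ext_alternating A n M [ffun l => e (J l)] a b ab _).
  rewrite big_cons big_nil /= scale1r addr0 => ->; first exact: spanned0.
  by rewrite !ffunE Jab.
pose B := [set J l | l in 'I_n]%SET.
case E: (set_enum B) => [J0|]; last first.
  by move: E; rewrite /set_enum; case: pickP => // /(_ J); rewrite Jinj eqxx.
have /andP[/injectiveP J0inj /eqP J0B] :
    injectiveb J0 && ([set J0 l | l in 'I_n]%SET == B).
  by move: E; rewrite /set_enum; case: pickP => // J1 J1P [<-].
have sP l : {l' | J l = J0 l'}.
  have /imsetP/cid2 [l' _ Jl] : J l \in [set J0 l | l in 'I_n]%SET.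
    by rewrite J0B imset_f.
  by exists l'.
have sinj : injective (fun l => sval (sP l)).
  move=> l1 l2 /(congr1 J0); case: (sP l1) => a1 /= <-; case: (sP l2) => a2 /= <-.
  by move/injectiveP: Jinj; apply.
have [b] := ext_gen_perm [ffun l => e (J0 l)] (perm sinj).
have -> : [ffun l => [ffun l0 => e (J0 l0)] (perm sinj l)] = [ffun l => e (J l)].
  by apply/ffunP => l; rewrite !ffunE permE; case: (sP l) => l' /= ->.
move=> ->; apply: spannedZ.
have -> : gen [ffun l => e (J0 l)] = ext_basis B by rewrite /ext_basis E.
exact: spanned_gen.
Qed.

Lemma set_enumP B J : set_enum B = Some J ->
  injective J /\ [set J l | l in 'I_n]%SET = B.
Proof.
rewrite /set_enum; case: pickP => // J1 /andP[/injectiveP inj /eqP im] [<-].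
by split.
Qed.

Variables (S : comPzRingType) (phi : {rmorphism A -> S}) (u : 'I_d -> M -> S).
Hypothesis lu : forall j, semilinear_over phi (u j).
Hypothesis u_dual : forall j l, u j (e l) = (j == l)%:R.

(** The value is a minor of the identity matrix: the identity itself if the sets agree, and
    otherwise a matrix with a zero row, since sets of equal size that differ leave some [J l0]
    outside [B']. *)
Lemma ext_ev_dual B J B' : set_enum B = Some J ->
  ext_ev phi (fun l => u (J l)) (ext_basis B') = (B == B')%:R.
Proof.
move=> BJ; rewrite /ext_basis; have [Jinj JB] := set_enumP BJ.
have lJ l := lu (J l).
case E: (set_enum B') => [J'|]; last first.
  rewrite (negPf (_ : B != B')); last by apply: contraPneq E => <-; rewrite BJ.
  rewrite -(scale0r 0) (proj2 (ext_ev_semilinear lJ)).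
  by rewrite rmorph0 mul0r.
have [J'inj J'B'] := set_enumP E.
rewrite ext_ev_gen //.
have [BB'|BB'] := eqVneq B B'.
  move: E; rewrite -BB' BJ => -[<-].
  rewrite [X in \det X](_ : _ = 1%:M) ?det1 //.
  by apply/matrixP => l' l; rewrite !mxE ffunE u_dual (inj_eq Jinj).
have [l0 Bl0] : exists l0, J l0 \notin B'.
  apply/existsP; rewrite -negb_forall; apply: contra BB' => /forallP JB'.
  have sub : B \subset B' by rewrite -JB; apply/fintype.subsetP => _ /imsetP [l _ ->].
  by rewrite eqEcard sub -JB -J'B' !card_imset // leqnn.
rewrite (expand_det_row _ l0) big1 // => l _; rewrite !mxE ffunE u_dual.
case: eqP => [Jl|]; last by rewrite mul0r.
by move: Bl0; rewrite Jl -J'B' imset_f.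
Qed.

End ExteriorSpan.

(** Evaluation on the derivations dual to the generators [x] of the differentials reads off, one by
    one, the coefficients of the form in the induced family. *)
Lemma forms_eq0 (k A : comPzRingType) (str : {rmorphism k -> A}) (i m d : nat)
  (S : comPzRingType) (phi : {rmorphism A -> S}) (x : 'I_d -> A) (D : 'I_d -> A -> S) :
  (forall a, phi a = 0 -> a = 0) ->
  (forall w, spanned (fun j => pgen (Omega_rel str) (x j)) w) ->
  (forall j, derivation phi (D j)) -> (forall j c, D j (str c) = 0) ->
  (forall j l, D j (x l) = (j == l)%:R) ->
  forall s : forms str i m,
  (forall J : 'I_m -> 'I_i -> 'I_d, forms_ev phi (fun j l => D (J j l)) s = 0) ->
  s = 0.
Proof.
move=> phi_inj x_span dD Dk Dx s s0.
pose u j := omega_ev (str := str) phi (D j).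
have lu j : semilinear_over phi (u j) by exact: omega_ev_semilinear.
have u_dual j l : u j (pgen (Omega_rel str) (x l)) = (j == l)%:R.
  by rewrite /u omega_ev_gen.
pose e := ext_basis i (fun j => pgen (Omega_rel str) (x j)).
have [c sE] := multilinear_spanned (fun r (tr : tens_rel r) => tr)
  (ext_spanned (n := i) x_span) s.
rewrite sE big1 // => T _.
(* A multi-index with some [T j] of size other than [i] contributes a tensor with a zero factor. *)
have [TN|Tall] := pselect (exists j, set_enum i (T j) = None).
  have [j Tj] := TN; rewrite (gen_zero (fun r (tr : tens_rel r) => tr) (j := j)) ?scaler0 //.
  by rewrite ffunE /ext_basis Tj.
have {}Tall j : {J | set_enum i (T j) = Some J}.
  by case E: (set_enum i (T j)) => [J|]; [exists J | case: Tall; exists j].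
suff -> : c T = 0 by rewrite scale0r.
apply: phi_inj; rewrite -[RHS](s0 (fun j => sval (Tall j))).
have le j : semilinear_over phi (ext_ev phi (fun l => u (sval (Tall j) l))).
  by apply: ext_ev_semilinear => l; apply: lu.
rewrite sE /forms_ev (semilinear_sum _ (tens_ev_semilinear le)) (bigD1 T) //=.
have evZ := proj2 (tens_ev_semilinear le).
rewrite big1 => [|T' TT'].
  rewrite addr0 evZ tens_ev_gen // big1 ?mulr1 // => j _.
  by rewrite ffunE (ext_ev_dual lu u_dual _ (svalP (Tall j))) eqxx.
rewrite evZ tens_ev_gen //.
have [j Tj] : exists j, T' j != T j.
  apply/existsP; rewrite -negb_forall; apply: contra TT' => /forallP E.
  by apply/eqP/ffunP => j; apply/eqP.
rewrite (bigD1 j) //= ffunE (ext_ev_dual lu u_dual _ (svalP (Tall j))).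
by rewrite eq_sym (negPf Tj) mul0r mulr0.
Qed.

(** * Generic points, function fields and points with values in a field *)

(** More than topological density: nonzero sections are invertible at [x], which makes the stalk a
    field into which sections around [x] embed. *)
Definition generic (S : scheme) (x : S) :=
  (forall U : opens S, U !=set0 -> U x) /\
  forall (U : opens S) (s : sec U), s <> 0 -> basic s x.

Definition oI (T : topologicalType) (U V : opens T) : opens T :=
  Opens (openI (oset_open U) (oset_open V)).

Lemma oIl (T : topologicalType) (U V : opens T) : oI U V `<=` U.
Proof. by move=> x []. Qed.

Lemma oIr (T : topologicalType) (U V : opens T) : oI U V `<=` V.
Proof. by move=> x []. Qed.

Lemma resP (S : ringed_space) (U V : opens S) (h h' : V `<=` U) (s : sec U) :
  res h s = res h' s.
Proof. by rewrite (Prop_irrelevance h h'). Qed.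

Lemma res2 (S : ringed_space) (U V W : opens S) (hV : V `<=` U) (hW : W `<=` V)
  (s : sec U) : res hW (res hV s) = res (subset_trans hW hV) s.
Proof. exact: res_res. Qed.

(** * Stalks as rings *)

Section Stalk.
Variables (S : scheme) (x : S).

Record germ_pair := GermPair {
  gp_open : opens S ; gp_mem : gp_open x ; gp_sec : sec gp_open }.

HB.instance Definition _ := gen_eqMixin germ_pair.
HB.instance Definition _ := gen_choiceMixin germ_pair.

Definition germ_equiv (p q : germ_pair) : bool :=
  `[< exists (W : opens S) (h : W `<=` gp_open p) (h' : W `<=` gp_open q),
        W x /\ res h (gp_sec p) = res h' (gp_sec q) >].

Lemma germ_equiv_refl : reflexive germ_equiv.
Proof.
move=> [U Ux s]; apply/asboolP => /=.
by exists U, (fun y Uy => Uy), (fun y Uy => Uy).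
Qed.

Lemma germ_equiv_sym : symmetric germ_equiv.
Proof.
by move=> p q; apply/asboolP/asboolP => -[W [h [h' [Wx e]]]]; exists W, h', h.
Qed.

Lemma germ_equiv_trans : transitive germ_equiv.
Proof.
move=> q p r /asboolP [W [h [h' [Wx e]]]] /asboolP [V [g [g' [Vx e']]]].
apply/asboolP; have [l r'] := (@oIl _ W V, @oIr _ W V).
exists (oI W V), (subset_trans l h), (subset_trans r' g'); split; first by [].
by rewrite -!res2 e -e' !res2; apply: resP.
Qed.

Canonical germ_equivRel :=
  EquivRel germ_equiv germ_equiv_refl germ_equiv_sym germ_equiv_trans.

Definition stalk : Type := {eq_quot germ_equivRel}.
HB.instance Definition _ : EqQuotient _ germ_equivRel stalk := EqQuotient.on stalk.
HB.instance Definition _ := Choice.on stalk.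

Definition germ_at (U : opens S) (Ux : U x) (s : sec U) : stalk :=
  \pi_stalk (GermPair Ux s).

Lemma germ_atP (U V : opens S) (Ux : U x) (Vx : V x) (s : sec U) (t : sec V) :
  germ_at Ux s = germ_at Vx t <->
  exists (W : opens S) (h : W `<=` U) (h' : W `<=` V), W x /\ res h s = res h' t.
Proof.
split=> [/eqmodP/asboolP //|e].
by apply/eqmodP/asboolP.
Qed.

Lemma germ_at_res (U V : opens S) (Ux : U x) (Vx : V x) (h : V `<=` U) (s : sec U) :
  germ_at Vx (res h s) = germ_at Ux s.
Proof.
apply/germ_atP; exists V, (fun y Vy => Vy), h; split=> //.
by rewrite res_id.
Qed.

Lemma stalkW (P : stalk -> Prop) :
  (forall (U : opens S) (Ux : U x) (s : sec U), P (germ_at Ux s)) -> forall z, P z.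
Proof. by move=> PU z; rewrite -[z]reprK; case: (repr z) => U Ux s; apply: PU. Qed.

Lemma stalkW2 (P : stalk -> stalk -> Prop) :
  (forall (U : opens S) (Ux : U x) (s t : sec U), P (germ_at Ux s) (germ_at Ux t)) ->
  forall z w, P z w.
Proof.
move=> PU; elim/stalkW=> U Ux s; elim/stalkW=> V Vx t.
have UVx : oI U V x by [].
by rewrite -(germ_at_res Ux UVx (@oIl _ U V)) -(germ_at_res Vx UVx (@oIr _ U V)).
Qed.

Lemma stalkW3 (P : stalk -> stalk -> stalk -> Prop) :
  (forall (U : opens S) (Ux : U x) (s t r : sec U),
     P (germ_at Ux s) (germ_at Ux t) (germ_at Ux r)) ->
  forall z w v, P z w v.
Proof.
move=> PU z w v; move: z w; apply: stalkW2 => U Ux s t; elim/stalkW: v => V Vx r.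
have UVx : oI U V x by [].
by rewrite -!(germ_at_res Ux UVx (@oIl _ U V)) -(germ_at_res Vx UVx (@oIr _ U V)).
Qed.

(** One construction for sum, product and opposite: restrict both representatives to the
    intersection of their open sets. *)
Definition stalk_op (f : forall U : opens S, sec U -> sec U -> sec U) (z w : stalk) :
    stalk :=
  let p := repr z in let q := repr w in
  @germ_at (oI (gp_open p) (gp_open q)) (conj (gp_mem p) (gp_mem q))
    (f _ (res (@oIl _ _ _) (gp_sec p)) (res (@oIr _ _ _) (gp_sec q))).

Lemma stalk_opE (f : forall U : opens S, sec U -> sec U -> sec U) :
  (forall (U V : opens S) (h : V `<=` U) (s t : sec U),
     res h (f U s t) = f V (res h s) (res h t)) ->
  forall (U : opens S) (Ux : U x) (s t : sec U),
  stalk_op f (germ_at Ux s) (germ_at Ux t) = germ_at Ux (f U s t).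
Proof.
move=> f_res U Ux s t; rewrite /stalk_op.
have: germ_at (gp_mem (repr (germ_at Ux s))) (gp_sec (repr (germ_at Ux s))) = germ_at Ux s.
  by rewrite /germ_at -[RHS]reprK; case: (repr _).
case: (repr (germ_at Ux s)) => U1 U1x s1 /= /germ_atP [W [h [h' [Wx e]]]].
have: germ_at (gp_mem (repr (germ_at Ux t))) (gp_sec (repr (germ_at Ux t))) = germ_at Ux t.
  by rewrite /germ_at -[RHS]reprK; case: (repr _).
case: (repr (germ_at Ux t)) => U2 U2x t1 /= /germ_atP [V [g [g' [Vx e']]]].
apply/germ_atP; have [l r] := (@oIl _ W V, @oIr _ W V).
have h1 : oI W V `<=` oI U1 U2 by move=> y [/h ? /g ?].
exists (oI W V), h1, (subset_trans l h'); split; first by [].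
rewrite !f_res !res2; congr f.
  by rewrite -(res2 h' l) -e res2; apply: resP.
by rewrite (resP _ (subset_trans r g')) -(res2 g' r) -e' res2; apply: resP.
Qed.

Definition stalk_add := stalk_op (fun (U : opens S) (s t : sec U) => s + t).
Definition stalk_mul := stalk_op (fun (U : opens S) (s t : sec U) => s * t).
Definition stalk_opp (z : stalk) := stalk_op (fun (U : opens S) (s _ : sec U) => - s) z z.

Lemma stalk_addE (U : opens S) (Ux : U x) (s t : sec U) :
  stalk_add (germ_at Ux s) (germ_at Ux t) = germ_at Ux (s + t).
Proof. by apply: stalk_opE => *; apply: rmorphD. Qed.

Lemma stalk_mulE (U : opens S) (Ux : U x) (s t : sec U) :
  stalk_mul (germ_at Ux s) (germ_at Ux t) = germ_at Ux (s * t).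
Proof. by apply: stalk_opE => *; apply: rmorphM. Qed.

Lemma stalk_oppE (U : opens S) (Ux : U x) (s : sec U) :
  stalk_opp (germ_at Ux s) = germ_at Ux (- s).
Proof. by apply: stalk_opE => *; apply: rmorphN. Qed.

Definition oT_mem : oT S x := I.

Lemma germ_at_cst (c : forall U : opens S, sec U) :
  (forall (U V : opens S) (h : V `<=` U), res h (c U) = c V) ->
  forall (U : opens S) (Ux : U x), germ_at oT_mem (c _) = germ_at Ux (c U).
Proof. by move=> cres U Ux; rewrite -(germ_at_res oT_mem Ux (@subsetT _ _)) cres. Qed.

Definition stalk_zero : stalk := germ_at oT_mem 0.
Definition stalk_one : stalk := germ_at oT_mem 1.

Lemma stalk_zeroE (U : opens S) (Ux : U x) : germ_at Ux 0 = stalk_zero.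
Proof. by apply/esym/(@germ_at_cst (fun=> 0)) => *; apply: rmorph0. Qed.

Lemma stalk_oneE (U : opens S) (Ux : U x) : germ_at Ux 1 = stalk_one.
Proof. by apply/esym/(@germ_at_cst (fun=> 1)) => *; apply: rmorph1. Qed.

Lemma stalk_addA : associative stalk_add.
Proof. by apply: stalkW3 => U Ux s t r; rewrite !stalk_addE addrA. Qed.

Lemma stalk_addC : commutative stalk_add.
Proof. by apply: stalkW2 => U Ux s t; rewrite !stalk_addE addrC. Qed.

Lemma stalk_add0 : left_id stalk_zero stalk_add.
Proof. by elim/stalkW=> U Ux s; rewrite -(stalk_zeroE Ux) stalk_addE add0r. Qed.

Lemma stalk_addN : left_inverse stalk_zero stalk_opp stalk_add.
Proof.
by elim/stalkW=> U Ux s; rewrite stalk_oppE stalk_addE addNr stalk_zeroE.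
Qed.

HB.instance Definition _ :=
  GRing.isZmodule.Build stalk stalk_addA stalk_addC stalk_add0 stalk_addN.

Lemma stalk_mulA : associative stalk_mul.
Proof. by apply: stalkW3 => U Ux s t r; rewrite !stalk_mulE mulrA. Qed.

Lemma stalk_mulC : commutative stalk_mul.
Proof. by apply: stalkW2 => U Ux s t; rewrite !stalk_mulE mulrC. Qed.

Lemma stalk_mul1 : left_id stalk_one stalk_mul.
Proof. by elim/stalkW=> U Ux s; rewrite -(stalk_oneE Ux) stalk_mulE mul1r. Qed.

Lemma stalk_mulDl : left_distributive stalk_mul stalk_add.
Proof.
by apply: stalkW3 => U Ux s t r; rewrite !(stalk_addE, stalk_mulE) mulrDl.
Qed.

Lemma stalk_one_neq0 : stalk_one != stalk_zero.
Proof.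
apply/eqP => /germ_atP [W [h [h' [Wx]]]]; rewrite rmorph1 rmorph0 => e.
apply: (@stalk_nontrivial S x W); exists W, (fun y Wy => Wy); split=> //.
by exists 0; rewrite mulr0.
Qed.

HB.instance Definition _ := GRing.Zmodule_isComNzRing.Build stalk
  stalk_mulA stalk_mulC stalk_mul1 stalk_mulDl stalk_one_neq0.

Lemma germ_at_zmod (U : opens S) (Ux : U x) : zmod_morphism (germ_at Ux).
Proof. by move=> s t; rewrite -[RHS]/(stalk_add _ (stalk_opp _)) stalk_oppE stalk_addE. Qed.

Lemma germ_at_monoid (U : opens S) (Ux : U x) : monoid_morphism (germ_at Ux).
Proof.
split; first exact: stalk_oneE.
by move=> s t; rewrite -[RHS]/(stalk_mul _ _) stalk_mulE.
Qed.

HB.instance Definition _ (U : opens S) (Ux : U x) :=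
  GRing.isZmodMorphism.Build (sec U) stalk (germ_at Ux) (@germ_at_zmod U Ux).
HB.instance Definition _ (U : opens S) (Ux : U x) :=
  GRing.isMonoidMorphism.Build (sec U) stalk (germ_at Ux) (@germ_at_monoid U Ux).

Lemma germ_at_invertible (U : opens S) (Ux : U x) (s : sec U) :
  basic s x <-> exists z : stalk, z * germ_at Ux s = 1.
Proof.
split=> [[V [h [Vx [b sb]]]]|[]].
  exists (germ_at Vx b); rewrite -(germ_at_res Ux Vx h) -rmorphM mulrC sb.
  by rewrite rmorph1.
elim/stalkW=> V Vx t e.
have VUx : oI V U x by [].
move: e; rewrite -(germ_at_res Vx VUx (@oIl _ _ _)) -(germ_at_res Ux VUx (@oIr _ _ _)).
rewrite -rmorphM => /germ_atP [W [h [h' [Wx]]]]; rewrite rmorphM rmorph1 !res2 => e.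
exists W, (subset_trans h (@oIr _ _ _)); split=> //.
by exists (res (subset_trans h (@oIl _ _ _)) t); rewrite mulrC.
Qed.

End Stalk.

Section FunctionField.
Variables (S : scheme) (x : S).

(** The proof of genericity is a phantom argument, so that the field structure can be attached to
    the type. *)
Definition ff (_ : generic x) : Type := stalk x.

Variable gen_x : generic x.
Notation K := (ff gen_x).

HB.instance Definition _ := GRing.ComNzRing.copy K (stalk x).

Lemma ff_inv_ex (z : K) : exists w : K, z != 0 -> w * z = 1.
Proof.
have [z0|z0] := eqVneq z 0; first by exists 0.
elim/stalkW: z z0 => U Ux s s0.
have /(germ_at_invertible Ux) [w ws] : basic s x.
  by apply: (proj2 gen_x) => s00; move: s0; rewrite s00 rmorph0 eqxx.
by exists w.
Qed.

Definition ff_inv (z : K) : K := if z == 0 then 0 else sval (cid (ff_inv_ex z)).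

Lemma ff_mulVf (z : K) : z != 0 -> ff_inv z * z = 1.
Proof. by move=> z0; rewrite /ff_inv ifN //; case: cid => w /= ->. Qed.

Lemma ff_inv0 : ff_inv 0 = 0.
Proof. by rewrite /ff_inv ifT. Qed.

HB.instance Definition _ := GRing.ComNzRing_isField.Build K ff_mulVf ff_inv0.

Definition ff_germ (U : opens S) (Ux : U x) : {rmorphism sec U -> K} := germ_at Ux.

Lemma ff_germ_res (U V : opens S) (Ux : U x) (Vx : V x) (h : V `<=` U) (s : sec U) :
  ff_germ Vx (res h s) = ff_germ Ux s.
Proof. exact: germ_at_res. Qed.

Lemma ff_germ_eq0 (U : opens S) (Ux : U x) (s : sec U) : ff_germ Ux s = 0 -> s = 0.
Proof.
move=> s0; apply: contrapT => /(proj2 gen_x) /(germ_at_invertible Ux) [z].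
by rewrite [germ_at Ux s]s0 mulr0 => /esym/eqP; rewrite oner_eq0.
Qed.

Lemma ff_germ_basic (U : opens S) (Ux : U x) (s : sec U) : ff_germ Ux s != 0 -> basic s x.
Proof. by move=> s0; apply: (proj2 gen_x) => s00; move: s0; rewrite s00 rmorph0 eqxx. Qed.

End FunctionField.


(** * Points with values in a field *)

Section Points.
Variable (L : fieldType).

Notation Lpt := (spec_scheme L).

Section Eval.
Variables (X : scheme) (a : morphism Lpt X).

Definition ev (V : opens X) (Va : V (a tt)) (s : sec V) : L :=
  (pull a V s : spec_sec L (mpreim a V)) (SigSub (mem_set (Va : (a @^-1` V) tt))).

Lemma ev_zmod (V : opens X) (Va : V (a tt)) : zmod_morphism (ev Va).
Proof. by move=> s t; rewrite /ev rmorphB. Qed.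

Lemma ev_monoid (V : opens X) (Va : V (a tt)) : monoid_morphism (ev Va).
Proof. by split=> [|s t]; rewrite /ev ?rmorph1 ?rmorphM. Qed.

HB.instance Definition _ (V : opens X) (Va : V (a tt)) :=
  GRing.isZmodMorphism.Build (sec V) L (ev Va) (@ev_zmod V Va).
HB.instance Definition _ (V : opens X) (Va : V (a tt)) :=
  GRing.isMonoidMorphism.Build (sec V) L (ev Va) (@ev_monoid V Va).

Lemma ev_res (V W : opens X) (Va : V (a tt)) (Wa : W (a tt)) (h : W `<=` V) (s : sec V) :
  ev Wa (res h s) = ev Va s.
Proof.
have h' : mpreim a W `<=` mpreim a V by move=> y /h.
rewrite /ev -(pull_res h h') /= /spec_res_fun /=.
by congr (pull a V s _); apply: val_inj.
Qed.

(** From left to right, this is the locality of [a]; conversely, a local inverse of [s] evaluates to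
    an inverse of the value. *)
Lemma ev_basic (V : opens X) (Va : V (a tt)) (s : sec V) : ev Va s != 0 <-> basic s (a tt).
Proof.
split=> [s0|[W [h [Wa [b sb]]]]].
  apply: pull_local; apply/spec_basicP.
  by exists (Va : (mpreim a V : set _) tt).
rewrite -(ev_res Va Wa h); apply/eqP => s0.
have : ev Wa (res h s) * ev Wa b = 1 by rewrite -rmorphM sb rmorph1.
by move/eqP; rewrite s0 mul0r eq_sym oner_eq0.
Qed.

End Eval.

Lemma ev_mcomp (X Y : scheme) (h : morphism X Y) (a : morphism Lpt X) (V : opens Y)
  (Va : V (mcomp h a tt)) (Va' : mpreim h V (a tt)) (s : sec V) :
  ev Va s = ev Va' (pull h V s).
Proof.
rewrite /ev /= /spec_res_fun /=.
by congr (pull a _ (pull h V s) _); apply: val_inj.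
Qed.

Lemma ev_eq (X : scheme) (a b : morphism Lpt X) (V : opens X) (Va : V (a tt))
  (Vb : V (b tt)) (s : sec V) : mor_eq a b -> ev Va s = ev Vb s.
Proof.
move=> [ab pab].
have sa : oT Lpt `<=` mpreim a V by case.
have sb : oT Lpt `<=` mpreim b V by case.
have := congr1 (fun t : spec_sec L (oT Lpt) => t (SigSub (mem_set (I : [set: Lpt] tt))))
  (pab V s _ sa sb).
rewrite /= /spec_res_fun /ev /= => e.
apply: etrans (etrans e _); [congr (pull a V s _) | congr (pull b V s _)]; exact: val_inj.
Qed.

Section MakePoint.
Variables (X : scheme) (c : X).
Variable e : forall V : opens X, V c -> {rmorphism sec V -> L}.
Hypothesis e_res : forall (V W : opens X) (Vc : V c) (Wc : W c) (h : W `<=` V) (s : sec V),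
  e Wc (res h s) = e Vc s.
Hypothesis e_local : forall (V : opens X) (Vc : V c) (s : sec V), e Vc s != 0 -> basic s c.

Definition mkpt_fun (_ : Lpt) : X := c.

Lemma mkpt_cont : continuous mkpt_fun.
Proof. exact: cst_continuous. Qed.

Definition mkpt_pull_fun (V : opens X) (s : sec V) : spec_sec L (Defs.preim mkpt_cont V) :=
  fun z => e (set_valP z) s.

Lemma mkpt_pull_zmod (V : opens X) : zmod_morphism (@mkpt_pull_fun V).
Proof. by move=> s t; apply/funext => z; rewrite /mkpt_pull_fun rmorphB. Qed.

Lemma mkpt_pull_monoid (V : opens X) : monoid_morphism (@mkpt_pull_fun V).
Proof.
by split=> [|s t]; apply/funext => z; rewrite /mkpt_pull_fun ?rmorph1 ?rmorphM.
Qed.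

HB.instance Definition _ (V : opens X) :=
  GRing.isZmodMorphism.Build (sec V) (spec_sec L (Defs.preim mkpt_cont V))
    (@mkpt_pull_fun V) (@mkpt_pull_zmod V).
HB.instance Definition _ (V : opens X) :=
  GRing.isMonoidMorphism.Build (sec V) (spec_sec L (Defs.preim mkpt_cont V))
    (@mkpt_pull_fun V) (@mkpt_pull_monoid V).

Definition mkpt_pull (V : opens X) : {rmorphism sec V -> sec (Defs.preim mkpt_cont V)} :=
  @mkpt_pull_fun V.

Lemma mkpt_pull_res (V W : opens X) (h : W `<=` V)
    (h' : Defs.preim mkpt_cont W `<=` Defs.preim mkpt_cont V) (s : sec V) :
  res h' (mkpt_pull V s) = mkpt_pull W (res h s).
Proof.
apply/funext => z; rewrite /= /spec_res_fun /mkpt_pull_fun.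
by rewrite (e_res (set_valP (spec_incl h' z))).
Qed.

Lemma mkpt_pull_local (V : opens X) (s : sec V) x :
  basic (mkpt_pull V s) x -> basic s (mkpt_fun x).
Proof. by move/spec_basicP => [Ux /e_local]. Qed.

(** Compatible local maps from the sections around [c] to [L], in effect a local map out of the
    stalk, suffice. Used for the generic point and for a point of X(k) extended to a larger
    field. *)
Definition mkpt : morphism Lpt X := Morphism mkpt_pull_res mkpt_pull_local.

Lemma ev_mkpt (V : opens X) (Vc : V (mkpt tt)) (s : sec V) : ev Vc s = e Vc s.
Proof. by rewrite /ev /= /mkpt_pull_fun; congr (e _ s); apply: Prop_irrelevance. Qed.

End MakePoint.

End Points.

(** * Invertibility loci and existence of generic points *)

Section Basic.
Variable S : scheme.
Implicit Types U V W : opens S.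

Lemma basic_mem U (f : sec U) x : basic f x -> U x.
Proof. exact: basic_sub. Qed.

Lemma basic1 U x : U x -> basic (1 : sec U) x.
Proof.
move=> Ux; exists U, (fun y Uy => Uy); split=> //.
by exists 1; rewrite rmorph1 mulr1.
Qed.

Lemma basicMr U (f g : sec U) x : basic (f * g) x -> basic g x.
Proof.
move=> [V [h [Vx [b fgb]]]]; exists V, h; split=> //.
by exists (res h f * b); rewrite mulrCA mulrA -rmorphM.
Qed.

Lemma basicM U (f g : sec U) x : basic f x -> basic g x -> basic (f * g) x.
Proof.
move=> [V [h [Vx [b fb]]]] [W [h' [Wx [c gc]]]].
have [l r] := (@oIl _ V W, @oIr _ V W).
exists (oI V W), (subset_trans l h); split; first by [].
exists (res l b * res r c).
have e1 : res (subset_trans l h) f * res l b = 1 by rewrite -res2 -rmorphM fb rmorph1.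
have e2 : res (subset_trans l h) g * res r c = 1.
  by rewrite (resP _ (subset_trans r h')) -res2 -rmorphM gc rmorph1.
by rewrite rmorphM mulrACA e1 e2 mulr1.
Qed.

Lemma basicX U (f : sec U) n x : basic f x -> basic (f ^+ n) x.
Proof.
move=> fx; elim: n => [|n IHn]; first by rewrite expr0; apply/basic1/(basic_mem fx).
by rewrite exprS; apply: basicM.
Qed.

Lemma basicN U (f : sec U) x : basic (- f) x -> basic f x.
Proof. by rewrite -mulN1r; apply: basicMr. Qed.

Lemma basic_res_in U V (h : V `<=` U) (f : sec U) x : V x -> basic f x -> basic (res h f) x.
Proof.
move=> Vx [W [h' [Wx [b fb]]]]; exists (oI V W), (@oIl _ V W); split; first by [].
exists (res (@oIr _ V W) b).
by rewrite res2 (resP _ (subset_trans (@oIr _ V W) h')) -res2 -rmorphM fb rmorph1.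
Qed.

Lemma basic_neq0 U (f : sec U) x : basic f x -> f <> 0.
Proof. by move=> fx f0; move: fx; rewrite f0; apply: stalk_nontrivial. Qed.

Lemma sec_locally0 U (s : sec U) :
  (forall x, U x -> exists (V : opens S) (h : V `<=` U), V x /\ res h s = 0) -> s = 0.
Proof.
move=> s0; pose F := [set V : opens S | exists h : V `<=` U, res h s = 0].
apply: (@sec_separated S U F).
  apply/seteqP; split=> [x /s0 [V [h [Vx Vs]]]|x [V [h _] /h]] //.
  by exists V => //; exists h.
by move=> V h [h' e]; rewrite -[RHS]e; apply: resP.
Qed.

Lemma affine_frac U V x (s : sec V) : affine U -> U x -> V x ->
  exists (a b : sec U) (W : opens S) (hU : W `<=` U) (hV : W `<=` V),
    [/\ W x, basic b x & res hU b * res hV s = res hU a].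
Proof.
move=> [_ _ bas loc] Ux Vx.
have [f [fx fV]] := bas (oI U V) x (@oIl _ U V) (conj Ux Vx).
have fV' : basic f `<=` V by apply: subset_trans fV (@oIr _ U V).
have [/(_ (res fV' s)) [n [a e]] _] := loc f.
exists a, (f ^+ n), (basic f), (@basic_sub S U f), fV'; split=> //.
exact: basicX.
Qed.

(** The point is the one that corresponds to the prime ideal 0. *)
Lemma affine_domain_generic U : affine U -> (1 : sec U) <> 0 ->
  (forall a b : sec U, a * b = 0 -> a = 0 \/ b = 0) ->
  exists x, U x /\ forall a : sec U, a <> 0 -> basic a x.
Proof.
move=> [/(_ [set 0]) spc _ _ _] one0 dom.
have [|x [[Ux e] _]] := spc.
  split=> //=; first by move=> a b -> ->; rewrite addr0.
  by move=> a b ->; rewrite mulr0.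
exists x; split=> // a a0; apply: contrapT => ax.
by apply: a0; have : [set f : sec U | ~ basic f x] a by []; rewrite -e.
Qed.

Lemma affine_generic_mem U x : affine U -> (forall a : sec U, a <> 0 -> basic a x) ->
  forall (V : opens S) y, U y -> V y -> V x.
Proof.
move=> aU gx V y Uy Vy; have [_ _ bas _] := aU.
have [f [fy fV]] := bas (oI U V) y (@oIl _ U V) (conj Uy Vy).
by have [] := fV x (gx f (basic_neq0 fy)).
Qed.

(** If [s] is not invertible at [x], write it near any [y] as a/b. A nonzero [a] would be invertible
    at [x], and then so would [s]; hence [a] is 0 and [s] vanishes near [y]. *)
Lemma generic_intro x : (forall U : opens S, U !=set0 -> U x) ->
  (forall y, exists U : opens S, [/\ U y, affine U & forall a : sec U, a <> 0 -> basic a !=set0]) ->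
  generic x.
Proof.
move=> mem cov; split=> // V s s0; apply: contrapT => sx; apply: s0.
apply: sec_locally0 => y Vy; have [U [Uy aU Ugen]] := cov y.
have [a [b [W [hU [hV [Wy [W' [h' [W'y [c bc]]]] e]]]]]] := affine_frac s aU Uy Vy.
have a0 : a = 0.
  apply: contrapT => /Ugen /(mem (basic a)) ax.
  have Wx : W x by apply: mem; exists y.
  have := basic_res_in hU Wx ax; rewrite -e => /basicMr /basic_res.
  exact: sx.
have [l r] := (@oIl _ W W', @oIr _ W W').
exists (oI W W'), (subset_trans l hV); split; first by [].
have := congr1 (res l) e; rewrite a0 rmorphM !res2 !rmorph0 => {}e.
have bc' : res (subset_trans l hU) b * res r c = 1.
  by rewrite (resP _ (subset_trans r h')) -res2 -rmorphM bc rmorph1.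
by rewrite -[LHS]mul1r -bc' mulrAC e mul0r.
Qed.

Lemma sec_empty U (s t : sec U) : ~ (U !=set0) -> s = t.
Proof.
move=> U0; apply/eqP; rewrite -subr_eq0; apply/eqP/sec_locally0 => x Ux.
by case: U0; exists x.
Qed.

Lemma integral_generic : integral S -> exists x : S, generic x.
Proof.
move=> [[x0 _] dom].
(* Two disjoint nonempty open sets would allow gluing 1 and 0 to a nontrivial idempotent, which a
   domain does not have. *)
have irr (U V : opens S) : U !=set0 -> V !=set0 -> (oI U V : set S) !=set0.
  move=> U0 V0; apply: contrapT => UV.
  pose N : opens S := Opens (openU (oset_open U) (oset_open V)).
  have hU : U `<=` N by left.
  have hV : V `<=` N by right.
  pose s (W : opens S) : sec W := if `[< W `<=` U >] then 1 else 0.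
  (* So that the value of [s] on [V] is indeed 0. *)
  have VU : ~ V `<=` U by move=> VU; case: V0 => y Vy; apply: UV; exists y; split=> //; apply: VU.
  have [||t tP] := @sec_glue S N [set U; V]%classic s.
  - apply/seteqP; split=> [y [Uy|Vy]|y [W [->|->]]].
    + by exists U => //; left.
    + by exists V => //; right.
    + by left.
    + by right.
  - move=> A B W h h' AE BE.
    have [[y Wy]|/sec_empty] := pselect (W !=set0); last exact.
    case: AE BE => -> [] -> in h h' *; try exact: resP.
      by case: UV; exists y; split; [apply: h | apply: h'].
    by case: UV; exists y; split; [apply: h' | apply: h].
  have tU : res hU t = 1 by rewrite (tP _ hU) /s ?asboolT //; left.
  have tV : res hV t = 0 by rewrite (tP _ hV) /s ?asboolF //; right.
  have tt : t * (t - 1) = 0.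
    apply: sec_locally0 => y [Uy|Vy]; [exists U, hU|exists V, hV]; split=> //.
      by rewrite rmorphM rmorphB rmorph1 tU subrr mulr0.
    by rewrite rmorphM tV mul0r.
  have [] := (dom N _).2 _ _ tt.
  - by case: U0 => y Uy; exists y; left.
  - move=> t0; case: (dom U U0) => n _; apply: n.
    by rewrite -tU t0 rmorph0.
  - move=> t1; case: (dom V V0) => n _; apply: n.
    have -> : 1 = res hV 1 :> sec V by rewrite rmorph1.
    by rewrite -[RHS]tV -[in RHS](subrK 1 t) t1 add0r.
have Ugen (U : opens S) : affine U -> U !=set0 ->
    exists x, U x /\ forall a : sec U, a <> 0 -> basic a x.
  by move=> aU /dom [one0 domU]; apply: affine_domain_generic.
have [U [Ux aU]] := affine_cover x0.
have [x [Ux' gx]] := Ugen U aU (ex_intro _ x0 Ux).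
exists x; apply: generic_intro.
  move=> V V0; have [y [Uy Vy]] := irr U V (ex_intro _ x0 Ux) V0.
  exact: (affine_generic_mem aU gx Uy Vy).
move=> y; have [V [Vy aV]] := affine_cover y.
exists V; split=> // a a0; have [z [Vz gz]] := Ugen V aV (ex_intro _ y Vy).
by exists z; apply: gz.
Qed.

End Basic.

Lemma basic_pull (X Y : scheme) (f : morphism X Y) (V : opens Y) (s : sec V) x :
  basic s (f x) -> basic (pull f V s) x.
Proof.
move=> [W [h [Wx [b sb]]]].
have h' : mpreim f W `<=` mpreim f V by move=> y /h.
exists (mpreim f W), h'; split=> //; exists (pull f W b).
by rewrite (pull_res h) -rmorphM sb rmorph1.
Qed.

(** Take [V] to be the image of [U]. Then [mpreim j V] has the same points as [U] without being
    convertible to it, hence the restriction along [h]. *)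
Lemma open_immersion_sec (X Y : scheme) (j : morphism X Y) (U : opens X) (s : sec U) :
  open_immersion j ->
  exists (V : opens Y) (t : sec V) (h : mpreim j V `<=` U),
    (forall x, U x -> V (j x)) /\ pull j V t = res h s.
Proof.
move=> [inj op bij].
pose V : opens Y := Opens (op U (oset_open U)).
have h : mpreim j V `<=` U by move=> x [y Uy /inj <-].
have [|g _ gK] := bij V; first by move=> _ [x _ <-]; exists x.
exists V, (g (res h s)), h; split; first by move=> x Ux; exists x.
exact: gK.
Qed.

Lemma open_immersion_generic (X Y : scheme) (j : morphism X Y) y :
  open_immersion j -> [set: X] !=set0 -> generic y -> exists x, j x = y /\ generic x.
Proof.
move=> oj [x0 _] [mem bas]; have [inj op bij] := oj.
pose V : opens Y := Opens (op setT openT).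
have [|x _ jx] := mem V; first by exists (j x0), x0.
exists x; split=> //; split=> [U [z Uz]|U s s0].
  pose V' : opens Y := Opens (op U (oset_open U)).
  have [|x' Ux' jx'] := mem V'; first by exists (j z), z.
  by rewrite -(inj x' x) // jx jx'.
have [V' [t [h [UV' ts]]]] := open_immersion_sec s oj.
have t0 : t <> 0.
  move=> t0; apply: s0; apply: sec_locally0 => z Uz; exists (mpreim j V'), h; split.
    exact: UV'.
  by rewrite -ts t0 rmorph0.
by apply: (@basic_res X _ _ h); rewrite -ts; apply: basic_pull; rewrite jx; apply: bas.
Qed.

(** The zero ideal of either polynomial ring gives a point. The one of [U1] lies in [U0] as well,
    because the nonzero coordinate is invertible there; hence the one of [U0] lies in every nonempty
    open set. *)
Lemma projective_line_generic (L : fieldType) (P : kscheme L) :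
  projective_line P -> exists x : P, generic x.
Proof.
move=> [U0 [U1 [phi0 [phi1 [[a0 a1] [b0 b1] _ cov [_ U01 _]]]]]].
have gen (U : opens P) (phi : {rmorphism {poly L} -> sec U}) : affine U -> bijective phi ->
    exists x, U x /\ forall a : sec U, a <> 0 -> basic a x.
  move=> aU [psi phiK psiK]; apply: affine_domain_generic => //.
    move=> e; have := congr1 psi e; rewrite -(rmorph1 phi) -(rmorph0 phi) !phiK.
    by move/eqP; rewrite oner_eq0.
  move=> a b; rewrite -(psiK a) -(psiK b) -rmorphM => /(congr1 psi).
  rewrite -(rmorph0 phi) !phiK => /eqP; rewrite mulf_eq0 => /orP [] /eqP ->;
    [by left | by right].
have [x0 [U0x0 g0]] := gen U0 phi0 a0 b0; have [x1 [U1x1 g1]] := gen U1 phi1 a1 b1.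
exists x0; apply: generic_intro.
  move=> V [y Vy]; have : [set: P] y by []; rewrite -cov => -[U0y|U1y].
    exact: (affine_generic_mem a0 g0 U0y Vy).
  have U0x1 : (U0 `&` U1) x1.
    rewrite U01; apply: g1 => e; case: b1 => psi phiK _.
    have := congr1 psi e; rewrite -(rmorph0 phi1) !phiK => /eqP.
    by rewrite polyX_eq0.
  exact: (affine_generic_mem a0 g0 (proj1 U0x1) (affine_generic_mem a1 g1 U1y Vy)).
move=> y; have : [set: P] y by []; rewrite -cov => -[U0y|U1y].
  by exists U0; split=> // a /g0; exists x0.
by exists U1; split=> // a /g1; exists x1.
Qed.

Section GenericPoint.
Variables (S : scheme) (x : S) (gen_x : generic x).

Definition gpt : morphism (spec_scheme (ff gen_x)) S :=
  mkpt (@ff_germ_res S x gen_x) (@ff_germ_basic S x gen_x).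

Lemma ev_gpt_eq0 (U : opens S) (Ux : U (gpt tt)) (s : sec U) : ev Ux s = 0 -> s = 0.
Proof. by rewrite ev_mkpt; apply: ff_germ_eq0. Qed.

(** The function field is the fraction field of any affine open set containing the generic point. *)
Lemma ff_frac (U : opens S) (Ux : U (gpt tt)) (z : ff gen_x) : affine U ->
  exists a b : sec U, ev Ux b != 0 /\ ev Ux b * z = ev Ux a.
Proof.
move=> aU; elim/stalkW: z => V Vx s.
have [a [b [W [hU [hV [Wx bx e]]]]]] := affine_frac s aU Ux Vx.
exists a, b; split; first exact/ev_basic.
have Wx' : W (gpt tt) by [].
have -> : germ_at Vx s = ev Wx' (res hV s) :> ff gen_x.
  by rewrite (ev_res (Vx : V (gpt tt)) Wx' hV) ev_mkpt.
by rewrite -!(ev_res Ux Wx' hU) -e rmorphM.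
Qed.

End GenericPoint.

(** * Derivations *)

Lemma derivation_comp (A B S : comPzRingType) (rho : {rmorphism A -> B}) (phi d : B -> S) :
  derivation phi d -> derivation (phi \o rho) (d \o rho).
Proof. by move=> [dD dM]; split=> a b /=; rewrite ?rmorphD ?rmorphM ?dD ?dM. Qed.

Section DerivationExt.
Variables (A : comPzRingType) (K : fieldType) (lam : {rmorphism A -> K}) (d : A -> K).
Hypothesis dd : derivation lam d.
Hypothesis d_ker : forall a, lam a = 0 -> d a = 0.
Hypothesis frac : forall z : K, exists a b, lam b != 0 /\ lam b * z = lam a.

(** The quotient rule on a chosen fraction; [d_ker] makes the result independent of the fraction. *)
Lemma derivation_ext : exists del : K -> K,
  derivation id del /\ forall a, del (lam a) = d a.
Proof.
have [dD dM] := dd.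
have sP z : {ab : A * A | lam ab.2 != 0 /\ lam ab.2 * z = lam ab.1}.
  by apply: cid; have [a [b ab]] := frac z; exists (a, b).
pose del z := (d (sval (sP z)).1 - z * d (sval (sP z)).2) / lam (sval (sP z)).2.
(* The quotient rule holds for every fraction that represents [z]: two of them differ by b a' - a
   b', an element of the kernel of [lam], killed by [d]. *)
have delE z a b : lam b * z = lam a -> lam b * del z = d a - z * d b.
  move=> ba; rewrite /del; case: (sP z) => -[a' b'] /= [b'0 b'a'].
  have e : d (b * a' - a * b') = 0.
    by apply: d_ker; rewrite rmorphB !rmorphM -b'a' -ba; ring.
  move: e; rewrite dD (derivationN _ dd) !dM -b'a' -ba => e.
  apply: (mulfI b'0); rewrite mulrCA [lam b' * (_ / _)]mulrC divfK //.
  apply/eqP; rewrite -subr_eq0 -e; apply/eqP; ring.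
exists del; split; last first.
  move=> a; have := delE (lam a) a 1; rewrite rmorph1 !mul1r (derivation1 dd).
  by rewrite mulr0 subr0; apply.
split=> [z w|z w]; have [a [b [b0 ba]]] := frac z; have [c [e [e0 ec]]] := frac w;
  have be0 : lam (b * e) != 0 by rewrite rmorphM mulf_neq0.
- have E : lam (b * e) * (z + w) = lam (a * e + c * b).
    by rewrite rmorphD !rmorphM -ba -ec; ring.
  apply: (mulfI be0); rewrite (delE _ _ _ E) rmorphM.
  have -> : lam b * lam e * (del z + del w) = lam e * (lam b * del z) + lam b * (lam e * del w).
    by ring.
  by rewrite (delE _ _ _ ba) (delE _ _ _ ec) dD !dM -ba -ec; ring.
- have E : lam (b * e) * (z * w) = lam (a * c) by rewrite !rmorphM -ba -ec; ring.
  apply: (mulfI be0); rewrite (delE _ _ _ E) rmorphM mulrDr.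
  have -> : lam b * lam e * (z * del w) = lam b * z * (lam e * del w) by ring.
  have -> : lam b * lam e * (w * del z) = lam e * w * (lam b * del z) by ring.
  rewrite (delE _ _ _ ba) (delE _ _ _ ec) !dM -ba -ec; ring.
Qed.

End DerivationExt.

Section PolyDerivation.
Variables (L : fieldType) (D : L -> L).
Hypothesis dD : derivation id D.

(** This is D + q d/dt on L[t]: [D] acts on the coefficients, and t is sent to [q]. *)
Definition pder (q p : {poly L}) : {poly L} := map_poly D p + q * p^`().

Let D0 : D 0 = 0 := derivation0 dD.

Lemma map_poly_derivation : derivation id (map_poly D).
Proof.
split=> p r; apply/polyP => i.
  by rewrite coefD !coef_map_id0 // coefD (proj1 dD).
rewrite coefD !coefM coef_map_id0 // coefM (derivation_sum _ dD) -big_split.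
transitivity (\sum_(l < i.+1) (p`_l * D r`_(i - l) + r`_(i - l) * D p`_l)).
  by apply: eq_bigr => l _; rewrite (proj2 dD).
rewrite !big_split /=; congr (_ + _); first by apply: eq_bigr => l _; rewrite coef_map_id0.
rewrite [LHS](reindex_inj rev_ord_inj) /=; apply: eq_bigr => l _.
by rewrite coef_map_id0 // subSS subKn // -ltnS.
Qed.

Lemma pder_derivation q : derivation id (pder q).
Proof.
have [mD mM] := map_poly_derivation.
split=> p r; rewrite /pder; first by rewrite mD derivD mulrDr addrACA.
by rewrite mM derivM; ring.
Qed.

Lemma pderC q c : pder q c%:P = (D c)%:P.
Proof.
rewrite /pder derivC mulr0 addr0; apply/polyP => i.
by rewrite coef_map_id0 // !coefC; case: eqP.
Qed.

Lemma pderX q : pder q 'X = q.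
Proof.
rewrite /pder derivX mulr1 [X in X + _](_ : _ = 0) ?add0r //.
apply/polyP => i; rewrite coef_map_id0 // coefX coef0.
by case: (i == 1)%N; rewrite ?(derivation1 (phi := idfun) dD).
Qed.

(** Constants and the variable generate L[t]. This identifies one derivation in both charts, and its
    compatibility with evaluation at a point. *)
Lemma pder_unique (T : comPzRingType) (del : T -> T) (lam : {rmorphism {poly L} -> T}) q :
  derivation id del -> (forall c, del (lam c%:P) = lam (D c)%:P) ->
  del (lam 'X) = lam q -> forall p, del (lam p) = lam (pder q p).
Proof.
move=> [delD delM] delC delX; elim/poly_ind => [|p c IHp].
  by have := delC 0; rewrite polyC0 D0 polyC0 => ->; rewrite -polyC0 pderC D0.
have [pD pM] := pder_derivation q.
by rewrite rmorphD rmorphM delD delM pD pM pderX pderC delX delC IHp !(rmorphD, rmorphM).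
Qed.

End PolyDerivation.

(* z lies in the localization at M and specializes to c. *)
Section LocRel.
Variables (A : comPzRingType) (K T : fieldType).
Variables (M : A -> Prop) (lam : {rmorphism A -> K}) (e : {rmorphism A -> T}).

Definition loc_rel (z : K) (c : T) :=
  exists p q, [/\ M q, lam q * z = lam p & e q * c = e p].

Hypothesis M1 : M 1.
Hypothesis MM : forall p q, M p -> M q -> M (p * q).
Hypothesis Mlam : forall q, M q -> lam q != 0.
Hypothesis Me : forall q, M q -> e q != 0.

Lemma loc_rel_gen p : loc_rel (lam p) (e p).
Proof. by exists p, 1; rewrite !rmorph1 !mul1r. Qed.

Lemma loc_rel0 : loc_rel 0 0.
Proof. by rewrite -(rmorph0 lam) -(rmorph0 e); apply: loc_rel_gen. Qed.

Lemma loc_rel1 : loc_rel 1 1.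
Proof. by rewrite -(rmorph1 lam) -(rmorph1 e); apply: loc_rel_gen. Qed.

Lemma loc_relN z c : loc_rel z c -> loc_rel (- z) (- c).
Proof.
by move=> [p [q [Mq zq cq]]]; exists (- p), q; rewrite !rmorphN -zq -cq !mulrN.
Qed.

Lemma loc_relD z c z' c' : loc_rel z c -> loc_rel z' c' -> loc_rel (z + z') (c + c').
Proof.
move=> [p [q [Mq zq cq]]] [p' [q' [Mq' zq' cq']]].
exists (p * q' + p' * q), (q * q'); split; first exact: MM.
- by rewrite rmorphD !rmorphM -zq -zq'; ring.
- by rewrite rmorphD !rmorphM -cq -cq'; ring.
Qed.

Lemma loc_relM z c z' c' : loc_rel z c -> loc_rel z' c' -> loc_rel (z * z') (c * c').
Proof.
move=> [p [q [Mq zq cq]]] [p' [q' [Mq' zq' cq']]].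
exists (p * p'), (q * q'); split; first exact: MM.
- by rewrite !rmorphM -zq -zq'; ring.
- by rewrite !rmorphM -cq -cq'; ring.
Qed.

(** By the quotient rule the new denominator is a square, still in [M]; [del0] lifts both
    derivations to [A]. *)
Lemma loc_rel_der (del : K -> K) (d : T -> T) (del0 : A -> A) z c :
  derivation id del -> derivation id d ->
  (forall p, del (lam p) = lam (del0 p)) -> (forall p, d (e p) = e (del0 p)) ->
  loc_rel z c -> loc_rel (del z) (d c).
Proof.
move=> [_ delM] [_ dM] dellam de [p [q [Mq zq cq]]].
exists (q * del0 p - p * del0 q), (q * q); split; first exact: MM.
- rewrite rmorphB !rmorphM -!dellam -zq delM; ring.
- rewrite rmorphB !rmorphM -!de -cq dM; ring.
Qed.

Lemma loc_rel_cst a c : loc_rel (lam a) c -> (forall p, lam p = 0 -> p = 0) -> c = e a.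
Proof.
move=> [p [q [Mq zq cq]]] lam_inj; apply: (mulfI (Me Mq)); rewrite cq -rmorphM.
suff -> : p = q * a by [].
by apply/eqP; rewrite -subr_eq0; apply/eqP/lam_inj; rewrite rmorphB rmorphM zq subrr.
Qed.

End LocRel.

(** * Values of a form at points with values in a field *)

Section FormAt.
Variables (k : fieldType) (X : kscheme k) (i m : nat).

Lemma germ_self (y : X) (U : opens X) (s : pre_forms i m U) :
  U y -> germ y s (existT _ U s).
Proof. by move=> Uy; exists U, (fun y Uy => Uy), (fun y Uy => Uy). Qed.

Variables (sigma : X -> set {V : opens X & pre_forms i m V}) (L : fieldType).
Implicit Types (a b : morphism (spec_scheme L) X) (D : 'I_m -> 'I_i -> L -> L).

(* v is the value at the L-point a of the form sigma on the derivations D *)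
Definition form_at a D (v : L) :=
  exists (V : opens X) (Va : V (a tt)) (s : pre_forms i m V),
    (forall y, V y -> sigma y = germ y s) /\
    v = forms_ev (ev Va) (fun j l x => D j l (ev Va x)) s.

Lemma form_at_ex a D : H0_forms X i m sigma -> exists v, form_at a D v.
Proof.
by move=> /(_ (a tt)) [V [s [Va sE]]]; eexists; exists V, Va, s.
Qed.

Variable iota : k -> L.

Definition point_over a :=
  forall (V : opens X) (Va : V (a tt)) c, ev Va (scal V c) = iota c.

(** Two sections that represent [sigma] at the image point agree on some smaller [W]. Evaluation
    commutes with restriction to [W], since the derivations vanish on the constants from [k]. *)
Lemma form_at_unique a b D v v' : point_over a -> mor_eq a b ->
  (forall j l, derivation id (D j l)) -> (forall j l c, D j l (iota c) = 0) ->
  form_at a D v -> form_at b D v' -> v = v'.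
Proof.
move=> oa ab dD Dk [V [Va [s [sE ->]]]] [V' [Vb [s' [s'E ->]]]].
have V'a : V' (a tt) by rewrite (proj1 ab).
have : germ (a tt) s (existT _ V' s').
  by rewrite -sE // (s'E (a tt)) //; apply: germ_self.
move=> [W [h [h' [Wa e]]]].
have Wb : W (b tt) by rewrite -(proj1 ab).
have evE (U : opens X) (Ua : U (a tt)) (g : W `<=` U) (t : pre_forms i m U) :
    forms_ev (ev Ua) (fun j l x => D j l (ev Ua x)) t =
    forms_ev (ev Wa) (fun j l x => D j l (ev Wa x)) (pre_forms_res g t).
  rewrite /pre_forms_res forms_ev_map; last 2 first.
  - by move=> j l; apply: (derivation_comp (ev Wa) (dD j l)).
  - by move=> j l c /=; rewrite oa Dk.
  have E : (ev Wa \o res g : sec U -> L) = ev Ua by apply/funext => x /=; apply: ev_res.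
  rewrite -[RHS]/(forms_ev (ev Wa \o res g) (fun j l x => D j l ((ev Wa \o res g) x)) t).
  by rewrite E.
rewrite (evE V Va h) e -(evE V' V'a h').
have E : (ev V'a : sec V' -> L) = ev Vb by apply/funext => x; apply: ev_eq.
by rewrite E.
Qed.

End FormAt.

(** * Charts of the projective line *)

Definition krestr (k L : fieldType) (iota : {rmorphism k -> L}) (Y Z : kscheme L)
    (f : kmorphism Y Z) : kmorphism (restr iota Y) (restr iota Z) :=
  @KMorphism k (restr iota Y) (restr iota Z) f (fun V c => kmor_scal f V (iota c)).

Section KComp.
Variables (k : fieldType) (X Y Z : kscheme k) (g : kmorphism Y Z) (f : kmorphism X Y).

Lemma kcomp_scal (V : opens Z) (c : k) :
  pull (mcomp g f) V (scal V c) = scal (mpreim (mcomp g f) V) c.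
Proof. by rewrite /= !kmor_scal /scal /= res2; apply: resP. Qed.

Definition kcomp : kmorphism X Z := KMorphism kcomp_scal.

End KComp.

Lemma poly_irreducible_factor (L : fieldType) (p : {poly L}) :
  (1 < size p)%N -> exists r : {poly L}, irreducible_poly r /\ r %| p.
Proof.
have [n] := ubnP (size p); elim: n p => // n IHn p /ltnSE pn p1.
have [irr|red] := pselect (irreducible_poly p); first by exists p.
have [q [q1 qp nqp]] : exists q : {poly L}, [/\ size q != 1%N, q %| p & ~~ (q %= p)].
  apply: contrapT => nq; apply: red; split=> // q q1 qp.
  by apply: contrapT => /negP nqp; apply: nq; exists q.
have p0 : p != 0 by rewrite -size_poly_gt0 (ltn_trans _ p1).
have q0 : q != 0 by apply: contraTneq qp => ->; rewrite dvd0p.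
have qltp : (size q < size p)%N.
  by rewrite ltn_neqAle dvdp_leq // andbT; apply: contra nqp; rewrite dvdp_size_eqp.
have [||r [irr rq]] := IHn q; first exact: leq_trans qltp pn.
  by rewrite ltn_neqAle eq_sym q1 size_poly_gt0.
by exists r; split=> //; apply: dvdp_trans qp.
Qed.

Section CoprimeFraction.
Variables (L K : fieldType) (lam : {rmorphism {poly L} -> K}).
Hypothesis lam_inj : forall p, lam p = 0 -> p = 0.

Lemma coprime_fraction (z : K) a b : lam b != 0 -> lam b * z = lam a ->
  exists a' b', [/\ coprimep a' b', b' != 0 & lam b' * z = lam a'].
Proof.
move=> lb0 e; have b0 : b != 0 by apply: contraNneq lb0 => ->; rewrite rmorph0.
have g0 : gcdp a b != 0 by rewrite gcdp_eq0 negb_and b0 orbT.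
have aE := divpK (dvdp_gcdl a b); have bE := divpK (dvdp_gcdr a b).
exists (a %/ gcdp a b), (b %/ gcdp a b); split.
- by apply: coprimep_div_gcd; rewrite b0 orbT.
- by apply: contraNneq b0 => b'0; rewrite -bE b'0 mul0r.
- have lg0 : lam (gcdp a b) != 0 by apply: contra g0 => /eqP/lam_inj/eqP.
  by apply: (mulfI lg0); rewrite mulrA -!rmorphM mulrC -![_ * (_ %/ _)]mulrC aE bE mulrC.
Qed.

End CoprimeFraction.

Section Chart.
Variables (L : fieldType) (P W : kscheme L) (j : kmorphism W P) (w : W).
Hypotheses (oj : open_immersion j) (gen_w : generic w) (gen_jw : generic (j w)).
Variables (U : opens P) (phi : {rmorphism {poly L} -> sec U}).
Hypotheses (aU : affine U) (bphi : bijective phi) (phiC : forall c, phi c%:P = scal U c).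
Hypothesis Ujw : U (j w).

Notation K := (ff gen_w).
Notation g := (gpt gen_w).

Definition chart_ev (T : fieldType) (c : morphism (spec_scheme T) W)
    (Uc : U (mcomp j c tt)) : {rmorphism {poly L} -> T} := ev Uc \o phi.

(** The value map at the generic point of [W]: it embeds L[t] in the function field. *)
Definition chart_lam : {rmorphism {poly L} -> K} := chart_ev (Ujw : U (mcomp j g tt)).

Lemma phi_neq0 p : p <> 0 -> phi p <> 0.
Proof.
case: bphi => psi phiK _ p0 /(congr1 psi).
by rewrite -(rmorph0 phi) !phiK.
Qed.

Lemma chart_lam_inj p : chart_lam p = 0 -> p = 0.
Proof.
move=> lp0; apply: contrapT => /phi_neq0 /(proj2 gen_jw) bas.
have : chart_lam p != 0 by apply/ev_basic.
by rewrite lp0 eqxx.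
Qed.

(** As [j] is an open immersion, a section of [W] comes from the line, where it is a fraction of
    functions on the affine chart, i.e. of polynomials. *)
Lemma chart_section (Q : opens W) (f : sec Q) y : Q y -> U (j y) ->
  exists p q, basic (phi q) (j y) /\
  exists (N : opens W) (hQ : N `<=` Q) (hU : N `<=` mpreim j U),
    N y /\ res hU (pull j U (phi q)) * res hQ f = res hU (pull j U (phi p)).
Proof.
move=> Qy Uy; have [V [t [h [QV te]]]] := open_immersion_sec f oj.
have [a [b [N [hU [hV [Ny by_ e]]]]]] := affine_frac t aU Uy (QV _ Qy).
case: bphi => psi _ psiK; exists (psi a), (psi b); rewrite !psiK; split=> //.
have hU' : mpreim j N `<=` mpreim j U by move=> z /hU.
have hV' : mpreim j N `<=` mpreim j V by move=> z /hV.
exists (mpreim j N), (subset_trans hV' h), hU'; split=> //.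
by rewrite -res2 -te (pull_res hU) (pull_res hV) -rmorphM e -(pull_res hU hU').
Qed.

(** The denominators allowed at [x]: inverting them yields the local ring of the line at [x]. *)
Definition chart_den (x : P) (q : {poly L}) := basic (phi q) x.

Lemma chart_den1 x : U x -> chart_den x 1.
Proof. by move=> Ux; rewrite /chart_den rmorph1; apply: basic1. Qed.

Lemma chart_denM x p q : chart_den x p -> chart_den x q -> chart_den x (p * q).
Proof. by rewrite /chart_den rmorphM; apply: basicM. Qed.

Lemma chart_den_lam x q : chart_den x q -> chart_lam q != 0.
Proof. by move=> /basic_neq0 q0; apply/ev_basic; apply: (proj2 gen_jw). Qed.

(** A single fraction p/q, valid near the image of [c], computes the value at [c] and also at the
    generic point, which lies in that neighbourhood. *)
Lemma chart_ev_rel (T : fieldType) (c : morphism (spec_scheme T) W)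
    (Uc : U (mcomp j c tt)) (Q : opens W) (Qc : Q (c tt)) (Qw : Q (g tt)) (f : sec Q) :
  loc_rel (chart_den (mcomp j c tt)) chart_lam (chart_ev Uc) (ev Qw f) (ev Qc f).
Proof.
have [p [q [bq [N [hQ [hU [Nc e]]]]]]] := chart_section f Qc Uc.
have Nw : N (g tt) by apply: (proj1 gen_w); exists (c tt).
have evE (T' : fieldType) (d : morphism (spec_scheme T') W) (Ud : U (mcomp j d tt))
    (Qd : Q (d tt)) : N (d tt) -> chart_ev Ud q * ev Qd f = chart_ev Ud p.
  move=> Nd; rewrite -(ev_res Qd Nd hQ) /chart_ev /=.
  rewrite !(ev_mcomp (Ud : U (mcomp j d tt)) (Ud : mpreim j U (d tt))).
  by rewrite -!(ev_res (Ud : mpreim j U (d tt)) Nd hU) -e rmorphM.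
exists p, q; split=> //; exact: evE.
Qed.

Lemma chart_frac (z : K) : exists a b, chart_lam b != 0 /\ chart_lam b * z = chart_lam a.
Proof.
elim/stalkW: z => V Vw s.
have [p [q [bq zq _]]] := chart_ev_rel (Ujw : U (mcomp j g tt)) Vw (Vw : V (g tt)) s.
exists p, q; split; first exact: chart_den_lam bq.
by rewrite -zq ev_mkpt.
Qed.

Lemma chart_coprime_frac (z : K) :
  exists a b, [/\ coprimep a b, b != 0 & chart_lam b * z = chart_lam a].
Proof.
by have [a [b [b0 e]]] := chart_frac z; apply: (coprime_fraction chart_lam_inj b0 e).
Qed.

(** With [chart_lam] on both sides, [loc_rel] says that [z] lies in the local ring at [x]. In lowest
    terms, an irreducible factor of a nonconstant denominator would define a point of the chart
    where [z] has a pole. *)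
Lemma chart_regular (z : K) :
  (forall x, U x -> loc_rel (chart_den x) chart_lam chart_lam z z) ->
  exists p, z = chart_lam p.
Proof.
move=> zreg; have [a [b [ab b0 e]]] := chart_coprime_frac z.
have [b1|b1] := leqP (size b) 1.
  have bC := size1_polyC b1; have b00 : b`_0 != 0.
    by apply: contraNneq b0 => b00; rewrite bC b00.
  exists ((b`_0)^-1 *: a); rewrite -mul_polyC rmorphM -e mulrA -rmorphM.
  by rewrite {2}bC -polyCM mulVf // rmorph1 mul1r.
have [r [irr rb]] := poly_irreducible_factor b1.
have rprime p q : r %| p * q -> r %| p \/ r %| q.
  move=> rpq; have [rp|rp] := boolP (r %| p); [by left | right].
  by move: rpq; rewrite Gauss_dvdpr // irreducible_poly_coprime.
case: (bphi) => psi phiK psiK.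
have [primes _ _ _] := aU.
have [|x [[Ux xE] _]] := primes [set f | r %| psi f].
  have psiD f f' : psi (f + f') = psi f + psi f'.
    by apply: (can_inj phiK); rewrite rmorphD !psiK.
  have psiM f f' : psi (f * f') = psi f * psi f'.
    by apply: (can_inj phiK); rewrite rmorphM !psiK.
  split=> /=.
  - by move=> f f' rf rf'; rewrite psiD dvdp_add.
  - by move=> f f' rf'; rewrite psiM dvdp_mull.
  - by rewrite -(rmorph0 phi) phiK dvdp0.
  - rewrite -(rmorph1 phi) phiK => r1.
    by move: (irr.1); rewrite (eqP (_ : size r == 1%N)) // -dvdp1.
  - by move=> f f'; rewrite psiM; apply: rprime.
have denE q : chart_den x q <-> ~ r %| q.
  have := congr1 (fun A : set (sec U) => A (phi q)) xE; rewrite /= phiK => ->.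
  by split=> [bq /(_ bq)|/contrapT].
have [p [q [/denE rq zq _]]] := zreg x Ux.
have : q * a = b * p.
  apply/eqP; rewrite -subr_eq0; apply/eqP/chart_lam_inj.
  by rewrite rmorphB !rmorphM -zq -e; apply/eqP; rewrite subr_eq0 mulrCA.
move=> qa; have /rprime [//|ra] : r %| q * a by rewrite qa dvdp_mulr.
have r1 : r %| gcdp a b by rewrite dvdp_gcd ra rb.
move: r1; rewrite (eqp_dvdr _ (_ : gcdp a b %= 1)) ?gcdp_eqp1 // dvdp1 => /eqP r1.
by move: (irr.1); rewrite r1.
Qed.

End Chart.

(** * Properness *)

Lemma mor_eq_pull (X Y Z : scheme) (u : morphism X Y) (p : morphism Y Z) (h : morphism X Z)
  (V : opens Z) (s : sec V) (N : opens X) (H1 : N `<=` mpreim u (mpreim p V))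
  (H2 : N `<=` mpreim h V) :
  mor_eq (mcomp p u) h -> res H1 (pull u _ (pull p V s)) = res H2 (pull h V s).
Proof.
move=> [_ e]; have H3 : N `<=` mpreim (mcomp p u) V by move=> y /H1.
by rewrite -(e V s N H3 H2) /= res2; apply: resP.
Qed.

(* The closure of the image of Y in X x T surjects onto T, and x' is the image in
   X of a point of this closure above x. *)
Lemma proper_specialization (k : fieldType) (X T Y : kscheme k) (h : kmorphism Y X)
  (j : kmorphism Y T) (y : Y) : universally_closed X ->
  (forall B : opens T, B !=set0 -> B (j y)) -> (forall B : opens Y, B !=set0 -> B y) ->
  forall x : T, exists x' : X, forall V : opens X, V x' -> V (h y) /\
  forall (f : sec V) (U : opens T) (a b : sec U), U x ->
    res (@oIl _ (mpreim h V) (mpreim j U)) (pull h V f) *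
      res (@oIr _ (mpreim h V) (mpreim j U)) (pull j U b) =
    res (@oIr _ (mpreim h V) (mpreim j U)) (pull j U a) ->
    basic a x -> basic b x.
Proof.
move=> univ genT genY x; have [Q [p [q [fib clos]]]] := univ T.
have [[u [pu qu]] _] := fib _ h j.
pose Z := closure (range u).
have [z Zz qz] : (q @` Z) x.
  apply: contrapT => nx.
  have op : open (~` (q @` Z)) by apply/closed_openC/clos/closed_closure.
  have [//|] := genT (Opens op) _; first by exists x.
  by exists (u y); [apply: subset_closure; exists y | apply: (proj1 qu)].
have meet (B : opens Q) : B z -> exists w, B (u w).
  move=> Bz; have [_ [[w _ <-] Bw]] := Zz _ (open_nbhs_nbhs (conj (oset_open B) Bz)).
  by exists w.
exists (p z) => V Vpz; split.
  have [w Vw] := meet (mpreim p V) Vpz.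
  by apply: (genY (mpreim h V)); exists w; rewrite /mpreim /= -(proj1 pu).
move=> f U a b Ux e ax.
pose N := oI (mpreim p V) (mpreim q U).
have Nz : N z by split=> //; rewrite /mpreim /= qz.
have [l r] := (@oIl _ (mpreim p V) (mpreim q U), @oIr _ (mpreim p V) (mpreim q U)).
(* The equation f b = a turns [F] into 0 on the pull-back along [u]. Every neighbourhood of [z]
   meets the range of [u], so [F] cannot be invertible at [z]. *)
pose F : sec N := res l (pull p V f) * res r (pull q U b) - res r (pull q U a).
have Fz : ~ basic F z.
  move=> /(meet (basic F)) [w Fw].
  pose M := oI (mpreim h V) (mpreim j U).
  have hM : M `<=` mpreim u N.
    move=> v [Vv Uv]; split; first by rewrite /mpreim /= -[p _]/(mcomp p u v) (proj1 pu).
    by rewrite /mpreim /= -[q _]/(mcomp q u v) (proj1 qu).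
  have [Vw Uw] : N (u w) by apply: basic_mem Fw.
  have Mw : M w.
    by split; rewrite /mpreim /=; [rewrite -(proj1 pu) | rewrite -(proj1 qu)].
  apply: (basic_neq0 (basic_res_in hM Mw (basic_pull Fw))).
  have l' : mpreim u N `<=` mpreim u (mpreim p V) by move=> v [].
  have r' : mpreim u N `<=` mpreim u (mpreim q U) by move=> v [].
  rewrite /F !(rmorphB, rmorphM) -(pull_res l l') -!(pull_res r r') !res2.
  rewrite (mor_eq_pull _ _ (@oIl _ _ _) pu) !(mor_eq_pull _ _ (@oIr _ _ _) qu).
  by rewrite e subrr.
have qaz : basic (res r (pull q U a)) z.
  by apply: basic_res_in => //; apply: basic_pull; rewrite qz.
(* Since [a] is invertible at [z] and [F] is not, locality of the stalk makes f b invertible at [z],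
   hence [b] too. *)
rewrite -qz; apply: (@pull_local _ _ q); apply: (@basic_res _ _ _ r).
have : basic (F - res l (pull p V f) * res r (pull q U b)) z.
  by rewrite /F addrC addKr; apply: (@basicN _ N); rewrite opprK.
by move=> /stalk_local [/Fz //|/basicN /basicMr].
Qed.

(** * Forms restricted to a chart of the line *)

Section ChartForm.
Variables (k L : fieldType) (iota : {rmorphism k -> L}) (X : kscheme k) (P W : kscheme L).
Variables (j : kmorphism W P) (h : kmorphism (restr iota W) X) (w : W).
Hypotheses (oj : open_immersion j) (gen_w : generic w) (gen_jw : generic (j w)).

Notation K := (ff gen_w).
Notation g := (gpt gen_w).

Definition cst_ev (T : fieldType) (c : morphism (spec_scheme T) W) : {rmorphism L -> T} :=
  ev (I : oT W (c tt)) \o str W.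

Lemma ev_scal (T : fieldType) (c : morphism (spec_scheme T) W) (V : opens W) (Vc : V (c tt)) x :
  ev Vc (scal V x) = cst_ev c x.
Proof. exact: ev_res. Qed.

Lemma cst_ev_rat (c : kmorphism (spec L) W) x : cst_ev c x = x.
Proof.
have -> : cst_ev c x = ev (I : oT W (c tt)) (scal (oT W) x) by rewrite ev_scal.
by rewrite /ev (kmor_scal c (oT W) x).
Qed.

Lemma over_comp (T : fieldType) (c : morphism (spec_scheme T) W) :
  point_over (cst_ev c \o iota) (mcomp h c : morphism (spec_scheme T) X).
Proof.
move=> V Vc x; rewrite (ev_mcomp Vc (Vc : mpreim h V (c tt))) kmor_scal.
exact: ev_res.
Qed.

Variables (U : opens P) (phi : {rmorphism {poly L} -> sec U}).
Hypotheses (aU : affine U) (bphi : bijective phi) (phiC : forall c, phi c%:P = scal U c).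
Hypothesis Ujw : U (j w).

Notation lam := (chart_lam gen_w phi Ujw).

Lemma chart_evC (T : fieldType) (c : morphism (spec_scheme T) W) (Uc : U (mcomp j c tt)) x :
  chart_ev phi Uc x%:P = cst_ev c x.
Proof.
rewrite /chart_ev /= phiC (ev_mcomp Uc (Uc : mpreim j U (c tt))) kmor_scal.
exact: ev_scal.
Qed.

Variables (i m : nat) (sigma : X -> set {V : opens X & pre_forms i m V}).
Hypothesis sigmaH : H0_forms X i m sigma.
Variables (D : 'I_m -> 'I_i -> L -> L) (r : 'I_m -> 'I_i -> {poly L}).
Hypotheses (dD : forall a b, derivation id (D a b)).
Hypothesis Dk : forall a b c, D a b (iota c) = 0.
Variable del : 'I_m -> 'I_i -> K -> K.
Hypothesis ddel : forall a b, derivation id (del a b).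
Hypothesis delE : forall a b p, del a b (lam p) = lam (pder (D a b) (r a b) p).

Lemma del_cst a b x : del a b (cst_ev g (iota x)) = 0.
Proof.
rewrite -(chart_evC (Ujw : U (mcomp j g tt))) [del _ _ _]delE.
by rewrite pderC // Dk rmorph0.
Qed.

(** The hypothesis on the value of ['X] at [c] says that evaluation at [c] intertwines the
    derivations of L[t] with the [D a b]; hence the value at the generic point specializes to the
    value at [c]. *)
Lemma chart_form_value (c : kmorphism (spec L) W) (Uc : U (mcomp j c tt)) z v :
  (forall a b, D a b (chart_ev phi Uc 'X) = (r a b).[chart_ev phi Uc 'X]) ->
  form_at sigma (mcomp h g) del z -> form_at sigma (mcomp h c) D v ->
  loc_rel (chart_den phi (mcomp j c tt)) lam (chart_ev phi Uc) z v.
Proof.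
move=> DX fz [V [Vc [s [sE ->]]]].
have eC x : chart_ev phi Uc x%:P = x by rewrite chart_evC cst_ev_rat.
have eE p : chart_ev phi Uc p = p.[chart_ev phi Uc 'X].
  elim/poly_ind: p => [|p x IHp]; first by rewrite rmorph0 horner0.
  by rewrite rmorphD rmorphM eC {1}IHp hornerMXaddC.
(* The neighbourhood chosen at [c] contains the generic point, so the same section [s] computes both
   values. *)
have Vw : V (mcomp h g tt) by apply: (proj1 gen_w (mpreim h V)); exists (c tt).
have fz' : form_at sigma (mcomp h g) del
    (forms_ev (ev Vw) (fun a b x => del a b (ev Vw x)) s) by exists V, Vw, s.
have self : mor_eq (mcomp h g) (mcomp h g) by split=> // *; apply: resP.
rewrite (form_at_unique (over_comp (c := g)) self ddel del_cst fz fz').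
have M1 := chart_den1 phi Uc.
have MM := @chart_denM _ _ U phi (mcomp j c tt).
have rel f : loc_rel (chart_den phi (mcomp j c tt)) lam (chart_ev phi Uc) (ev Vw f) (ev Vc f).
  rewrite (ev_mcomp Vw (Vw : mpreim h V (g tt))) (ev_mcomp Vc (Vc : mpreim h V (c tt))).
  exact: chart_ev_rel.
apply: forms_ev_ind2 => //.
- exact: loc_rel0.
- exact: loc_rel1.
- exact: loc_relN.
- by move=> *; apply: loc_relD.
- by move=> *; apply: loc_relM.
- move=> a b f; apply: (loc_rel_der MM (ddel a b) (dD a b) (delE a b)) => //.
  apply: pder_unique => // [x|]; first by rewrite !eC.
  by rewrite DX -eE.
Qed.

(** The point [x] may lie outside the image of [j]. The section of the form near the specialization
    [x'] still computes [z]; functions near [x'] have no pole at [x], and [del] preserves the local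
    ring. *)
Lemma chart_form_regular z : universally_closed X ->
  form_at sigma (mcomp h g) del z ->
  forall x, U x -> loc_rel (chart_den phi x) lam lam z z.
Proof.
move=> univ fz x Ux.
have [x' x'P] := @proper_specialization _ _ _ _ h (krestr iota j) w univ
  (proj1 gen_jw) (proj1 gen_w) x.
have [V [s [Vx' sE]]] := sigmaH x'.
have [Vw valP] := x'P V Vx'.
have fz' : form_at sigma (mcomp h g) del
    (forms_ev (ev (Vw : V (mcomp h g tt))) (fun a b y => del a b (ev (Vw : V (mcomp h g tt)) y)) s).
  by exists V, Vw, s.
have self : mor_eq (mcomp h g) (mcomp h g) by split=> // *; apply: resP.
rewrite (form_at_unique (over_comp (c := g)) self ddel del_cst fz fz').
have M1 := chart_den1 phi Ux.
have MM := @chart_denM _ _ U phi x.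
have rel f : loc_rel (chart_den phi x) lam lam (ev (Vw : V (mcomp h g tt)) f)
    (ev (Vw : V (mcomp h g tt)) f).
  have [a [b [ab b0 e]]] := chart_coprime_frac oj gen_jw aU bphi Ujw
    (ev (Vw : V (mcomp h g tt)) f).
  suff bx : basic (phi b) x by exists a, b.
  have e' : res (@oIl _ (mpreim h V) (mpreim j U)) (pull h V f) *
      res (@oIr _ (mpreim h V) (mpreim j U)) (pull j U (phi b)) =
    res (@oIr _ (mpreim h V) (mpreim j U)) (pull j U (phi a)).
    have Nw : oI (mpreim h V) (mpreim j U) (g tt) by [].
    apply/eqP; rewrite -subr_eq0; apply/eqP/(ev_gpt_eq0 (Ux := Nw)).
    transitivity (ev (Vw : V (mcomp h g tt)) f * lam b - lam a); last first.
      by rewrite mulrC e subrr.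
    rewrite rmorphB rmorphM; congr (_ * _ - _).
    - apply: etrans (ev_res (Vw : mpreim h V (g tt)) Nw _ _) (esym _).
      exact: ev_mcomp.
    - apply: etrans (ev_res (Ujw : mpreim j U (g tt)) Nw _ _) (esym _).
      exact: ev_mcomp.
    - apply: etrans (ev_res (Ujw : mpreim j U (g tt)) Nw _ _) (esym _).
      exact: ev_mcomp.
  (* If [b] were not invertible at [x], neither would [a] be, against the Bezout relation for
     coprime [a] and [b]. *)
  have val := valP f U (phi a) (phi b) Ux e'.
  apply: contrapT => nbx; have nax : ~ basic (phi a) x by move=> /val.
  have /Bezout_eq1_coprimepP [[u v] /= uv] := ab.
  have : basic (phi (u * a + v * b)) x by rewrite uv rmorph1; apply: basic1.
  rewrite rmorphD !rmorphM => /stalk_local [/basicMr|/basicMr]; [exact: nax | exact: nbx].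
apply: forms_ev_ind2 => //.
- exact: loc_rel0.
- exact: loc_rel1.
- exact: loc_relN.
- by move=> *; apply: loc_relD.
- by move=> *; apply: loc_relM.
- by move=> a b f; apply: (loc_rel_der MM (ddel a b) (ddel a b) (delE a b)).
Qed.

End ChartForm.

(** * Invariance under R-equivalence *)

(** The line through the two prescribed values, or a constant when the two abscissas coincide. *)
Lemma affine_interpolation (L : fieldType) (D : L -> L) (x y : L) :
  exists q0 q1, q0 + q1 * x = D x /\ q0 + q1 * y = D y.
Proof.
have [->|xy] := eqVneq x y; first by exists (D y), 0; rewrite mul0r addr0.
have d0 : x - y != 0 by rewrite subr_eq0.
exists (D x - (D x - D y) / (x - y) * x), ((D x - D y) / (x - y)).
split; first by rewrite subrK.
rewrite -addrA -mulrN addrC -mulrDr.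
have -> : - x + y = - (x - y) by rewrite opprB addrC.
by rewrite mulrN divfK // opprB subrK.
Qed.

(** L[t] and L[1/t] meet in L: if multiplication by t^n clears the negative powers and leaves degree
    at most n, comparing degrees makes [p0] constant. *)
Lemma poly_in_var_and_inv_const (L K : fieldType)
  (lam0 lam1 : {rmorphism {poly L} -> K}) p0 p1 :
  (forall p, lam0 p = 0 -> p = 0) -> (forall c, lam1 c%:P = lam0 c%:P) ->
  lam0 'X * lam1 'X = 1 -> lam0 p0 = lam1 p1 -> exists c, p0 = c%:P.
Proof.
move=> inj lamC X01 e.
have [n [r [sr re]]] : exists n (r : {poly L}),
    (size r <= n.+1)%N /\ lam0 'X ^+ n * lam1 p1 = lam0 r.
  elim/poly_ind: p1 {e} => [|p c [n [r [sr re]]]].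
    by exists 0%N, 0; rewrite size_poly0 !rmorph0 mulr0.
  exists n.+1, (r + c%:P * 'X^(n.+1)); split.
    rewrite (leq_trans (size_polyD _ _)) // geq_max (leq_trans sr) //=.
    by rewrite (leq_trans (size_polyMleq _ _)) // size_polyXn size_polyC addnS; case: eqP.
  rewrite rmorphD rmorphM lamC [in RHS]rmorphD rmorphM rmorphXn -re exprS.
  rewrite mulrDr [_ * (_ * lam1 'X)]mulrA -[_ * lam1 p * _]mulrA.
  congr (_ + _); last by rewrite mulrC.
  transitivity (lam0 'X ^+ n * lam1 p * (lam0 'X * lam1 'X)); first by ring.
  by rewrite X01 mulr1.
have [->|p00] := eqVneq p0 0; first by exists 0.
exists p0`_0; apply: size1_polyC.
have : 'X^n * p0 = r.
  by apply/eqP; rewrite -subr_eq0; apply/eqP/inj; rewrite rmorphB rmorphM rmorphXn e re subrr.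
move=> rE; move: sr; rewrite -rE size_monicM ?monicXn // size_polyXn addSn /=.
by rewrite -addn1 leq_add2l.
Qed.

Section Link.
Variables (k L : fieldType) (iota : {rmorphism k -> L}) (X : kscheme k) (P W : kscheme L).
Variables (j : kmorphism W P) (h : kmorphism (restr iota W) X).
Hypotheses (lineP : projective_line P) (oj : open_immersion j) (univ : universally_closed X).
Variables (i m : nat) (sigma : X -> set {V : opens X & pre_forms i m V}).
Hypothesis sigmaH : H0_forms X i m sigma.
Variable (D : 'I_m -> 'I_i -> L -> L).
Hypothesis dD : forall a b, derivation id (D a b).
Hypothesis Dk : forall a b c, D a b (iota c) = 0.

Lemma form_at_rational_curve (a b : kmorphism (spec L) W) va vb :
  form_at sigma (mcomp h a) D va -> form_at sigma (mcomp h b) D vb -> va = vb.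
Proof.
move=> fa fb; have [y gen_y] := projective_line_generic lineP.
have [|w [jw gen_w]] := open_immersion_generic oj _ gen_y; first by exists (a tt).
have gen_jw : generic (j w) by rewrite jw.
pose g := gpt gen_w.
have [U0 [U1 [phi0 [phi1 [[aU0 aU1] [b0 b1] [phi0C phi1C] cov [_ U011 inv]]]]]] := lineP.
(* An empty chart would have the zero ring as its sections. *)
have U1w : U1 (j w).
  apply: (proj1 gen_jw).
  apply: contrapT => U1e; have := @phi_neq0 _ _ _ _ b1 1.
  by apply; [apply/eqP/oner_neq0 | apply: sec_empty].
have U0w : U0 (j w).
  apply: (proj1 gen_jw).
  apply: contrapT => U0e; have := @phi_neq0 _ _ _ _ b0 1.
  by apply; [apply/eqP/oner_neq0 | apply: sec_empty].
pose lam0 := chart_lam gen_w phi0 U0w; pose lam1 := chart_lam gen_w phi1 U1w.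
have evX (T : fieldType) (c : morphism (spec_scheme T) W)
    (c0 : U0 (mcomp j c tt)) (c1 : U1 (mcomp j c tt)) :
    chart_ev phi0 c0 'X * chart_ev phi1 c1 'X = 1.
  have c01 : oI U0 U1 (mcomp j c tt) by [].
  rewrite -[RHS](rmorph1 (ev c01)) -(inv _ (@oIl _ U0 U1) (@oIr _ U0 U1)) rmorphM.
  by congr (_ * _); apply/esym/ev_res.
have lamX : lam0 'X * lam1 'X = 1 by apply: (evX _ g).
(* The coordinate of [c], with default 0 when [c] is at infinity; there compatibility is automatic,
   whatever the default. *)
have val (c : kmorphism (spec L) W) : exists x, forall c0 : U0 (mcomp j c tt),
    chart_ev phi0 c0 'X = x.
  have [c0|nc0] := pselect (U0 (mcomp j c tt)); last by exists 0.
  exists (chart_ev phi0 c0 'X) => c0'; by rewrite (Prop_irrelevance c0' c0).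
have [xa xaP] := val a; have [xb xbP] := val b.
have qP u v : {q : L * L | q.1 + q.2 * xa = D u v xa /\ q.1 + q.2 * xb = D u v xb}.
  by apply: cid; have [q0 [q1 e]] := affine_interpolation (D u v) xa xb; exists (q0, q1).
pose q0 u v := (sval (qP u v)).1; pose q1 u v := (sval (qP u v)).2.
pose r0 u v : {poly L} := (q0 u v)%:P + (q1 u v)%:P * 'X.
(* The image of s = 1/t: -s^2 (q0 + q1 / s), a polynomial in s thanks to the degree bound. *)
pose r1 u v : {poly L} := - ((q0 u v)%:P * 'X + (q1 u v)%:P) * 'X.
have delP u v : {del : ff gen_w -> ff gen_w |
    derivation id del /\ forall p, del (lam0 p) = lam0 (pder (D u v) (r0 u v) p)}.
  apply: cid; apply: (derivation_ext (d := fun p => lam0 (pder (D u v) (r0 u v) p))).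
  - have [pD pM] := pder_derivation (dD u v) (r0 u v).
    by split=> p q; rewrite ?pD ?pM rmorphD ?rmorphM.
  - move=> p /(chart_lam_inj gen_jw b0) ->.
    by rewrite (derivation0 (pder_derivation (dD u v) _)) rmorph0.
  - exact: chart_frac.
pose del u v := sval (delP u v).
have ddel u v : derivation id (del u v) by rewrite /del; case: (delP u v) => d [].
have del0 u v p : del u v (lam0 p) = lam0 (pder (D u v) (r0 u v) p).
  by rewrite /del; case: (delP u v) => d [].
have lam0C c : lam0 c%:P = cst_ev g c by apply: chart_evC.
have lam1C c : lam1 c%:P = cst_ev g c by apply: chart_evC.
have der_inv (T : comPzRingType) (d : T -> T) (x y' : T) : derivation id d ->
    x * y' = 1 -> d y' = - (y' * y' * d x).
  move=> dd xy; have := proj2 dd x y'; rewrite xy (derivation1 (phi := idfun) dd) => e.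
  have -> : d y' = y' * (x * d y' + y' * d x) - y' * y' * d x.
    by rewrite mulrDr mulrA [y' * x]mulrC xy mul1r mulrA addrK.
  by rewrite -e mulr0 sub0r.
(* The derivation defined on the first chart, read in the coordinate of the second. *)
have del1 u v p : del u v (lam1 p) = lam1 (pder (D u v) (r1 u v) p).
  apply: pder_unique => // [c|].
    by rewrite !lam1C -lam0C del0 pderC // lam0C.
  rewrite (der_inv _ _ _ _ (ddel u v) lamX) del0 pderX // /r0 /r1.
  rewrite !(rmorphD, rmorphM, rmorphN) !lam0C !lam1C.
  have -> : lam1 'X * lam1 'X * (cst_ev g (q0 u v) + cst_ev g (q1 u v) * lam0 'X) =
    (cst_ev g (q0 u v) * lam1 'X + cst_ev g (q1 u v) * (lam0 'X * lam1 'X)) * lam1 'X by ring.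
  by rewrite lamX mulr1 mulNr.
have [z fz] := form_at_ex (mcomp h g) del sigmaH.
have reg0 := chart_form_regular oj gen_jw aU0 b0 phi0C sigmaH dD Dk ddel del0 univ fz.
have reg1 := chart_form_regular oj gen_jw aU1 b1 phi1C sigmaH dD Dk ddel del1 univ fz.
have [p0 zp0] := chart_regular oj gen_jw aU0 b0 reg0.
have [p1 zp1] := chart_regular oj gen_jw aU1 b1 reg1.
have [c cE] : exists c, p0 = c%:P.
  apply: (@poly_in_var_and_inv_const _ _ lam0 lam1 p0 p1) => //.
  - exact: chart_lam_inj.
  - by move=> c; rewrite lam0C lam1C.
  - exact: etrans (esym zp0) zp1.
have zc0 : z = lam0 c%:P by rewrite zp0 cE.
have zc1 : z = lam1 c%:P by rewrite zc0 lam0C lam1C.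
(* One argument for both ends: it only uses that the interpolation holds at the coordinate of the
   end considered. *)
suff H (d : kmorphism (spec L) W) x v : (forall d0 : U0 (mcomp j d tt), chart_ev phi0 d0 'X = x) ->
    (forall u v, q0 u v + q1 u v * x = D u v x) -> form_at sigma (mcomp h d) D v -> v = c.
  rewrite (H a xa va) //; last by move=> u v; rewrite /q0 /q1; case: (qP u v) => q [].
  by rewrite (H b xb vb) //; move=> u v; rewrite /q0 /q1; case: (qP u v) => q [].
move=> dx qx fd.
have : [set: P] (mcomp j d tt) by []; rewrite -cov => -[d0|d1].
  have rel : loc_rel (chart_den phi0 (mcomp j d tt)) lam0 (chart_ev phi0 d0) z v.
    apply: (chart_form_value oj aU0 b0 phi0C dD Dk ddel del0 _ fz fd).
    by move=> u v'; rewrite dx -qx !hornerE.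
  rewrite zc0 in rel; have -> := loc_rel_cst _ rel _.
  - by rewrite chart_evC // cst_ev_rat.
  - by move=> q qd; apply/ev_basic.
  - exact: chart_lam_inj.
have rel : loc_rel (chart_den phi1 (mcomp j d tt)) lam1 (chart_ev phi1 d1) z v.
  apply: (chart_form_value oj aU1 b1 phi1C dD Dk ddel del1 _ fz fd).
  move=> u v'; set y1 := chart_ev _ _ _; rewrite /r1 !hornerE.
  (* At infinity s = 0: both D 0 and the value of [r1] at 0 vanish. *)
  have [y10|y10] := eqVneq y1 0; first by rewrite y10 (derivation0 (dD u v')) mulr0.
  have d0 : U0 (mcomp j d tt).
    have : (U0 `&` U1) (mcomp j d tt) by rewrite U011; apply/(ev_basic d1).
    by case.
  have e := evX _ d d0 d1; rewrite dx -/y1 in e.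
  rewrite (der_inv _ _ _ _ (dD u v') e) -qx.
  have -> : y1 * y1 * (q0 u v' + q1 u v' * x) =
    (q0 u v' * y1 + q1 u v' * (x * y1)) * y1 by ring.
  by rewrite e mulr1 mulNr.
rewrite zc1 in rel; have -> := loc_rel_cst _ rel _.
- by rewrite chart_evC // cst_ev_rat.
- by move=> q qd; apply/ev_basic.
- exact: chart_lam_inj.
Qed.

End Link.

(** * Smooth charts *)

Lemma pres_map_comp (A B C : comPzRingType) (G H I : choiceType)
  (relA : set (seq (A * G))) (relB : set (seq (B * H))) (relC : set (seq (C * I)))
  (rho : {rmorphism A -> B}) (rho' : {rmorphism B -> C}) (rho'' : {rmorphism A -> C})
  (f : G -> H) (f' : H -> I) (f'' : G -> I) (x : pres relA) :
  (forall r, relB r -> pres_eq relC (Defs.fmap rho' f' r) [::]) ->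
  (forall a, rho' (rho a) = rho'' a) -> (forall g, f' (f g) = f'' g) ->
  pres_map relC rho' f' (pres_map relB rho f x) = pres_map relC rho'' f'' x.
Proof.
move=> fr er ef; rewrite {1}/pres_map [pres_map relC rho'' f'' x]/pres_map.
rewrite -/(pres_map relC rho' f' _) /pres_map -/(pres_map relC rho' f' _) pres_map_pi //.
congr (\pi_ _ _); rewrite /Defs.fmap -map_comp; apply: eq_map => p /=.
by rewrite er ef.
Qed.

Lemma forms_map_comp (k A B C : comPzRingType) (strA : {rmorphism k -> A})
  (strB : {rmorphism k -> B}) (strC : {rmorphism k -> C}) (rho : {rmorphism A -> B})
  (rho' : {rmorphism B -> C}) (rho'' : {rmorphism A -> C}) i m (x : forms strA i m) :
  (forall c, rho' (strB c) = strC c) -> (forall a, rho' (rho a) = rho'' a) ->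
  forms_map strC rho' (forms_map strB rho x) = forms_map strC rho'' x.
Proof.
move=> e er.
have oD (u v : Omega strB) :
    Omega_map strC rho' (u + v) = Omega_map strC rho' u + Omega_map strC rho' v.
  by apply: pres_mapD => r; apply: Omega_map_rel.
have oZ a (u : Omega strB) :
    Omega_map strC rho' (a *: u) = rho' a *: Omega_map strC rho' u.
  by apply: pres_mapZ => r; apply: Omega_map_rel.
have er1 r : @ext_rel B i (Omega strB) r ->
    pres_eq (@ext_rel C i (Omega strC))
      (Defs.fmap rho' (ffun_map (Omega_map strC rho')) r) [::].
  by move=> rr; apply: pres_rel; apply: (ext_rel_map oD oZ rr).
apply: pres_map_comp => // [r rr|f].
  apply: pres_rel; apply: tens_rel_map; last exact: rr.
    by move=> y z; apply: pres_mapD.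
  by move=> a y; apply: pres_mapZ.
apply/ffunP => a; rewrite !ffunE; apply: pres_map_comp => // g.
apply/ffunP => b; rewrite !ffunE; apply: pres_map_comp => // r.
exact: Omega_map_rel.
Qed.

Section PreForms.
Variables (k : fieldType) (X : kscheme k) (i m : nat).

Lemma res_scal (U V : opens X) (h : V `<=` U) c : res h (scal U c) = scal V c.
Proof. by rewrite /scal /= res2; apply: resP. Qed.

Lemma pre_forms_res2 (U V W : opens X) (h : V `<=` U) (h' : W `<=` V) (h'' : W `<=` U)
  (s : pre_forms i m U) : pre_forms_res h' (pre_forms_res h s) = pre_forms_res h'' s.
Proof.
apply: forms_map_comp => [c|a]; first exact: res_scal.
exact: res_res.
Qed.

Lemma pre_forms_res0 (U V : opens X) (h : V `<=` U) :
  pre_forms_res h (0 : pre_forms i m U) = 0.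
Proof.
have D (x y : pre_forms i m U) :
    pre_forms_res h (x + y) = pre_forms_res h x + pre_forms_res h y.
  by apply: forms_mapD => c; apply: res_scal.
by apply: (addrI (pre_forms_res h 0)); rewrite -D !addr0.
Qed.

Lemma germ_res (y : X) (U V : opens X) (h : V `<=` U) (s : pre_forms i m U) :
  V y -> germ y (pre_forms_res h s) = germ y s.
Proof.
move=> Vy; apply/seteqP; split=> -[V' t] [W [h1 [h2 [Wy e]]]] /=.
  exists W, (subset_trans h1 h), h2; split=> //.
  by rewrite -e (pre_forms_res2 _ _ (subset_trans h1 h)).
have [l r] := (@oIl _ W V, @oIr _ W V).
exists (oI W V), r, (subset_trans l h2); split; first by [].
rewrite (pre_forms_res2 _ _ (subset_trans l h1)) -(pre_forms_res2 h1 l) e.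
exact: pre_forms_res2.
Qed.

End PreForms.

Lemma mpoly_ring_ind (R : comNzRingType) n (Q : mpoly n R -> Prop) :
  (forall c, Q (mpolyC n c)) -> (forall l, Q (mpolyX R (mnm1 l))) ->
  (forall p q, Q p -> Q q -> Q (p + q)) -> (forall p q, Q p -> Q q -> Q (p * q)) ->
  forall p, Q p.
Proof.
move=> QC QX QD QM p; rewrite [p]mpolyE.
have Q0 : Q 0 by rewrite -(mpolyC0 n R); apply: QC.
have Q1 : Q 1 by rewrite -(mpolyC1 n R); apply: QC.
apply: (big_ind Q Q0 QD) => u _; rewrite -mul_mpolyC; apply: (QM) => //.
rewrite mpolyXE_id; apply: (big_ind Q Q1 QM) => l _.
by elim: (u l) => [|a IHa]; rewrite ?expr0 // exprS; apply: (QM).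
Qed.

Lemma mderiv_var (R : comNzRingType) n (l l' : 'I_n) :
  mderiv l (mpolyX R (mnm1 l')) = mpolyC n (l == l')%:R.
Proof.
rewrite mderivX mnm1E eq_sym.
case: eqP => [->|_]; last by rewrite scale0r mpolyC0.
rewrite scale1r -[RHS]/(mpolyC n 1) mpolyC1 -mpolyX0; congr (mpolyX _ _).
by apply/mnmP => a; rewrite mnmBE subnn mnm0E.
Qed.

Section UniversalDerivation.
Variables (k A : comPzRingType) (str : {rmorphism k -> A}).
Notation du := (fun a => pgen (Omega_rel str) a).

Lemma pgenD a b : du (a + b) = du a + du b.
Proof.
have := pres_rel0 (Omega_add str a b).
rewrite !big_cons big_nil /= addr0 !scaleN1r scale1r => /eqP.
by rewrite -opprD subr_eq0 => /eqP.
Qed.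

Lemma pgenM a b : du (a * b) = a *: du b + b *: du a.
Proof.
have := pres_rel0 (Omega_leibniz str a b).
rewrite !big_cons big_nil /= addr0 !scaleNr scale1r => /eqP.
by rewrite -opprD subr_eq0 => /eqP.
Qed.

Lemma pgen_cst c : du (str c) = 0.
Proof.
have := pres_rel0 (Omega_cst str c).
by rewrite !big_cons big_nil /= addr0 scale1r.
Qed.

Lemma pgen_spanned (I : finType) (e : I -> Omega str) :
  (forall a, spanned e (du a)) -> forall w, spanned e w.
Proof.
move=> ae; elim/presW=> s; rewrite pres_sum_gen.
by apply: spanned_sum => -[a b] _; apply: spannedZ.
Qed.

End UniversalDerivation.

(** Inverses are unique, so the local inverses that define [basic f] glue. *)
Lemma basic_unit (S : scheme) (U : opens S) (f : sec U) : invertible (res (@basic_sub S U f) f).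
Proof.
pose hF := @basic_sub S U f.
pose F := [set V : opens S | exists (h : V `<=` basic f), invertible (res h (res hF f))].
have inv_uniq (V : opens S) (x y z : sec V) : x * y = 1 -> x * z = 1 -> y = z.
  by move=> xy xz; rewrite -[y]mul1r -xz mulrAC xy mul1r.
have sP (V : opens S) : {b : sec V | F V ->
    forall h : V `<=` basic f, res h (res hF f) * b = 1}.
  apply: cid; have [[h [b hb]]|nF] := pselect (F V); last by exists 0.
  by exists b => _ h'; rewrite (resP h' h).
have [||t tP] := @sec_glue S (basic f) F (fun V => sval (sP V)).
- apply/seteqP; split=> [x [V [h [Vx [b fb]]]]|x [V [h _] /h]] //.
  have h' : V `<=` basic f by move=> y Vy; exists V, h; split=> //; exists b.
  exists V => //; exists h'; exists b.
  by rewrite res2 (resP _ h).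
- move=> V V' W h h' FV FV'; have [[g _] [g' _]] := (FV, FV').
  apply: (inv_uniq _ (res (subset_trans h g) (res hF f))).
    by rewrite -res2 -rmorphM (proj2_sig (sP V)) // rmorph1.
  rewrite (resP _ (subset_trans h' g')).
  by rewrite -res2 -rmorphM (proj2_sig (sP V')) // rmorph1.
exists t; apply/eqP; rewrite -subr_eq0; apply/eqP/sec_locally0 => x [V [h [Vx [b fb]]]].
have h' : V `<=` basic f by move=> y Vy; exists V, h; split=> //; exists b.
have FV : F V by exists h', b; rewrite res2 (resP _ h).
exists V, h'; split=> //; rewrite rmorphB rmorphM rmorph1 (tP _ _ FV).
by rewrite (proj2_sig (sP V)) // subrr.
Qed.

Section SmoothChart.
Variables (k : fieldType) (X : kscheme k) (x : X) (gen_x : generic x).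
Variable (U : opens X).
Hypotheses (aU : affine U) (Ux : U (gpt gen_x tt)).
Variables (c d : nat) (f : 'I_c -> mpoly (c + d) k) (pi : {rmorphism mpoly (c + d) k -> sec U}).
Hypotheses (piC : forall a, pi (mpolyC (c + d) a) = scal U a)
  (pi_surj : forall a, exists p, pi p = a)
  (pi_ker : forall p, pi p = 0 -> exists g : 'I_c -> mpoly (c + d) k, p = \sum_l g l * f l)
  (pif : forall l, pi (f l) = 0)
  (pi_det : invertible (pi (\det (\matrix_(a, b) mderiv (lshift d b) (f a))))).

(** The Jacobian in the first [c] variables is invertible, so the last [d] variables are étale
    coordinates on [U]. *)
Definition smooth_coord (j : 'I_d) : sec U := pi (mpolyX k (mnm1 (rshift c j))).

Notation K := (ff gen_x).
Let lam : {rmorphism mpoly (c + d) k -> K} := ev Ux \o pi.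

(* Implicit differentiation: the derivation of K dual to the coordinates is
   d/dx_(c+j) + sum_l gamma_l d/dx_l with gamma chosen to kill the equations f. *)
Lemma smooth_derivation (j : 'I_d) : exists D : K -> K,
  [/\ derivation id D, forall a, D (ev Ux (scal U a)) = 0
    & forall l, D (ev Ux (smooth_coord l)) = (j == l)%:R].
Proof.
pose J : 'M[K]_c := \matrix_(a, b) lam (mderiv (lshift d b) (f a)).
have Junit : J \in unitmx.
  rewrite unitmxE unitfE; have -> : J = map_mx lam (\matrix_(a, b) mderiv (lshift d b) (f a)).
    by apply/matrixP => a b; rewrite !mxE.
  rewrite det_map_mx /= ; case: pi_det => b pb; apply/eqP => e.
  have : ev Ux (pi (\det (\matrix_(a, b) mderiv (lshift d b) (f a)))) * ev Ux b = 1.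
    by rewrite -rmorphM pb rmorph1.
  by rewrite e mul0r => /esym/eqP; rewrite oner_eq0.
pose B : 'cV[K]_c := \col_a lam (mderiv (rshift c j) (f a)).
(* The solution of J gamma = -B, which is the system [d0 (f a) = 0]. *)
pose gamma := - (invmx J *m B).
pose d0 p := lam (mderiv (rshift c j) p) + \sum_l gamma l 0 * lam (mderiv (lshift d l) p).
have d0D : derivation lam d0.
  split=> p q; rewrite /d0.
    rewrite mderivD rmorphD addrACA -big_split; congr (_ + _).
    by apply: eq_bigr => l _; rewrite mderivD rmorphD mulrDr.
  rewrite mderivM rmorphD !rmorphM !mulrDr !mulr_sumr.
  rewrite [LHS](_ : _ = lam p * lam (mderiv (rshift c j) q) + lam q * lam (mderiv (rshift c j) p)
    + \sum_l (lam p * (gamma l 0 * lam (mderiv (lshift d l) q)) +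
              lam q * (gamma l 0 * lam (mderiv (lshift d l) p)))).
    by rewrite big_split addrACA.
  congr (_ + _); first by rewrite addrC [_ * lam q]mulrC.
  by apply: eq_bigr => l _; rewrite mderivM rmorphD !rmorphM; ring.
have d0f a : d0 (f a) = 0.
  have : (J *m gamma) a 0 = - B a 0 by rewrite mulmxN mulKVmx // mxE.
  rewrite !mxE => e; rewrite /d0 -[lam _]opprK -e addrC; apply/eqP; rewrite subr_eq0.
  by apply/eqP; apply: eq_bigr => l _; rewrite !mxE mulrC.
have d0C a : d0 (mpolyC (c + d) a) = 0.
  by rewrite /d0 mderivC rmorph0 add0r big1 // => l _; rewrite mderivC rmorph0 mulr0.
have [| |D [dD DE]] := derivation_ext d0D.
(* Sections over [U] embed in the function field, so the kernel of [lam] is the ideal of the [f l],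
   on which [d0] vanishes after Leibniz. *)
- move=> p /ev_gpt_eq0 /pi_ker [g ->]; rewrite (derivation_sum _ d0D) big1 // => l _.
  by rewrite (proj2 d0D) d0f mulr0 add0r /lam /= pif rmorph0 mul0r.
- move=> z; have [a [b [b0 ba]]] := ff_frac Ux z aU.
  have [p pa] := pi_surj a; have [q qb] := pi_surj b.
  by exists p, q; rewrite /lam /= pa qb.
exists D; split=> // [a|l]; first by rewrite -piC [D _]DE d0C.
rewrite [D _]DE /d0 mderiv_var big1 => [|l' _].
  rewrite addr0 (inj_eq (@rshift_inj c d)) /lam /= piC.
  by case: (j == l); rewrite !(rmorph0, rmorph1).
rewrite mderiv_var (_ : _ == _ = false) ?mpolyC0 ?rmorph0 ?mulr0 //.
exact: eq_lrshift.
Qed.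

(** The relations [d (f a) = 0] and the invertible Jacobian express the first [c] differentials by
    the last [d]; the quotient rule then passes from [U] to [basic g]. *)
Lemma smooth_spanned (g : sec U) (w : Omega (scal (basic g))) :
  spanned (fun j => pgen (Omega_rel (scal (basic g)))
    (res (@basic_sub X U g) (smooth_coord j))) w.
Proof.
pose Q := basic g; pose rho := res (@basic_sub X U g); pose du := pgen (Omega_rel (scal Q)).
set e := (fun j => _); move: w; apply: pgen_spanned.
pose y (l : 'I_(c + d)) := rho (pi (mpolyX k (mnm1 l))).
have duD a b : du (a + b) = du a + du b by exact: pgenD.
have duM a b : du (a * b) = a *: du b + b *: du a by exact: pgenM.
have chain p : du (rho (pi p)) = \sum_l rho (pi (mderiv l p)) *: du (y l).
  elim/mpoly_ring_ind: p => [a|l|p q IHp IHq|p q IHp IHq].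
  - rewrite piC [rho _]res_scal [du _]pgen_cst big1 // => l _.
    by rewrite mderivC !rmorph0 scale0r.
  - rewrite (bigD1 l) //= mderiv_var eqxx mpolyC1 !rmorph1 scale1r big1 ?addr0 //.
    by move=> l' /negPf l'l; rewrite mderiv_var l'l mpolyC0 !rmorph0 scale0r.
  - rewrite !rmorphD duD IHp IHq -big_split; apply: eq_bigr => l _.
    by rewrite mderivD !rmorphD scalerDl.
  - rewrite !rmorphM duM IHp IHq !scaler_sumr -big_split; apply: eq_bigr => l _.
    by rewrite mderivM !rmorphD !rmorphM scalerDl !scalerA /= addrC [rho (pi q) * _]mulrC.
pose J : 'M[sec Q]_c := \matrix_(a, b) rho (pi (mderiv (lshift d b) (f a))).
have [u Ju] : exists u, u * \det J = 1.
  have -> : J = map_mx (rho \o pi) (\matrix_(a, b) mderiv (lshift d b) (f a)).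
    by apply/matrixP => a b; rewrite !mxE.
  rewrite det_map_mx /=; case: pi_det => b pb; exists (rho b).
  by rewrite mulrC -rmorphM pb rmorph1.
have yr j : spanned e (du (y (rshift c j))) by apply: spanned_gen.
have row a : spanned e (\sum_b J a b *: du (y (lshift d b))).
  have du0 : du 0 = 0 by rewrite -(rmorph0 (scal Q)); apply: pgen_cst.
  have := chain (f a); rewrite pif rmorph0 du0 big_split_ord /= => /eqP.
  rewrite eq_sym addr_eq0 => /eqP rowE.
  rewrite [X in spanned _ X](_ : _ =
    \sum_b rho (pi (mderiv (lshift d b) (f a))) *: du (y (lshift d b))).
    by rewrite rowE; apply/spannedN/spanned_sum => b _; apply: spannedZ.
  by apply: eq_bigr => b _; rewrite mxE.
(* Cramer's rule: the adjugate matrix combines the rows, and [u] inverts the determinant. *)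
have yl l : spanned e (du (y (lshift d l))).
  rewrite -[du _]scale1r -Ju -scalerA; apply: spannedZ.
  have -> : \det J *: du (y (lshift d l)) =
      \sum_a \adj J l a *: \sum_b J a b *: du (y (lshift d b)).
    transitivity (\sum_b (\adj J *m J) l b *: du (y (lshift d b))).
      rewrite mul_adj_mx (bigD1 l) //= mxE eqxx mulr1n big1 ?addr0 // => b /negPf bl.
      by rewrite mxE eq_sym bl mulr0n scale0r.
    transitivity (\sum_b \sum_a (\adj J l a * J a b) *: du (y (lshift d b))).
      by apply: eq_bigr => b _; rewrite mxE scaler_suml.
    rewrite exchange_big; apply: eq_bigr => a _; rewrite scaler_sumr.
    by apply: eq_bigr => b _; rewrite scalerA.
  by apply: spanned_sum => a _; apply: spannedZ.
have duU a : spanned e (du (rho a)).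
  have [p <-] := pi_surj a; rewrite chain; apply: spanned_sum => l _; apply: spannedZ.
  by case: (split_ordP l) => l' ->.
(* A section [b] over [basic g] satisfies g^n b = a for some [a] over [U]; differentiate this
   equation and divide by g^n. *)
move=> b; have [_ _ _ loc] := aU; have [/(_ b) [n [a e1]] _] := loc g.
have [v gv] := basic_unit g; rewrite -/(du b).
have -> : du b = v ^+ n *: (rho (g ^+ n) *: du b).
  by rewrite scalerA rmorphXn -exprMn mulrC gv expr1n scale1r.
apply: spannedZ.
have -> : rho (g ^+ n) *: du b = du (rho a) - b *: du (rho (g ^+ n)).
  by rewrite -e1 duM addrK.
by apply: spannedD => //; apply/spannedN/spannedZ.
Qed.

End SmoothChart.

(** * The generic point *)

Lemma mor_eq_refl (X Y : scheme) (f : morphism X Y) : mor_eq f f.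
Proof. by split=> // *; apply: resP. Qed.

Lemma mor_eq_comp (X Y Z Z' : scheme) (p : morphism Z Z') (h : morphism Y Z)
  (a : morphism X Y) (A : morphism X Z) :
  mor_eq (mcomp h a) A -> mor_eq (mcomp (mcomp p h) a) (mcomp p A).
Proof.
move=> haA; split=> [x|V s W hf hg]; first by rewrite /= -(proj1 haA).
have H1 : W `<=` mpreim a (mpreim h (mpreim p V)) by [].
have H2 : W `<=` mpreim A (mpreim p V) by [].
transitivity (res H1 (pull a _ (pull h _ (pull p V s)))).
  have h2 : mpreim a (mpreim (mcomp p h) V) `<=` mpreim a (mpreim h (mpreim p V)) by [].
  rewrite /= res2 -(pull_res (@comp_preim_sub _ _ _ p h V) h2) res2; exact: resP.
by rewrite (mor_eq_pull _ H1 H2 haA) /= res2; apply: resP.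
Qed.

Section RTrivial.
Variables (k : fieldType) (X : kscheme k) (L : fieldType) (iota : {rmorphism k -> L}).

Lemma point_over_k (a : kmorphism (restr iota (spec L)) X) : point_over iota a.
Proof. by move=> V Va c; rewrite /ev (kmor_scal a V c). Qed.

Lemma mkpt_scal (c : X) (e : forall V : opens X, V c -> {rmorphism sec V -> L}) e_res e_local :
  (forall (V : opens X) (Vc : V c) x, e V Vc (scal V x) = iota x) ->
  forall (V : opens X) x,
  pull (mkpt (e := e) e_res e_local) V (scal V x) =
  scal (X := restr iota (spec L)) (mpreim (mkpt e_res e_local) V) x.
Proof. by move=> eC V x; apply/funext => z; rewrite /= /mkpt_pull_fun eC. Qed.

Variables (i m : nat) (sigma : X -> set {V : opens X & pre_forms i m V}).
Hypotheses (sigmaH : H0_forms X i m sigma) (univ : universally_closed X).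
Variable (D : 'I_m -> 'I_i -> L -> L).
Hypothesis dD : forall a b, derivation id (D a b).
Hypothesis Dk : forall a b c, D a b (iota c) = 0.
Variables (XL : kscheme L) (p : kmorphism (restr iota XL) X).

Definition base_point (A : rat_points XL) : kmorphism (restr iota (spec L)) X :=
  kcomp p (krestr iota A).

(** The link lives on [XL] over [L] and the form on [X] over [k]: composing the curve with the
    projection [p] brings it to [X]. *)
Lemma elem_R_linked_form_at (A B : rat_points XL) va vb : elem_R_linked A B ->
  form_at sigma (base_point A) D va -> form_at sigma (base_point B) D vb -> va = vb.
Proof.
move=> [P [W [j [h [lineP oj [a haA] [b hbB]]]]]] fA fB.
pose H := kcomp p (krestr iota h).
have [za fa] := form_at_ex (mcomp H a) D sigmaH.
have [zb fb] := form_at_ex (mcomp H b) D sigmaH.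
have e (c : rat_points W) (C : rat_points XL) z v : mor_eq (mcomp h c) C ->
    form_at sigma (mcomp H c) D z -> form_at sigma (base_point C) D v -> z = v.
  move=> hcC fz fv; apply: (form_at_unique _ (mor_eq_comp p hcC) dD Dk fz fv).
  exact: (point_over_k (a := kcomp H (krestr iota c))).
rewrite -(e _ _ _ _ haA fa fA) -(e _ _ _ _ hbB fb fB).
exact: (form_at_rational_curve lineP oj univ sigmaH dD Dk fa fb).
Qed.

Lemma R_equiv_form_at (A B : rat_points XL) va vb : R_equiv A B ->
  form_at sigma (base_point A) D va -> form_at sigma (base_point B) D vb -> va = vb.
Proof.
move=> [n [c [<- <- link]]] {A B} f0.
elim: n link vb => [|n IHn] link vb fb.
  have pk := point_over_k (a := base_point (c 0%N)).
  exact: (form_at_unique pk (mor_eq_refl _) dD Dk f0 fb).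
have [v fv] := form_at_ex (base_point (c n)) D sigmaH.
rewrite (IHn _ v fv); last by move=> l ln; apply: link; apply: ltnW.
exact: elem_R_linked_form_at (link n (ltnSn n)) fv fb.
Qed.

End RTrivial.

Section Main.
Variables (k : fieldType) (X : kscheme k) (i m : nat).
Hypotheses (univ : universally_closed X) (Xtriv : almost_R_trivial X).
Hypotheses (i_gt0 : (0 < i)%N) (m_gt0 : (0 < m)%N).
Variable sigma : X -> set {V : opens X & pre_forms i m V}.
Hypothesis sigmaH : H0_forms X i m sigma.

Lemma form_at_generic0 (x : X) (gen_x : generic x)
  (D : 'I_m -> 'I_i -> ff gen_x -> ff gen_x) v :
  (forall a b, derivation id (D a b)) ->
  (forall a b c, D a b (ev (I : oT X (gpt gen_x tt)) (str X c)) = 0) ->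
  form_at sigma (gpt gen_x) D v -> v = 0.
Proof.
pose K : fieldType := ff gen_x; move=> dD Dk fv.
pose iota : {rmorphism k -> K} := ev (I : oT X (gpt gen_x tt)) \o str X.
have Dk' a b c : D a b (iota c) = 0 by exact: Dk.
have [_ [U [dU RU]]] := Xtriv.
have Ux : U x.
  by apply: (proj1 gen_x); have [y [_ Uy]] := dU setT (ex_intro _ x I) openT; exists y.
have etaC (V : opens X) (Vx : V x) c : ff_germ gen_x Vx (scal V c) = iota c.
  have e1 := @ff_germ_res X x gen_x (oT X) V (I : oT X x) Vx (@subsetT _ V) (str X c).
  by apply: etrans e1 _; apply/esym; apply: ev_mkpt.
pose eta : kmorphism (restr iota (spec K)) X :=
  @KMorphism k (restr iota (spec K)) X (gpt gen_x) (mkpt_scal (iota := iota)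
  (@ff_germ_res X x gen_x) (@ff_germ_basic X x gen_x) etaC).
have [XK [p [bc [C CE]]]] := RU K iota.
(* For the trivial extension, the set of classes is a singleton; in particular some [k]-point lies
   over [U]. *)
have [X1 [p1 [_ [C1 C1E]]]] := RU k idfun.
have [A1 UA1 _] : [set R_class A | A in [set A : rat_points X1 | U (p1 (rat_image A))]] C1.
  by rewrite C1E.
pose a1 : morphism (spec_scheme k) X := mcomp p1 A1.
(* The same [k]-point seen with values in the function field: values are first taken in [k], so that
   the derivations kill them. *)
pose e (V : opens X) (Va : V (a1 tt)) : {rmorphism sec V -> K} := iota \o ev Va.
have e_res (V W : opens X) (Va : V (a1 tt)) (Wa : W (a1 tt)) (h : W `<=` V) (s : sec V) :
    e W Wa (res h s) = e V Va s by rewrite /e /= (ev_res Va).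
have e_local (V : opens X) (Va : V (a1 tt)) (s : sec V) : e V Va s != 0 -> basic s (a1 tt).
  move=> es0; apply/(ev_basic Va); apply: contra es0 => /eqP s0.
  by rewrite -[e V Va s]/(iota (ev Va s)) s0 rmorph0.
have eC (V : opens X) (Va : V (a1 tt)) c : e V Va (scal V c) = iota c.
  rewrite /e /=; congr (ev _ (str X _)).
  exact: (point_over_k (iota := idfun) (a := kcomp p1 (krestr idfun A1))).
pose y0 : kmorphism (restr iota (spec K)) X :=
  @KMorphism k (restr iota (spec K)) X (mkpt e_res e_local)
    (mkpt_scal (iota := iota) e_res e_local eC).
have [[u pu] _] := bc (spec K) eta.
have [[w pw] _] := bc (spec K) y0.
have R_class_C (A : rat_points XK) : U (p (rat_image A)) -> R_class A = C.
  move=> UA; suff : [set C] (R_class A) by [].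
  by rewrite -CE; exists A.
(* Both lifts have image in [U], so their classes are the same set [C], and [w] belongs to its own
   class. *)
have uw : R_equiv u w.
  have -> : R_equiv u w = (R_class u : set _) w by [].
  rewrite (R_class_C u); last by rewrite /rat_image -[p _]/(mcomp p u tt) (proj1 pu).
  rewrite -(R_class_C w); last by rewrite /rat_image -[p _]/(mcomp p w tt) (proj1 pw).
  by exists 0%N, (fun=> w).
have [zu fu] := form_at_ex (base_point p u) D sigmaH.
have [zw fw] := form_at_ex (base_point p w) D sigmaH.
have -> : v = zu.
  apply/esym; apply: (form_at_unique (point_over_k (a := base_point p u)) _ dD Dk' fu fv).
  exact: pu.
rewrite (R_equiv_form_at sigmaH univ dD Dk' uw fu fw).
have [V [s [Va sE]]] := sigmaH (a1 tt).
have Vy : V (y0 tt) by [].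
have fy : form_at sigma y0 D (forms_ev (ev Vy) (fun a b f => D a b (ev Vy f)) s).
  by exists V, Vy, s.
rewrite (form_at_unique (point_over_k (a := base_point p w)) pw dD Dk' fw fy).
by apply: forms_ev0 => // a b f; rewrite ev_mkpt Dk'.
Qed.

End Main.

Theorem proposition3p30 (k : fieldType) (X : kscheme k) :
  infinite_set [set: k] ->
  variety X -> proper_scheme X -> smooth X -> geom_connected X ->
  almost_R_trivial X ->
  forall i m : nat, (0 < i)%N -> (0 < m)%N ->
    H0_forms X i m = [set H0_forms_zero X i m].
Proof.
move=> _ _ [_ _ univ] smoothX _ trivX i m i_gt0 m_gt0.
apply/seteqP; split=> [sigma sigmaH|_ ->] /=; last first.
  by move=> x; exists (oT X), 0.
have [x0 gen_x] := integral_generic (proj1 trivX).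
apply/funext => x.
have [U [Ux aU [c [d [f [pi [piC pi_surj pi_ker pi_det]]]]]]] := smoothX x.
have U0 : U (gpt gen_x tt) by apply: (proj1 gen_x); exists x.
have pif l : pi (f l) = 0.
  apply/pi_ker; exists (fun l' => (l' == l)%:R); rewrite (bigD1 l) //= eqxx mul1r.
  by rewrite big1 ?addr0 // => l' /negPf ->; rewrite mul0r.
have pi_ker' p : pi p = 0 -> exists g : 'I_c -> mpoly (c + d) k, p = \sum_l g l * f l.
  by move/pi_ker.
have DP j := cid (smooth_derivation aU U0 piC pi_surj pi_ker' pif pi_det j).
have [V [s [Vx sE]]] := sigmaH x.
(* Shrink to a basic open set on which both the coordinates of [U] and the section [s] are
   available. *)
have [_ _ /(_ (oI U V) x (@oIl _ U V) (conj Ux Vx)) [g [gx gUV]] _] := aU.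
have gV : basic g `<=` V by apply: subset_trans gUV (@oIr _ U V).
have g0 : basic g (gpt gen_x tt) by apply: (proj1 gen_x (basic g)); exists x.
have Dk j a : sval (DP j) (ev U0 (scal U a)) = 0 by case: (DP j) => D [].
have dD j : derivation id (sval (DP j)) by case: (DP j) => D [].
have Dx j l : sval (DP j) (ev U0 (smooth_coord pi l)) = (j == l)%:R by case: (DP j) => D [].
have evk (W : opens X) (W0 : W (gpt gen_x tt)) a :
    ev W0 (scal W a) = ev (I : oT X (gpt gen_x tt)) (str X a) by apply: ev_res.
have s0 : pre_forms_res gV s = 0.
  apply: (forms_eq0 (phi := ev g0)
    (x := fun j => res (@basic_sub X U g) (smooth_coord pi j))
    (D := fun j => sval (DP j) \o ev g0)).
  - exact: ev_gpt_eq0.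
  - exact: (smooth_spanned aU piC pi_surj pif pi_det).
  - by move=> j; apply: (derivation_comp (phi := idfun) (ev g0) (dD j)).
  - by move=> j a /=; rewrite evk -(evk U U0).
  - by move=> j l /=; rewrite (ev_res U0).
  (* The restricted section computes the value of [sigma] at the generic point, which vanishes on
     every choice of dual derivations. *)
  move=> J; apply: (form_at_generic0 univ trivX i_gt0 m_gt0 sigmaH
    (D := fun a b => sval (DP (J a b)))) => [a b|a b e|].
  - exact: dD.
  - by rewrite -(evk U U0).
  - exists (basic g), g0, (pre_forms_res gV s); split=> // y gy.
    by rewrite germ_res // sE //; apply: gV.
have gT : basic g `<=` oT X by [].
by rewrite sE // -(germ_res gV) // s0 -(pre_forms_res0 _ _ gT) germ_res.
Qed.
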